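(* Let $n\ge 2$ be an integer and $1<p<\infty$, $1\leq q\leq\infty$. For $L\in \mathbb{N}$, let $\vec \omega=\{ \omega_l \}_{l=1}^L\subset \mathbb{S}^{n-1}$ be a set consisting of $L$ (distinct) points and let $\{D_l\}_{l=1}^L$ be the optimal transport partition of $\mathbb{S}^{n-1}$ (with exponent $p$) associated to $\vec\omega$ (as defined in the context). Then for all $\mu_1,\mu_2 \in \mathcal{P}_p(\mathbb{R}^n)$, $$\left| \left\| \sum_{l=1}^L \mathrm{MK}^{\mathbb{R}}_p\left( R^{\omega_l}_ \sharp \mu_1, R^{\omega_l}_ \sharp \mu_2\right)\mathbf{1}_{D_l} \right\|_{L^q(\sigma_{n-1})}-\mathrm{MK}_{p,q}(\mu_1,\mu_2)\right| \leq \frac{\alpha_{n,p}}{2}\cdot \mathrm{MK}_p^{\mathbb{S}^{n-1}}(\sigma_{n-1}, \nu_{\vec\omega})^{\frac{p}{n-1+p}}\cdot\left\{\sum_{k=1}^2\left( \int_{\mathbb{R}^n} |x|^p\,d\mu_k(x)\right)^{\frac{1}{p}}\right\}.$$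
   Context: $\mathbb{S}^{n-1}$ is the standard unit sphere in $\mathbb{R}^n$, $d_{\mathbb{S}^{n-1}}$ its Riemannian (geodesic) distance, $\sigma_{n-1}$ the Riemannian volume measure on $\mathbb{S}^{n-1}$ normalized to be a probability measure, $|\mathbb{S}^{n-2}|$ the $(n-2)$-dimensional Hausdorff measure of $\mathbb{S}^{n-2}$ (so $|\mathbb{S}^0|=2$), and $|x|$ the Euclidean norm of $x\in\mathbb{R}^n$. $\mathbf{1}_A$ is the indicator function of $A$; $T_\sharp\mu$ is the push-forward of $\mu$ by $T$; $\mathbb{N}=\{1,2,\dots\}$. For $\vec\omega=\{\omega_l\}_{l=1}^L$, $\nu_{\vec\omega}:=\frac1L\sum_{l=1}^L\delta_{\omega_l}$. For a metric space $(X,d_X)$ and $1\le p<\infty$, $\mathcal{P}_p(X)$ is the set of Borel probability measures on $X$ with finite $p$th moment, and for $\mu,\nu\in\mathcal{P}_p(X)$ $$\mathrm{MK}^{X}_p(\mu, \nu):=\inf_{\gamma\in \Pi(\mu, \nu)}\left(\int_{X\times X} d_X(x, y)^p\,d\gamma(x, y)\right)^{1/p},$$ where $\Pi(\mu,\nu)$ is the set of Borel probability measures on $X\times X$ with left and right marginals $\mu$ and $\nu$. For $X=\mathbb{S}^{n-1}$ the metric is $d_{\mathbb{S}^{n-1}}$; for $X=\mathbb{R}$ it is the usual distance. For $\omega\in\mathbb{S}^{n-1}$, $R^\omega:\mathbb{R}^n\to\mathbb{R}$ is $R^\omega(x):=\langle x,\omega\rangle$. The $(p,q)$-sliced Monge–Kantorovich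 distance between $\mu,\nu\in\mathcal{P}_p(\mathbb{R}^n)$ is $$\mathrm{MK}_{p,q}(\mu,\nu):=\left\| \omega\mapsto \mathrm{MK}^{\mathbb{R}}_p(R^\omega_\sharp\mu,R^\omega_\sharp\nu)\right\|_{L^q(\sigma_{n-1})}.$$ The constants are $$\alpha_{n, p}:=\frac{2}{a_p}\cdot\left\{\frac{|\mathbb{S}^{n-2}|}{n-1}\left(\frac{\sin (a_p\pi)}{a_p\pi} \right)^{n-2}\right\}^{-\frac{1}{n-1+p}},\qquad a_p:=\frac14\sup_{i \in \mathbb{N}} \left( i^{-\frac1p}-i^{-1} \right).$$ Optimal transport partition associated to $\vec\omega$. Let $T_p$ be the optimal map from $\sigma_{n-1}$ to $\nu_{\vec\omega}$ for the cost $d_{\mathbb{S}^{n-1}}^p$, that is, the ($\sigma_{n-1}$-a.e. unique) map defined $\sigma_{n-1}$-a.e. that pushes $\sigma_{n-1}$ forward to $\nu_{\vec\omega}$ and satisfies $\int_{\mathbb{S}^{n-1}} d_{\mathbb{S}^{n-1}}(\omega,T_p(\omega))^p\,d\sigma_{n-1}(\omega)=\mathrm{MK}_p^{\mathbb{S}^{n-1}}(\sigma_{n-1},\nu_{\vec\omega})^p$. The representative used is the following: there are $\lambda_1,\dots,\lambda_L\in\mathbb{R}$ such that $T_p(\omega)=\omega_l$ whenever $k\mapsto d_{\mathbb{S}^{n-1}}(\omega,\omega_k)^p+\lambda_k$ attains its minimum over $\{1,\dots,L\}$ only at $k=l$, and $T_p$ is left undefined on the $\sigma_{n-1}$-null set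 of $\omega$ where the minimum is attained at more than one index. The associated partition is $$D_1:=\overline{T_p^{-1}(\{\omega_1\})},\qquad D_{l+1}:=\overline{T_p^{-1}(\{\omega_{l+1}\})}\setminus \bigcup_{k=1}^lD_k\quad (1\leq l\leq L-1).$$ It is an equal area partition of $\mathbb{S}^{n-1}$: the $D_l$ are disjoint, cover $\mathbb{S}^{n-1}$, and satisfy $\sigma_{n-1}(D_l)=1/L$. *)

(* Defs.v *)
From HB Require Import structures.
From mathcomp Require Import all_boot all_order all_algebra.
From mathcomp Require Import ring lra.
From mathcomp Require Import all_classical all_reals all_analysis.

Set Implicit Arguments.
Unset Strict Implicit.
Unset Printing Implicit Defensive.

Import Order.TTheory GRing.Theory Num.Theory.
Import numFieldNormedType.Exports.

Local Open Scope classical_set_scope.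
Local Open Scope ring_scope.

(* Euclidean structure. The library norm of ['rV[R]_n] is the max norm, which
   has the same topology as [enorm]. *)
Section euclidean.
Context {R : realType} {n : nat}.
Implicit Types u v : 'rV[R]_n.

Definition dot u v : R := \sum_i u 0 i * v 0 i.
Definition enorm u : R := Num.sqrt (dot u u).

Lemma dotC u v : dot u v = dot v u.
Proof. by apply: eq_bigr => i _; rewrite mulrC. Qed.

Lemma dot_ge0 u : 0 <= dot u u.
Proof. by apply: sumr_ge0 => i _; rewrite -expr2 sqr_ge0. Qed.

Lemma enorm_ge0 u : 0 <= enorm u. Proof. exact: sqrtr_ge0. Qed.

Lemma enorm_sq u : enorm u ^+ 2 = dot u u.
Proof. by rewrite sqr_sqrtr// dot_ge0. Qed.

Lemma dotDl u v w : dot (u + v) w = dot u w + dot v w.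
Proof. by rewrite -big_split; apply: eq_bigr => i _; rewrite mxE mulrDl. Qed.

Lemma dotZl a u w : dot (a *: u) w = a * dot u w.
Proof. by rewrite /dot big_distrr/=; apply: eq_bigr => i _; rewrite mxE mulrA. Qed.

Lemma dotDr u v w : dot w (u + v) = dot w u + dot w v.
Proof. by rewrite dotC dotDl !(dotC w). Qed.

Lemma dotZr a u w : dot w (a *: u) = a * dot w u.
Proof. by rewrite dotC dotZl (dotC w). Qed.

Lemma normr_coord_le u i : `|u 0 i| <= enorm u.
Proof.
rewrite -sqrtr_sqr ler_sqrt ?dot_ge0// /dot (bigD1 i)//= -expr2 lerDl.
by apply: sumr_ge0 => j _; rewrite -expr2 sqr_ge0.
Qed.

Lemma enorm_eq0 u : enorm u = 0 -> u = 0.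
Proof.
move=> u0; apply/rowP => i; rewrite mxE; apply/eqP; rewrite -normr_le0 -u0.
exact: normr_coord_le.
Qed.

Lemma dot_le u v : dot u v <= enorm u * enorm v.
Proof.
have [u0|u0] := eqVneq (enorm u) 0.
  rewrite u0 mul0r (enorm_eq0 u0) /dot big1// => i _.
  by rewrite mxE mul0r.
have [v0|v0] := eqVneq (enorm v) 0.
  rewrite v0 mulr0 (enorm_eq0 v0) /dot big1// => i _.
  by rewrite mxE mulr0.
have a0 : 0 < enorm u by rewrite lt_def u0 enorm_ge0.
have b0 : 0 < enorm v by rewrite lt_def v0 enorm_ge0.
have := dot_ge0 (enorm v *: u + (- enorm u) *: v).
rewrite !dotDl !dotDr !dotZl !dotZr (dotC v u) -!enorm_sq.
move: (enorm u) (enorm v) (dot u v) a0 b0 => a b c a0 b0 h.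
have {}h : 0 <= (a * b) * (a * b - c) *+ 2 by rewrite mulr2n; lra.
by move: h; rewrite pmulrn_lge0// pmulr_rge0 ?mulr_gt0// subr_ge0.
Qed.

Lemma enormD u v : enorm (u + v) <= enorm u + enorm v.
Proof.
rewrite -(@ler_pXn2r _ 2) ?nnegrE ?addr_ge0 ?enorm_ge0//.
rewrite enorm_sq dotDl !dotDr (dotC v u) -!enorm_sq sqrrD addrA lerD2r.
by rewrite -addrA lerD2l mulr2n lerD// dot_le.
Qed.

End euclidean.

Section metric_outer_measure.
Local Open Scope ereal_scope.
Context {R : realType} {T : Type}.
Variables (mu : {outer_measure set T -> \bar R}) (f : T -> R).
Hypothesis sep : forall (A B : set T) (e : R), (0 < e)%R ->
  (forall x y, A x -> B y -> (e <= `|f x - f y|)%R) ->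
  mu A + mu B <= mu (A `|` B).

Let t (k : nat) : R := k.+1%:R^-1.

Let t_gt0 k : (0 < t k)%R. Proof. by rewrite invr_gt0. Qed.

Let t_le k l : (k <= l)%N -> (t l <= t k)%R.
Proof. by move=> kl; rewrite lef_pV2 ?posrE// ler_nat. Qed.

Let t_lt k : (t k.+1 < t k)%R.
Proof. by rewrite ltf_pV2 ?posrE// ltr_nat. Qed.

Lemma metric_caratheodory : mu.-caratheodory [set x | (0 < f x)%R].
Proof.
apply: le_caratheodory_measurable => X; set U := [set x | _].
have [->|Xoo] := eqVneq (mu X) +oo; first by rewrite leey.
pose A n := X `&` [set x | (t n < f x)%R].
pose N := X `&` ~` U.
pose ring k := X `&` [set x | (t k.+1 < f x <= t k)%R].
have AN n : mu (A n) + mu N <= mu X.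
  apply: (@le_trans _ _ (mu (A n `|` N))); last first.
    by apply: le_outer_measure; rewrite /A /N -setIUr; exact: subIsetl.
  apply: (sep (t_gt0 n)) => x y [_ /= fx] [_ /negP]; rewrite -leNgt => fy.
  have := t_gt0 n; move: (t n) fx fy => r fx fy r0.
  by rewrite ger0_norm; lra.
have ring_par (b : bool) m :
    \sum_(0 <= k < m) mu (ring (k.*2 + b)%N) <= mu X.
  pose V m := \bigcup_(k in [set k | (k < m)%N]) ring (k.*2 + b)%N.
  apply: (@le_trans _ _ (mu (V m))); last first.
    by apply: le_outer_measure => x [k _ []].
  elim: m => [|m IHm]; first by rewrite big_nil outer_measure_ge0.
  rewrite big_nat_recr//= (le_trans (leeD2r _ IHm))//.
  have VS : V m `|` ring (m.*2 + b)%N `<=` V m.+1.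
    move=> x [[k /= km rk]|rx]; last by exists m => /=.
    by exists k => //=; exact: ltnW.
  apply: le_trans (le_outer_measure mu _ _ VS).
  have [m0|m0] := posnP m.
    by apply: (sep (t_gt0 0)) => x y [k /=]; rewrite m0.
  have d0 : (0 < t (m.*2 + b).-1 - t (m.*2 + b))%R.
    by rewrite subr_gt0 -[in t (m.*2 + b)%N](prednK (n := (m.*2 + b)%N)) ?t_lt//
       addn_gt0 double_gt0 m0.
  apply: (sep d0) => x y [k /= km [_ /andP[fx _]]] [_ /andP[_ fy]].
  have : (t (m.*2 + b).-1 <= t (k.*2 + b).+1)%R.
    apply: t_le; rewrite -ltnS prednK ?addn_gt0 ?double_gt0 ?m0//.
    by rewrite -addSn -addSn leq_add2r -doubleS leq_double.
  move: d0 fx fy; move: (t _) (t _) (t _) => r1 r2 r3 d0 fx fy tt.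
  by rewrite ger0_norm; lra.
have ring_sum : \sum_(0 <= k <oo) mu (ring k) < +oo.
  apply: (@le_lt_trans _ _ (mu X + mu X)).
    apply: lime_le; first by apply: is_cvg_nneseries => n _ _; exact: outer_measure_ge0.
    apply: nearW => n.
    apply: (@le_trans _ _ (\sum_(0 <= k < n.*2) mu (ring k))).
      rewrite [leRHS](big_cat_nat _ (n := n))//= ?leeDl//; last first.
        by rewrite -addnn leq_addl.
      by apply: sume_ge0 => k _; exact: outer_measure_ge0.
    suff -> : \sum_(0 <= k < n.*2) mu (ring k) =
        \sum_(0 <= k < n) mu (ring (k.*2 + false)%N) +
        \sum_(0 <= k < n) mu (ring (k.*2 + true)%N).
      by rewrite leeD// ring_par.
    elim: n => [|n IHn]; first by rewrite !big_nil adde0.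
    rewrite doubleS !big_nat_recr//= IHn addn0 addn1 -!addeA; congr (_ + _).
    by rewrite addeCA.
  by rewrite lte_add_pinfty// ltey.
apply/lee_addgt0Pr => e e0.
have := nneseries_tail_cvg ring_sum (fun k _ => outer_measure_ge0 mu _).
move=> /fine_cvgP [_ /cvgrPdist_lt /(_ _ e0)] [n _ /(_ n (leqnn n))] /=.
set s := \sum_(n <= k <oo) _ => sn.
have sfin : s \is a fin_num.
  rewrite ge0_fin_numE; last by apply: nneseries_ge0 => k _ _; exact: outer_measure_ge0.
  apply: le_lt_trans ring_sum.
  rewrite (nneseries_split 0 n) ?add0n ?leeDr//; last first.
    by move=> k _; exact: outer_measure_ge0.
  by apply: sume_ge0 => k _; exact: outer_measure_ge0.
have se : s <= e%:E.
  rewrite -(fineK sfin) lee_fin; move: sn; rewrite sub0r normrN => /ltW.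
  exact/le_trans/ler_norm.
have XU : mu (X `&` U) <= mu (A n) + s.
  apply: (@le_trans _ _ (mu (A n `|` \bigcup_k ring (k + n)%N))); last first.
    rewrite (le_trans (outer_measureU2 _ _ _))// leeD2l// /s.
    rewrite -(nneseries_addn _ (fun k => outer_measure_ge0 mu (ring k))).
    exact: outer_measure_sigma_subadditive.
  apply: le_outer_measure => x [Xx Ux].
  have [fx|fx] := ltP (t n) (f x); [by left|right].
  have [m mP] : exists m, (t m < f x)%R.
    exists (Num.truncn (f x)^-1); rewrite /t -[ltRHS]invrK ltf_pV2 ?posrE ?invr_gt0//.
    by rewrite truncnS_gt// invr_ge0 ltW.
  have exm : exists m, (t m < f x)%R by exists m.
  case: (ex_minnP exm) => -[|l] lP lmin.
    by have := lt_le_trans lP fx; rewrite ltNge t_le.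
  have ln : (n <= l)%N.
    by rewrite leqNgt; apply/negP => /t_le ln;
      have := lt_le_trans (le_lt_trans ln lP) fx; rewrite ltxx.
  exists (l - n)%N => //; rewrite subnK//; split => //=; rewrite lP/=.
  by rewrite leNgt; apply/negP => /lmin; rewrite ltnn.
rewrite (le_trans (leeD2r _ XU))// addeAC leeD// AN.
Qed.

End metric_outer_measure.

(* Volume of the unit ball of R^k, by the recursion
   omega_(k+2) = 2 pi / (k + 2) * omega_k. *)
Fixpoint ball_volume {R : realType} (k : nat) : R :=
  match k with
  | 0 => 1
  | 1 => 2
  | k'.+2 => 2 * pi / k%:R * ball_volume k'
  end.

Section hausdorff_definition.
Local Open Scope ereal_scope.
Context {R : realType} {T : Type}.
Variables (d : T -> T -> R) (k : nat).

Definition diameter (A : set T) : \bar R :=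
  ereal_sup [set (d z.1 z.2)%:E | z in A `*` A].

(* The normalization makes the Hausdorff measure of dimension k agree with
   the k-dimensional volume; for k = 0 every nonempty set weighs 1. *)
Definition hausdorff_weight (A : set T) : \bar R :=
  if A == set0 then 0 else (ball_volume k / 2 ^+ k)%:E * diameter A ^+ k.

Definition hausdorff_size (delta : R) (A : set T) : \bar R :=
  ereal_inf [set \sum_(i <oo) hausdorff_weight (F i) | F in
    [set F : (set T)^nat | (forall i, diameter (F i) <= delta%:E) /\
                           A `<=` \bigcup_i F i]].

Definition hausdorff (A : set T) : \bar R :=
  ereal_sup [set hausdorff_size delta A | delta in [set delta | (0 < delta)%R]].

End hausdorff_definition.

Lemma ball_volume_ge0 {R : realType} k : 0 <= ball_volume k :> R.
Proof.
suff: (0 <= ball_volume k :> R) /\ (0 <= ball_volume k.+1 :> R) by case.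
elim: k => [|k [IH1 IH2]]; first by rewrite /= ler01 ler0n.
split => //; rewrite [ball_volume k.+2]/=.
by rewrite mulr_ge0// divr_ge0// mulr_ge0// pi_ge0.
Qed.

(* The sets of diameter at most delta form a semiring of sets: this makes
   [hausdorff_size delta] an instance of [mu_ext]. *)
Module SmallSets.
Definition small_display : measure_display.
Proof. exact: (sigma_display (set0 : set (set bool))). Qed.

Definition small {R : realType} {T : Type} (d : T -> T -> R) (delta : R) := T.

Section small_sets.
Context {R : realType} {T : pointedType}.
Variables (d : T -> T -> R) (delta : R).

Definition small_set (A : set T) : Prop := (diameter d A <= delta%:E)%E.

Lemma small_subset A B : A `<=` B -> small_set B -> small_set A.
Proof.
rewrite /small_set => AB; apply: le_trans.
apply: ereal_sup_le => _ [[x y] [Ax Ay] <-].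
by exists (x, y) => //; split; exact: AB.
Qed.

Lemma small_set0 : small_set set0.
Proof. by apply: ge_ereal_sup => ? [[x y] [[]]]. Qed.

Lemma small_setI : setI_closed small_set.
Proof. by move=> A B sA _; apply: small_subset sA; exact: subIsetl. Qed.

Lemma small_semi_setD : semi_setD_closed small_set.
Proof.
move=> A B sA _; exists [set A `\` B]; split.
- exact: finite_set1.
- by move=> _ ->; apply: small_subset sA; exact: subDsetl.
- by rewrite bigcup_set1.
- by move=> C D -> ->.
Qed.

HB.instance Definition _ := Pointed.on (small d delta).
HB.instance Definition _ := @isSemiRingOfSets.Build small_display (small d delta)
  small_set small_set0 small_setI small_semi_setD.

End small_sets.
End SmallSets.
Import SmallSets.

Section hausdorff_outer_measure.
Local Open Scope ereal_scope.
Context {R : realType} {T : pointedType}.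
Variables (d : T -> T -> R) (k : nat).
Hypothesis d_ge0 : forall x y, (0 <= d x y)%R.

Let w := hausdorff_weight d k.
Let Hs := hausdorff_size d k.
Let H := hausdorff d k.

Let w0 : w set0 = 0. Proof. by rewrite /w /hausdorff_weight eqxx. Qed.

Let w_ge0 A : 0 <= w A.
Proof.
rewrite /w /hausdorff_weight; case: ifPn => // /set0P[x Ax].
apply: mule_ge0; first by rewrite lee_fin divr_ge0 ?ball_volume_ge0.
apply: expe_ge0; apply: le_ereal_sup_tmp.
by exists (d x x)%:E; [exists (x, x)|rewrite lee_fin].
Qed.

Let HsE delta : Hs delta = @mu_ext _ (small d delta) R w.
Proof. by []. Qed.

Let Hs0 delta : Hs delta set0 = 0.
Proof. by rewrite HsE; exact: mu_ext0. Qed.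

Let Hs_ge0 delta A : 0 <= Hs delta A.
Proof. by rewrite HsE; exact: mu_ext_ge0. Qed.

Let le_Hs delta : {homo Hs delta : A B / A `<=` B >-> A <= B}.
Proof. by move=> A B AB; rewrite HsE; exact: le_mu_ext. Qed.

Let Hs_sigma_subadditive delta : sigma_subadditive (Hs delta).
Proof. by exact: (@mu_ext_sigma_subadditive _ (small d delta) R w w_ge0). Qed.

Let Hs_le_H delta A : (0 < delta)%R -> Hs delta A <= H A.
Proof. by move=> d0; apply: ereal_sup_ubound; exists delta. Qed.

Lemma hausdorff0 : hausdorff d k set0 = 0.
Proof.
apply/eqP; rewrite eq_le; apply/andP; split.
  by apply: ge_ereal_sup => _ [e e0 <-]; rewrite -[X in X <= _]/(Hs e set0) Hs0.
by rewrite -(Hs0 1); exact: Hs_le_H.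
Qed.

Lemma hausdorff_ge0 A : 0 <= hausdorff d k A.
Proof. exact: le_trans (Hs_ge0 1 A) (Hs_le_H _ ltr01). Qed.

Lemma le_hausdorff : {homo hausdorff d k : A B / A `<=` B >-> A <= B}.
Proof.
move=> A B AB; apply: ge_ereal_sup => _ [e e0 <-].
exact: le_trans (le_Hs e AB) (Hs_le_H _ e0).
Qed.

Lemma hausdorff_sigma_subadditive : sigma_subadditive (hausdorff d k).
Proof.
move=> F; apply: ge_ereal_sup => _ [e e0 <-].
apply: le_trans (Hs_sigma_subadditive e F) _.
by apply: lee_nneseries => i _ //; exact: Hs_le_H.
Qed.

Lemma hausdorff_separated (A B : set T) (e : R) : (0 < e)%R ->
  (forall x y, A x -> B y -> (e <= d x y)%R) ->
  hausdorff d k A + hausdorff d k B <= hausdorff d k (A `|` B).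
Proof.
move=> e0 AB.
have Hs_anti A' (r s : R) : (r <= s)%R -> Hs s A' <= Hs r A'.
  move=> rs; apply: ereal_inf_le_tmp => _ [F [dF AF] <-]; exists F => //.
  by split => // i; apply: le_trans (dF i) _; rewrite lee_fin.
have Hs_sep (r : R) : (0 < r)%R -> (r < e)%R ->
    Hs r A + Hs r B <= Hs r (A `|` B).
  move=> r0 re; apply: le_ereal_inf_tmp => _ [F [dF ABF] <-].
  pose FA (C : set T) i := if `[< F i `&` C !=set0 >] then F i else set0.
  have FAle C : C `<=` A `|` B -> Hs r C <= \sum_(i <oo) w (FA C i).
    move=> CAB; apply: ereal_inf_lbound; exists (FA C) => //; split.
      move=> i; rewrite /FA; case: ifPn => // _.
      by apply: ge_ereal_sup => ? [[x y] [[]]].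
    move=> x Cx; have [i _ Fix] := ABF _ (CAB _ Cx); exists i => //.
    by rewrite /FA; case: asboolP => // -[]; exists x.
  apply: le_trans (leeD (FAle A (@subsetUl _ _ _)) (FAle B (@subsetUr _ _ _))) _.
  rewrite -nneseriesD//; apply: lee_nneseries => [i _ _|i _]; first exact: adde_ge0.
  rewrite /FA; case: asboolP => [[x [Fx Ax]]|_]; last first.
    by case: ifPn => _; rewrite w0 add0e// w_ge0.
  case: asboolP => [[y [Fy By]]|_]; last by rewrite w0 adde0.
  have dxy : (d x y)%:E <= diameter d (F i).
    by apply: ereal_sup_ubound; exists (x, y).
  have := le_trans dxy (dF i); rewrite lee_fin => dr.
  by have := le_lt_trans (le_trans (AB _ _ Ax By) dr) re; rewrite ltxx.
have HsepH (r : R) : (0 < r)%R -> (r < e)%R ->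
    Hs r A + Hs r B <= hausdorff d k (A `|` B).
  by move=> r0 re; apply: le_trans (Hs_sep r r0 re) (Hs_le_H _ r0).
have step (r s : R) : (0 < r)%R -> (0 < s)%R ->
    Hs r A + Hs s B <= hausdorff d k (A `|` B).
  move=> r0 s0; pose m := (Num.min (Num.min r s) (e / 2))%R.
  have m0 : (0 < m)%R by rewrite !lt_min r0 s0 divr_gt0.
  have me : (m < e)%R.
    by rewrite gt_min ltr_pdivrMr// ltr_pMr// ltr1n orbT.
  apply: le_trans (HsepH m m0 me); apply: leeD; apply: Hs_anti.
    by rewrite !ge_min lexx.
  by rewrite !ge_min lexx orbT.
have [Hoo|Hoo] := eqVneq (hausdorff d k (A `|` B)) +oo; first by rewrite Hoo leey.
have Hfin : hausdorff d k (A `|` B) \is a fin_num.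
  by rewrite ge0_fin_numE ?ltey// hausdorff_ge0.
have Hlt : hausdorff d k (A `|` B) < +oo by rewrite ltey.
have HAle : hausdorff d k A <= hausdorff d k (A `|` B).
  by apply: le_hausdorff; exact: subsetUl.
have HBle : hausdorff d k B <= hausdorff d k (A `|` B).
  by apply: le_hausdorff; exact: subsetUr.
have Bfin (s : R) : (0 < s)%R -> Hs s B \is a fin_num.
  move=> s0; rewrite ge0_fin_numE//.
  exact: le_lt_trans (Hs_le_H _ s0) (le_lt_trans HBle Hlt).
have Afin : hausdorff d k A \is a fin_num.
  by rewrite ge0_fin_numE ?hausdorff_ge0//; exact: le_lt_trans HAle Hlt.
rewrite -leeBrDl//; apply: ge_ereal_sup => _ [s s0 <-].
rewrite leeBrDl//.
rewrite -leeBrDr ?Bfin//; apply: ge_ereal_sup => _ [r r0 <-].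
by rewrite leeBrDr ?Bfin//; exact: step.
Qed.

End hausdorff_outer_measure.

HB.instance Definition _ (R : realType) (n : nat) :=
  Measurable.copy 'rV[R]_n (g_sigma_algebraType (@open 'rV[R]_n)).

(* The unit sphere of R^n, with the topology induced by R^n. The Borel
   sigma-algebra is declared on [sphere R n.+1]: for n = 0 the sphere is empty,
   whereas measurable types are pointed. *)
Definition sphere (R : realType) (n : nat) : Type :=
  set_type [set x : 'rV[R]_n | enorm x = 1].

HB.instance Definition _ (R : realType) (n : nat) :=
  Topological.copy (sphere R n) (set_type [set x : 'rV[R]_n | enorm x = 1]).

Definition pole {R : realType} {n : nat} : 'rV[R]_n.+1 := delta_mx 0 0.

Lemma enorm_pole (R : realType) n : enorm (@pole R n) = 1.
Proof.
rewrite /enorm /dot (bigD1 ord0)//= big1 ?addr0.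
  by rewrite mxE !eqxx mulr1 sqrtr1.
by move=> i i0; rewrite mxE (negbTE i0) andbF mul0r.
Qed.

HB.instance Definition _ (R : realType) (n : nat) :=
  isPointed.Build (sphere R n.+1)
    (exist _ pole (mem_set (enorm_pole R n))).

HB.instance Definition _ (R : realType) (n : nat) :=
  Measurable.copy (sphere R n.+1) (g_sigma_algebraType (@open (sphere R n.+1))).

Section sphere_geometry.
Context {R : realType} {n : nat}.
Implicit Types x y : sphere R n.

Definition sphere_point x : 'rV[R]_n := set_val x.

(* Geodesic distance on the round sphere: the angle between x and y. *)
Definition sphere_dist x y : R := acos (dot (sphere_point x) (sphere_point y)).

Definition chord x y : R := enorm (sphere_point x - sphere_point y).

(* Riemannian volume of the round sphere of R^n, as the (n-1)-dimensional
   Hausdorff measure. The chordal and the geodesic distances give the same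
   measure, since their ratio tends to 1 at small scale. *)
Definition sphere_hausdorff : set (sphere R n) -> \bar R :=
  hausdorff chord n.-1.

End sphere_geometry.

(* [sphere_area R n] is |S^(n-1)|, the area of the unit sphere of R^n; it is
   finite, so that [fine] loses nothing. *)
Definition sphere_area (R : realType) (n : nat) : R :=
  fine (@sphere_hausdorff R n [set: sphere R n]).

Section sphere_volume.
Context {R : realType} {n : nat}.
Local Notation S := (sphere R n.+1).

Lemma chord_ge0 (x y : S) : 0 <= chord x y. Proof. exact: enorm_ge0. Qed.

HB.instance Definition _ := isOuterMeasure.Build R S sphere_hausdorff
  (hausdorff0 n chord_ge0) (hausdorff_ge0 n chord_ge0)
  (@le_hausdorff R S chord n) (hausdorff_sigma_subadditive n chord_ge0).

Lemma open_caratheodory (U : set S) : open U ->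
  caratheodory_measurable sphere_hausdorff U.
Proof.
case=> V oV <-.
have [V0|/set0P[z0 Vz0]] := eqVneq (~` V) set0.
  rewrite (_ : set_val @^-1` V = ~` set0); last first.
    rewrite setC0; apply/seteqP; split => // x _ /=; apply: contrapT => Vx.
    by have : (~` V) (set_val x) by []; rewrite V0.
  apply: caratheodory_measurable_setC.
  exact: (caratheodory_measurable_set0 sphere_hausdorff).
pose D (x : S) := [set enorm (sphere_point x - z) | z in ~` V].
have D0 x : D x !=set0 by exists (enorm (sphere_point x - z0)), z0.
have Dlb x : lbound (D x) 0 by move=> _ [z _ <-]; exact: enorm_ge0.
pose f (x : S) : R := inf (D x).
have fle x y : f x - f y <= chord x y.
  rewrite lerBlDl -lerBlDr; apply: lb_le_inf => // _ [z Vz <-].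
  rewrite lerBlDr; apply: le_trans (ge_inf _ _) _; first by exists 0.
    by exists z.
  rewrite (_ : sphere_point x - z = (sphere_point y - z) +
    (sphere_point x - sphere_point y)) ?enormD//.
  by rewrite [RHS]addrC subrKA.
rewrite (_ : set_val @^-1` V = [set x | 0 < f x]).
  apply: metric_caratheodory => A B e e0 AB.
  apply: (hausdorff_separated n chord_ge0 e0) => x y Ax By.
  apply: le_trans (AB _ _ Ax By) _; rewrite ler_norml fle andbT lerNl opprB.
  apply: le_trans (fle _ _) _.
  by rewrite /chord /enorm -opprB /dot; under eq_bigr do rewrite mxE mulrNN.
apply/seteqP; split => x /=; last first.
  move=> fx; apply: contrapT => Vx; move: fx; rewrite ltNge => /negP; apply.
  apply: ge_inf; first by exists 0.
  exists (set_val x) => //; rewrite /sphere_point subrr /enorm /dot big1 ?sqrtr0//.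
  by move=> i _; rewrite mxE mul0r.
move=> Vx; have /nbhs_ballP[e /= e0 eV] := open_nbhs_nbhs (conj oV Vx).
apply: (lt_le_trans e0); apply: lb_le_inf => // _ [z Vz <-].
rewrite leNgt; apply/negP => xz; apply: Vz; apply: eV; split => // i j.
rewrite /ball/= (ord1 i); apply: le_lt_trans xz.
by have := normr_coord_le (sphere_point x - z) j; rewrite !mxE.
Qed.

Lemma borel_caratheodory (U : set S) : measurable U ->
  caratheodory_measurable sphere_hausdorff U.
Proof.
apply: smallest_sub; last exact: open_caratheodory.
split => [|A|F].
- exact: (caratheodory_measurable_set0 sphere_hausdorff).
- by rewrite setTD; exact: caratheodory_measurable_setC.
- exact: caratheodory_measurable_bigcup.
Qed.

Let sphere_hausdorff_sigma_additive :
  semi_sigma_additive (sphere_hausdorff : set S -> \bar R).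
Proof.
move=> F mF tF _.
apply: (@caratheodory_measure_sigma_additive R S sphere_hausdorff) => //.
  by move=> i; exact: borel_caratheodory.
apply: caratheodory_measurable_bigcup => i; exact: borel_caratheodory.
Qed.

HB.instance Definition _ := isMeasure.Build _ S R sphere_hausdorff
  (hausdorff0 n chord_ge0) (hausdorff_ge0 n chord_ge0)
  sphere_hausdorff_sigma_additive.

End sphere_volume.

(* The area of the sphere is positive and finite, so [mnormalize] divides by it
   and never uses its default value [dirac point]. *)
Definition sphere_prob (R : realType) (n : nat) : probability (sphere R n.+1) R :=
  mnormalize (@sphere_hausdorff R n.+1) (dirac point).

Section projection.
Context {R : realType} {n : nat}.

Definition slice_map (w : sphere R n) (x : 'rV[R]_n) : R := dot x (sphere_point w).

Lemma measurable_slice_map (w : sphere R n) : measurable_fun setT (slice_map w).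
Proof.
have /continuousP cproj : continuous (slice_map w).
  apply: continuous_big => [|i _]; first exact: add_continuous.
  move=> x; apply: cvgMr_tmp; first exact: (@nbhs_filter _ x).
  exact: coord_continuous.
apply: (measurability _ (measurable_realfun.RGenOpens.measurableE R)) => _ [_ [a [b ->] <-]].
rewrite setTI; apply: sub_sigma_algebra; apply: cproj.
exact: interval_open.
Qed.

HB.instance Definition _ (w : sphere R n) :=
  isMeasurableFun.Build _ _ _ _ (slice_map w) (measurable_slice_map w).

End projection.

Section transport.
Local Open Scope ereal_scope.
Context {d : measure_display} {T : measurableType d} {R : realType}.

(* The measurable sets of the product type form the product sigma-algebra,
   which is the Borel one for the separable spaces considered here. *)
Definition couplings (mu nu : {measure set T -> \bar R}) :
    set (probability (T * T)%type R) :=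
  [set g | forall A, measurable A ->
    g (A `*` setT) = mu A /\ g (setT `*` A) = nu A].

Definition MK (dist : T -> T -> R) (p : R) (mu nu : {measure set T -> \bar R}) :
    \bar R :=
  ereal_inf [set (\int[g]_z ((dist z.1 z.2) `^ p)%:E) `^ p^-1 |
             g in couplings mu nu].

End transport.

Section empirical.
Local Open Scope ereal_scope.
Context {d : measure_display} {T : measurableType d} {R : realType} {L : nat}.
Variable w : 'I_L -> T.

Definition empirical (A : set T) : \bar R :=
  (L%:R^-1)%R%:E * \sum_(l < L) \d_(w l) A.

Let point_mass (k : nat) : {measure set T -> \bar R} :=
  if insub k is Some l then \d_(w l) else mzero.

Let empiricalE : empirical =
  mscale ((L%:R^-1)%:nng : {nonneg R})%R (msum point_mass L).
Proof.
apply/funext => A; rewrite /empirical /mscale /msum/=; congr (_ * _)%E.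
by apply: eq_bigr => i _; rewrite /point_mass valK.
Qed.

Let empirical0 : empirical set0 = 0.
Proof. by rewrite empiricalE measure0. Qed.

Let empirical_ge0 A : 0 <= empirical A.
Proof. by rewrite empiricalE measure_ge0. Qed.

Let empirical_sigma_additive : semi_sigma_additive empirical.
Proof. by rewrite empiricalE; exact: measure_semi_sigma_additive. Qed.

HB.instance Definition _ := isMeasure.Build _ _ _ empirical
  empirical0 empirical_ge0 empirical_sigma_additive.

End empirical.

Definition rdist {R : realType} (x y : R) : R := `|x - y|.

Definition moment {R : realType} {n : nat} (p : R)
    (mu : probability 'rV[R]_n R) : \bar R :=
  (\int[mu]_x (enorm x `^ p)%:E)%E.

Definition sliceMK {R : realType} {n : nat} (p : R)
    (mu1 mu2 : probability 'rV[R]_n R) (w : sphere R n) : \bar R :=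
  MK rdist p (distribution mu1 (slice_map w)) (distribution mu2 (slice_map w)).

Definition slicedMK {R : realType} {n : nat} (p : R) (q : \bar R)
    (mu1 mu2 : probability 'rV[R]_n.+1 R) : \bar R :=
  'N[sphere_prob R n]_q [sliceMK p mu1 mu2].

Section constants.
Context {R : realType}.

Definition a_const (p : R) : R :=
  4^-1 * sup [set i%:R `^ (- p^-1) - i%:R^-1 | i in [set i | (0 < i)%N]].

(* [sphere_area R n.-1] is |S^(n-2)|. *)
Definition alpha_const (n : nat) (p : R) : R :=
  2 / a_const p *
  (sphere_area R n.-1 / (n%:R - 1) *
   (sin (a_const p * pi) / (a_const p * pi)) ^+ n.-2) `^ (- (n%:R - 1 + p)^-1).

End constants.

Section partition.
Context {R : realType} {n L : nat}.
Local Notation S := (sphere R n.+1).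
Variables (p : R) (w : 'I_L -> S).

Definition sphereMK : \bar R :=
  MK sphere_dist p (sphere_prob R n) (empirical w).

Definition strict_cell (lam : 'I_L -> R) (l : 'I_L) : set S :=
  [set x | forall k, k != l ->
    sphere_dist x (w l) `^ p + lam l < sphere_dist x (w k) `^ p + lam k].

(* A partially defined map is a map to an option type; x is outside the domain
   when the minimum of the first clause is attained at several indices. The
   second clause, for A the whole sphere, makes T defined almost everywhere. *)
Definition is_optimal_map (T : S -> option S) : Prop :=
  [/\ exists lam : 'I_L -> R, forall x y,
        T x = Some y <-> exists2 l, w l = y & strict_cell lam l x,
      forall A : set S, measurable A ->
        sphere_prob R n (T @^-1` (Some @` A)) = empirical w A
    & (\int[sphere_prob R n]_x
         (if T x is Some y then sphere_dist x y `^ p else 0)%:E =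
       sphereMK `^ p)%E].

Definition is_transport_partition (D : 'I_L -> set S) : Prop :=
  exists2 T, is_optimal_map T &
    forall l, D l = closure (T @^-1` [set Some (w l)]) `\`
                    \bigcup_(k in [set k : 'I_L | (k < l)%N]) D k.

End partition.

(* Main.v *)
Require Import Defs.
From HB Require Import structures.
From mathcomp Require Import all_boot all_order all_algebra.
From mathcomp Require Import ring lra zify.
From mathcomp Require Import all_classical all_reals all_analysis.
From mathcomp Require Import measurable_realfun ess_sup_inf.

Set Implicit Arguments.
Unset Strict Implicit.
Unset Printing Implicit Defensive.

Import Order.TTheory GRing.Theory Num.Theory.
Import numFieldNormedType.Exports.
Import SmallSets.

Local Open Scope classical_set_scope.
Local Open Scope ring_scope.

(* Let T be the optimal map, x a point of the closure of the l-th cell and r its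
   distance to w_l. Optimality forces T to move every point of the ball of radius
   proportional to r around the midpoint of x and w_l by a distance of order r,
   so that W^p, the cost of T, is at least of order r^p sigma(ball), that is
   r^(n-1+p). With explicit constants this is r <= (alpha / 2) W^(p / (n-1+p)).
   As omega |-> MK_p(R^omega mu_1, R^omega mu_2) is Lipschitz, with constant the
   sum of the two moments, replacing omega by w_l in the l-th cell changes it
   uniformly by at most the right-hand side, and Minkowski's inequality concludes.

   The measure of a ball is bounded below relatively to the whole sphere by
   comparing thin zones through conformal dilations and integrating over their
   heights; the area of the sphere itself, as a Hausdorff measure, is bounded
   above by a Vitali covering argument with small caps. *)

(** The measure sigma is normalized, whereas alpha contains the unnormalized |S^(n-2)|. The estimate
    for balls only involves the integral of sin^(n-2) over [0, rho] relative to the one over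
    [0, pi], so inserting |S^(n-2)| costs a factor, |S^(n-2)| times the full integral, which is
    classically |S^(n-1)| = 2 pi omega_(n-2) with omega_k the volume of the unit ball. Hence the
    need for upper bounds of Hausdorff areas. For p >= 2 this factor, at most 35 in every dimension,
    is absorbed by the smallness of a_p, because (4 a_p)^(p+1) <= 1/35.

    For 1 < p < 2 the monotonicity of T degenerates as p tends to 1: the displacement obtained is
    only of order (p - 1) r, on a ball of radius of order sqrt (p - 1) r. Room is left here by a_p
    <= 3/32 (p - 1), which is far below sqrt (p - 1). This is why the two ranges of p are treated
    apart, with their own ratios. *)

Section real_analysis.
Context {R : realType}.
Implicit Types x y z p k s u v A B : R.

(** * Calculus and spherical trigonometry *)

Lemma is_derive_ge0_le (f df : R -> R) a b : a <= b ->
  (forall x, is_derive x 1 f (df x)) ->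
  (forall x, a <= x <= b -> 0 <= df x) -> f a <= f b.
Proof.
move=> ab fdf df0.
have cf : {within `[a, b], continuous f}.
  apply: continuous_subspaceT => x; apply: differentiable_continuous.
  by apply/derivable1_diffP; have [] := fdf x.
have [c] := MVT_segment ab (fun x _ => fdf x) cf.
rewrite in_itv/= => cab; rewrite -subr_ge0 => ->.
by rewrite mulr_ge0 ?subr_ge0// df0.
Qed.

Lemma sin_le x : 0 <= x -> sin x <= x.
Proof.
move=> x0; rewrite -subr_ge0.
have := @is_derive_ge0_le (fun y => y - sin y) (fun y => 1 - cos y) 0 x x0.
by rewrite sin0 subr0; apply => y _; rewrite subr_ge0 cos_le1.
Qed.

Lemma cos_ge x : 0 <= x -> 1 - x ^+ 2 / 2 <= cos x.
Proof.
move=> x0; rewrite -subr_ge0.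
have := @is_derive_ge0_le (fun y => cos y - (1 - y ^+ 2 / 2)) (fun y => y - sin y) 0 x x0.
rewrite cos0 expr0n mul0r subr0 subrr; apply => [y|y /andP[y0 _]].
  by apply: is_derive_eq; rewrite !scaler1 /GRing.scale/=; lra.
by rewrite subr_ge0 sin_le.
Qed.

Lemma sin_ge x : 0 <= x -> x - x ^+ 3 / 6 <= sin x.
Proof.
move=> x0; rewrite -subr_ge0.
have := @is_derive_ge0_le (fun y => sin y - (y - y ^+ 3 / 6)) (fun y => cos y - (1 - y ^+ 2 / 2)) 0 x x0.
rewrite sin0 expr0n mul0r !subr0; apply => [y|y /andP[y0 _]].
  by apply: is_derive_eq; rewrite !scaler1 /GRing.scale/=; lra.
by rewrite subr_ge0 cos_ge.
Qed.

Lemma cos_le x : 0 <= x -> cos x <= 1 - x ^+ 2 / 2 + x ^+ 4 / 24.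
Proof.
move=> x0; rewrite -subr_ge0.
have := @is_derive_ge0_le (fun y => 1 - y ^+ 2 / 2 + y ^+ 4 / 24 - cos y) (fun y => sin y - (y - y ^+ 3 / 6)) 0 x x0.
rewrite cos0 !expr0n !mul0r subr0 addr0 subrr; apply => [y|y /andP[y0 _]].
  by apply: is_derive_eq; rewrite !scaler1 /GRing.scale/=; lra.
by rewrite subr_ge0 sin_ge.
Qed.

Lemma pi_le : pi <= 16 / 5 :> R.
Proof.
(* If pi / 2 exceeded 8/5, then cos (8/5) would be positive; but cos (4/5) <= 7/10, and the doubling
   formula yields at most 2 * (7/10)^2 - 1 < 0. *)
rewrite leNgt; apply/negP => pi_gt.
have : 0 < cos (8 / 5) :> R.
  by apply: cos_gt0_pihalf; apply/andP; split; lra.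
have := @cos_le (4 / 5); have := @cos_gt0_pihalf R (4 / 5).
have -> : 8 / 5 = (4 / 5) *+ 2 :> R by rewrite -mulr_natr; lra.
rewrite cos_mulr2n -[_ *+ 2]mulr_natr.
set c := cos _ => h1 h2; have c0 : 0 < c by apply: h1; apply/andP; split; lra.
have : c <= 7 / 10 by apply: le_trans (h2 _) _; lra.
by move=> c7; nra.
Qed.

(** With l = x / y, the function sin (l z) - l sin z of z has derivative l (cos (l z) - cos z) >= 0,
    as cos decreases on [0, pi]. *)
Lemma sin_div_noninc x y : 0 <= x -> x <= y -> y <= pi -> x * sin y <= y * sin x.
Proof.
move=> x0; rewrite le_eqVlt => /predU1P[->//|xy ypi].
have y0 : 0 < y by exact: le_lt_trans xy.
pose l := x / y.
have l0 : 0 <= l by rewrite divr_ge0// ltW.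
have l1 : l <= 1 by rewrite ler_pdivrMr// mul1r ltW.
suff : l * sin y <= sin (l * y).
  rewrite /l divfK ?gt_eqF// mulrAC ler_pdivrMr//.
  by rewrite [sin x * _]mulrC.
rewrite -subr_ge0.
have := @is_derive_ge0_le (fun z => sin (l * z) - l * sin z) (fun z => l * cos (l * z) - l * cos z) 0 y (ltW y0).
rewrite mulr0 sin0 mulr0 subr0; apply => [z|z /andP[z0 zy]].
  apply: is_derive_eq; rewrite !scaler1 /GRing.scale/=; lra.
rewrite -mulrBr mulr_ge0// subr_ge0.
have lz0 : 0 <= l * z by rewrite mulr_ge0.
have lzz : l * z <= z by rewrite ler_piMl.
have zpi := le_trans zy ypi.
rewrite leNgt ltr_cos ?in_itv/= ?lz0 ?z0 ?zpi ?(le_trans lzz)//.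
by rewrite -leNgt.
Qed.

(** Monotonicity of tan x / x, cleared of denominators. By the addition formulas it is
    [sin_div_noninc] at y - x and y + x. *)
Lemma tan_div_nondec x y : 0 <= x -> x <= y -> y <= pi / 2 ->
  y * cos y * sin x <= x * cos x * sin y.
Proof.
move=> x0 xy ypi.
have := @sin_div_noninc (y - x) (y + x).
rewrite sinB sinD => /(_ _ _ _); move: (sin x) (cos x) (sin y) (cos y) => a b c d h.
suff : (y - x) * (c * b + d * a) <= (y + x) * (c * b - d * a) by nra.
by apply: h; lra.
Qed.

(* With c = tan k / k, the function cos x * exp (c x^2 / 2) increases up to k
   and decreases afterwards; this compares it at u, k and at v, s. *)
Lemma cos_mul_sum_sqr k s u v : 0 <= s -> s <= k -> k < pi / 2 ->
  k <= u -> u <= pi / 2 -> 0 <= v -> v <= s ->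
  cos u * cos v = cos k * cos s -> u ^+ 2 + v ^+ 2 <= k ^+ 2 + s ^+ 2.
Proof.
move=> s0 sk kpi ku upi v0 vs uv.
have [k0|k0] := eqVneq k 0.
  have s00 : s = 0 by apply/eqP; rewrite eq_le s0 -k0 sk.
  have v00 : v = 0 by apply/eqP; rewrite eq_le v0 -s00 vs.
  move: uv; rewrite s00 v00 cos0 !mulr1 => /cos_inj.
  by rewrite !in_itv/= => -> //; apply/andP; split; move: (@pi_gt0 R) ku; rewrite ?k0; lra.
have {}k0 : 0 < k by rewrite lt_def k0 (le_trans s0).
have pi0 := @pi_gt0 R.
have ck : 0 < cos k by apply: cos_gt0_pihalf; apply/andP; split; lra.
have cs : 0 < cos s by apply: cos_gt0_pihalf; apply/andP; split; lra.
have sink : 0 < sin k by apply: sin_gt0_pi; apply/andP; split; lra.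
pose c := sin k / (k * cos k).
have c0 : 0 < c by rewrite divr_gt0// mulr_gt0.
pose psi x := cos x * expR (c / 2 * x ^+ 2).
pose dpsi x := expR (c / 2 * x ^+ 2) * (c * x * cos x - sin x).
have dpsiP x : is_derive x 1 psi (dpsi x).
  rewrite /psi /dpsi; apply: is_derive_eq; rewrite !scaler1 /GRing.scale/=.
  by rewrite /GRing.scale/= ?mulr1; field.
have cE x : c * x * cos x - sin x = (x * cos x * sin k - k * cos k * sin x) / (k * cos k).
  by rewrite /c; field; rewrite ?gt_eqF.
have vpsi : psi v <= psi s.
  apply: is_derive_ge0_le vs dpsiP _ => x /andP[vx xs].
  rewrite /dpsi; apply: mulr_ge0; first exact: expR_ge0.
  rewrite cE; apply: divr_ge0; last by rewrite mulr_ge0 ?ltW.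
  by rewrite subr_ge0; apply: tan_div_nondec; lra.
have upsi : psi u <= psi k.
  rewrite -lerN2; have dN x : is_derive x 1 (fun x => - psi x) (- dpsi x).
    by apply: is_derive_eq.
  apply: is_derive_ge0_le ku dN _ => x /andP[kx xu].
  rewrite /dpsi -mulrN; apply: mulr_ge0; first exact: expR_ge0.
  rewrite oppr_ge0 cE ler_pdivrMr ?mulr_gt0// mul0r subr_le0.
  by apply: tan_div_nondec; lra.
have cu : 0 <= cos u by apply: cos_ge0_pihalf; apply/andP; split; lra.
have cv : 0 <= cos v by apply: cos_ge0_pihalf; apply/andP; split; lra.
have : psi u * psi v <= psi k * psi s.
  by apply: ler_pM => //; rewrite /psi mulr_ge0// expR_ge0.
rewrite /psi mulrACA [leRHS]mulrACA uv ler_pM2l ?mulr_gt0// -!expRD ler_expR -!mulrDr.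
by rewrite ler_pM2l// divr_gt0.
Qed.

(* In the spherical triangle with vertices x, y, z', k is half of the side xy,
   s the distance from z' to its midpoint, and A, B the two other sides. *)
Lemma median_sides k s A B : 0 <= s -> s <= k / 2 -> k <= pi / 2 ->
  0 <= A <= pi -> 0 <= B <= pi ->
  cos A + cos B = 2 * (cos k * cos s) ->
  `|cos A - cos B| <= 2 * (sin k * sin s) ->
  [/\ A <= k + s, B <= k + s & A ^+ 2 + B ^+ 2 <= 2 * (k ^+ 2 + s ^+ 2)].
Proof.
wlog BA : A B / B <= A => [H s0 sk kpi A0 B0 AB AB'|].
  have [/H|/ltW/H] := leP B A; first exact.
  case=> //; first by rewrite addrC.
    by rewrite distrC.
  by move=> ? ?; rewrite addrC => ?; split.
move=> s0 sk kpi /andP[A0 Api] /andP[B0 Bpi] AB AB'.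
have pi0 := @pi_gt0 R.
(* In half sum and half difference the hypotheses become cos u cos v = cos k cos s and sin u sin v
   <= sin k sin s, so that cos A >= cos (k + s) and cos B <= cos (k - s). *)
pose u := (A + B) / 2; pose v := (A - B) / 2.
have Auv : A = u + v by rewrite /u /v; lra.
have Buv : B = u - v by rewrite /u /v; lra.
have v0 : 0 <= v by rewrite /v; lra.
have uv : cos u * cos v = cos k * cos s.
  by move: AB; rewrite Auv Buv cosD cosB; lra.
have {AB'}suv : sin u * sin v <= sin k * sin s.
  have := le_trans (ler_norm _) (AB' : `|_| <= _).
  move: AB'; rewrite ler_norml => /andP[+ _] _.
  by rewrite Auv Buv cosD cosB; lra.
have Ale : A <= k + s.
  rewrite leNgt; apply/negP; rewrite -ltr_cos ?in_itv/=; first last.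
  - by apply/andP; split; lra.
  - by apply/andP; split; lra.
  by rewrite Auv !cosD; lra.
have Bge : k - s <= B.
  rewrite leNgt; apply/negP; rewrite -ltr_cos ?in_itv/=; first last.
  - by apply/andP; split; lra.
  - by apply/andP; split; lra.
  by rewrite Buv !cosB; lra.
split => //; first lra.
have vs : v <= s by rewrite /v; lra.
suff : u ^+ 2 + v ^+ 2 <= k ^+ 2 + s ^+ 2 by rewrite Auv Buv; lra.
have cv0 : 0 <= cos v by apply: cos_ge0_pihalf; apply/andP; split; lra.
have cs0 : 0 < cos s by apply: cos_gt0_pihalf; apply/andP; split; lra.
have ck0 : 0 <= cos k by apply: cos_ge0_pihalf; apply/andP; split; lra.
have csv : cos s <= cos v.
  by rewrite leNgt ltr_cos ?in_itv/= -?leNgt//; apply/andP; split; lra.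
have cu0 : 0 <= cos u.
  by rewrite -(pmulr_lge0 _ (lt_le_trans cs0 csv)) uv mulr_ge0// ltW.
have u0 : 0 <= u by rewrite /u; lra.
have upi : u <= pi / 2.
  rewrite leNgt; apply/negP => uu; have : cos u < cos (pi / 2).
    by rewrite ltr_cos ?in_itv//=; apply/andP; split; rewrite /u in uu *; lra.
  by rewrite cos_pihalf ltNge cu0.
have ku : k <= u.
  rewrite leNgt -ltr_cos ?in_itv/= -?leNgt; first last.
  - by apply/andP; split; lra.
  - by apply/andP; split; lra.
  have : cos u * cos s <= cos k * cos s by rewrite -uv ler_wpM2l.
  by rewrite ler_pM2r.
(* For k = pi / 2 the constant tan k / k behind [cos_mul_sum_sqr] is infinite, but then k <= u <= pi
   / 2 forces u = k. *)
move: kpi; rewrite le_eqVlt => /predU1P[kE|kpi].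
  have -> : u = k by lra.
  by rewrite lerD2l ler_sqr ?nnegrE.
by apply: cos_mul_sum_sqr => //; lra.
Qed.

End real_analysis.

(** * Power inequalities and lower bounds for the displacement *)

Section powers.
Context {R : realType}.
Implicit Types x y z p a b r t d w q s A B : R.

(** Young's inequality for z and 1, with the conjugate exponents p and p / (p - 1). *)
Lemma powR_bernoulli p z : 1 <= p -> 0 <= z -> 1 + p * (z - 1) <= z `^ p.
Proof.
rewrite le_eqVlt => /predU1P[<- z0|p1 z0].
  by rewrite powRr1//; lra.
have p0 : 0 < p by lra.
have q0 : 0 < p / (p - 1) by rewrite divr_gt0//; lra.
have pq : p^-1 + (p / (p - 1))^-1 = 1 by field; apply/andP; split; lra.
have := @conjugate_powR _ z 1 p (p / (p - 1)) z0 ler01 p0 q0 pq.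
rewrite mulr1 powR1.
have -> : z `^ p / p + 1 / (p / (p - 1)) = (z `^ p + (p - 1)) / p.
  by field; apply/andP; split; lra.
by rewrite ler_pdivlMr//; lra.
Qed.

Lemma convex_powR_le p t a b : 1 <= p -> 0 <= t <= 1 -> 0 <= a -> 0 <= b ->
  (t * a + (1 - t) * b) `^ p <= t * a `^ p + (1 - t) * b `^ p.
Proof.
move=> p1 /andP[t0 t1] a0 b0.
have := @convex_powR R p p1 (Itv01 t0 t1) a b.
by rewrite !inE/= !in_itv/= a0 b0 !convRE/=; apply.
Qed.

(** By convexity the increment of y^p over an interval of length d grows when the interval moves
    right. Both w and x - d are convex combinations of w - d and x, with weights t and 1 - t
    exchanged. *)
Lemma powR_increment p d w x : 1 <= p -> 0 <= d -> d <= w -> w <= x ->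
  w `^ p + (x - d) `^ p <= x `^ p + (w - d) `^ p.
Proof.
move=> p1 d0 dw wx.
have [->|d_neq0] := eqVneq d 0; first by rewrite !subr0 addrC.
have {d_neq0} d0' : 0 < d by rewrite lt_def d_neq0.
have E0 : 0 < x - w + d by lra.
pose t := d / (x - w + d).
have t01 : 0 <= t <= 1.
  by rewrite divr_ge0 ?(ltW E0)//= ler_pdivrMr//; lra.
have t01' : 0 <= 1 - t <= 1 by case/andP: t01 => *; apply/andP; split; lra.
have x0 : 0 <= x by lra.
have wd0 : 0 <= w - d by lra.
have := convex_powR_le p1 t01 x0 wd0; have := convex_powR_le p1 t01' x0 wd0.
have -> : (1 - t) * x + (1 - (1 - t)) * (w - d) = x - d by rewrite /t; field; lra.
have -> : t * x + (1 - t) * (w - d) = w by rewrite /t; field; lra.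
by lra.
Qed.

(** Concavity of y^(p/2), in the form of the convexity of y^(2/p) at A^p and B^p. *)
Lemma powR_mean p A B : 0 < p -> p <= 2 -> 0 <= A -> 0 <= B ->
  A `^ p + B `^ p <= 2 * ((A ^+ 2 + B ^+ 2) / 2) `^ (p / 2).
Proof.
move=> p0 p2 A0 B0.
have P1 : 1 <= 2 / p by rewrite ler_pdivlMr// mul1r.
have h01 : 0 <= (2^-1 : R) <= 1 by apply/andP; split; lra.
have := convex_powR_le P1 h01 (powR_ge0 A p) (powR_ge0 B p).
have hE : 1 - 2^-1 = 2^-1 :> R by lra.
rewrite !hE -!powRrM mulrCA divff ?gt_eqF// mulr1 !powR_mulrn// -!mulrDr => h.
have p20 : 0 <= p / 2 by rewrite divr_ge0 ?ltW.
have := ge0_ler_powR p20 _ _ h.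
have pE : 2 / p * (p / 2) = 1 by field; lra.
rewrite -powRrM pE powRr1; last by rewrite mulr_ge0// addr_ge0 ?powR_ge0.
rewrite !nnegrE powR_ge0 mulr_ge0 ?addr_ge0 ?sqr_ge0// => /(_ isT isT).
by rewrite [_^-1 * (_ ^+ 2 + _)]mulrC; lra.
Qed.

(* t is the displacement of a point at distances A and B from the ends of a
   segment of length r, transported from the A end to the B end; the last
   hypothesis is the monotonicity of the optimal map. *)
Lemma displacement_ge2 p r t A B : 2 <= p -> 0 < r -> 0 <= t -> 0 <= A -> 0 <= B ->
  A <= 3 / 4 * r -> B <= 3 / 4 * r -> A ^+ 2 + B ^+ 2 <= 5 / 8 * r ^+ 2 ->
  r `^ p + t `^ p <= B `^ p + (A + t) `^ p -> r / 4 <= t.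
Proof.
move=> p2 r0 t0 A0 B0 Ar Br AB H; rewrite leNgt; apply/negP => tr.
move: H; apply/negP; rewrite -ltNge.
have sq y : 0 <= y -> y `^ p = (y ^+ 2) `^ (p / 2).
  by move=> y0; rewrite -powR_mulrn// -powRrM mulrC divfK.
rewrite (sq r)//; last exact: ltW.
rewrite (sq t)// (sq B)// (sq (A + t)) ?addr_ge0//.
have P1 : 1 <= p / 2 by lra.
(* As p / 2 >= 1, [powR_increment] can be applied to the squares, and it remains to see that B^2 + d
   < r^2. If t < r / 4, then A^2 + B^2 + 2 A t < (5/8 + 2 * 3/4 * 1/4) r^2 = r^2, which is where the
   constant 1/4 comes from. *)
set d := (A + t) ^+ 2 - t ^+ 2.
have d0 : 0 <= d by rewrite /d; nra.
have dw : d <= (A + t) ^+ 2 by rewrite /d; nra.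
have wx : (A + t) ^+ 2 <= r ^+ 2.
  by rewrite ler_sqr ?nnegrE ?addr_ge0 ?(ltW r0)//; lra.
have := powR_increment P1 d0 dw wx.
have -> : (A + t) ^+ 2 - d = t ^+ 2 by rewrite /d; ring.
have BB : B ^+ 2 < r ^+ 2 - d.
  have : A * t <= 3 / 4 * r * t by rewrite ler_wpM2r.
  have : r * t < r * (r / 4) by rewrite ltr_pM2l.
  rewrite /d; move: AB; rewrite !expr2; lra.
have : (B ^+ 2) `^ (p / 2) < (r ^+ 2 - d) `^ (p / 2).
  apply: gt0_ltr_powR; rewrite ?nnegrE ?sqr_ge0//; first lra.
  by rewrite (le_trans (sqr_ge0 B))// ltW.
by lra.
Qed.

(** For p <= 2 the function y^(p/2) of the squares is no longer convex. Instead (A + t)^p is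
    linearized in t, while the power mean bounds A^p + B^p by r^p (1 - e/2) (1 + e/4), where e = p -
    1. The deficit, of order e r^p, has to be made up by t. *)
Lemma displacement_le2 p r s t A B : 1 < p -> p <= 2 -> 0 < r -> 0 <= t ->
  0 <= A -> 0 <= B -> A <= 3 / 4 * r -> s ^+ 2 <= (p - 1) / 16 * r ^+ 2 ->
  A ^+ 2 + B ^+ 2 <= 2 * ((r / 2) ^+ 2 + s ^+ 2) ->
  r `^ p + t `^ p <= B `^ p + (A + t) `^ p -> 3 / 16 * (p - 1) * r <= t.
Proof.
move=> p1 p2 r0 t0 A0 B0 Ar sr AB H; rewrite leNgt; apply/negP => tr.
have pr : 0 < p by lra.
have Atr : A + t <= r by nra.
set e := p - 1 in sr tr *.
have e0 : 0 < e by rewrite /e; lra.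
have e1 : e <= 1 by rewrite /e; lra.
have re0 : 0 < r `^ e by rewrite powR_gt0.
have powE y : 0 <= y -> y `^ p = y * y `^ e by move=> y0; rewrite mulr_powRB1.
have step1 : (A + t) `^ p <= A `^ p + p * r `^ e * t.
  have [At0|At0] := eqVneq (A + t) 0.
    rewrite At0 powR0 ?gt_eqF//; apply: addr_ge0; first exact: powR_ge0.
    by apply: mulr_ge0 => //; apply: mulr_ge0; exact: ltW.
  have {}At0 : 0 < A + t by rewrite lt_def At0 addr_ge0.
  have z0 : 0 <= A / (A + t) by apply: divr_ge0 => //; exact: ltW.
  have AE : (A + t) * (A / (A + t)) = A by rewrite mulrC divfK ?gt_eqF.
  have -> : A `^ p = ((A + t) * (A / (A + t))) `^ p by rewrite AE.
  rewrite powRM ?(ltW At0)// (powE (A + t)) ?(ltW At0)//.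
  set Y := (A + t) `^ e; set Z := (_ / _) `^ p.
  have Y0 : 0 <= Y by rewrite powR_ge0.
  have Yr : Y <= r `^ e by apply: ge0_ler_powR; rewrite ?nnegrE ?(ltW At0) ?(ltW r0) ?(ltW e0).
  have : 1 + p * (A / (A + t) - 1) <= Z by exact: powR_bernoulli (ltW p1) z0.
  rewrite -(ler_pM2l At0) => /(ler_wpM2l Y0).
  have -> : (A + t) * (1 + p * (A / (A + t) - 1)) = A + t - p * t by field; lra.
  have : p * t * Y <= p * t * r `^ e by rewrite ler_wpM2l// mulr_ge0// ltW.
  lra.
have step2 : A `^ p + B `^ p <= r * r `^ e * ((1 - e / 2) * (1 + e / 4)).
  apply: le_trans (powR_mean pr p2 A0 B0) _.
  apply: (@le_trans _ _ (2 * ((r / 2) ^+ 2 * (1 + e / 4)) `^ (p / 2))).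
    rewrite ler_pM2l//; apply: ge0_ler_powR; rewrite ?nnegrE.
    - by rewrite divr_ge0 ?ltW.
    - by rewrite divr_ge0// addr_ge0 ?sqr_ge0.
    - by rewrite mulr_ge0 ?sqr_ge0//; lra.
    - rewrite ler_pdivrMr// mulrC; apply: le_trans AB _.
      by move: sr; rewrite !expr2; lra.
  rewrite powRM ?sqr_ge0//; last lra.
  rewrite -[(r / 2) ^+ 2]powR_mulrn; last by rewrite divr_ge0 ?ltW.
  rewrite -powRrM mulrC -mulrA [2 * (p / 2)]mulrC divfK//.
  have r2 : (r / 2) `^ p = r * r `^ e * (2^-1 * (2^-1) `^ e).
    by rewrite powRM ?ltW// powE ?(powE 2^-1) ?ltW.
  rewrite r2.
  (* Bernoulli with exponent 1 / e at z = 2^(-e), whose power is 1/2. *)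
  have h1 : (2^-1) `^ e <= 1 - e / 2 :> R.
    have E1 : 1 <= e^-1 by rewrite -invr1 lef_pV2 ?posrE.
    have := powR_bernoulli E1 (powR_ge0 2^-1 e).
    rewrite -powRrM mulfV ?gt_eqF// powRr1 ?invr_ge0//.
    by rewrite -lerBrDl ler_pdivrMl//; lra.
  have h2 : (1 + e / 4) `^ (p / 2) <= 1 + e / 4 by apply: ler1_powR; lra.
  rewrite (_ : _ * 2 = r * r `^ e * ((2^-1) `^ e * (1 + e / 4) `^ (p / 2))); last by field.
  rewrite [leRHS]mulrA ler_pM2l ?mulr_gt0//.
  by apply: ler_pM; rewrite ?powR_ge0.
have tp := powR_ge0 t p.
have : r * r `^ e <= r * r `^ e * ((1 - e / 2) * (1 + e / 4)) + p * r `^ e * t.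
  by move: H; rewrite (powE r (ltW r0)); lra.
have -> : r * r `^ e * ((1 - e / 2) * (1 + e / 4)) + p * r `^ e * t =
  r `^ e * (r * ((1 - e / 2) * (1 + e / 4)) + (1 + e) * t) by rewrite /e; field.
rewrite mulrC ler_pM2l//; apply/negP; rewrite -ltNge.
have : (1 + e) * t < (1 + e) * (3 / 16 * e * r) by rewrite ltr_pM2l//; lra.
(* At t = 3/16 e r the inequality fails by the margin e r (1 - e) / 16, whence the constant 3/16. *)
have : 0 <= e * r * (1 - e) by apply: mulr_ge0; [apply: mulr_ge0; exact: ltW|rewrite subr_ge0].
lra.
Qed.

End powers.

(** * The constants a_p and the volumes of balls *)

Section constant_bounds.
Context {R : realType}.
Implicit Types x y z p q v : R.

Lemma one_sub_le_expR y : 0 <= y -> y <= 1 -> 1 - y <= expR (- (y + y ^+ 2 / 2)).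
Proof.
move=> y0 y1; rewrite expRN -[leRHS]mul1r ler_pdivlMr ?expR_gt0//.
have := @is_derive_ge0_le R (fun z => - ((1 - z) * expR (z + z ^+ 2 / 2)))
  (fun z => z ^+ 2 * expR (z + z ^+ 2 / 2)) 0 y y0.
rewrite subr0 expr0n mul0r addr0 expR0 mulr1 lerN2; apply => [x|x _].
  by apply: is_derive_eq; rewrite !scaler1 /GRing.scale/= /GRing.scale/= ?mulr1; field.
by rewrite mulr_ge0 ?sqr_ge0 ?expR_ge0.
Qed.

Lemma expR_pade v : 0 <= v -> 2 * (expR v - 1) <= v * (expR v + 1).
Proof.
move=> v0; rewrite -subr_ge0.
have := @is_derive_ge0_le R (fun z => z * (expR z + 1) - 2 * (expR z - 1))
  (fun z => 1 + (z - 1) * expR z) 0 v v0.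
rewrite mul0r expR0 subrr mulr0 subrr; apply => [x|x _].
  by apply: is_derive_eq; rewrite !scaler1 /GRing.scale/= /GRing.scale/= ?mulr1; ring.
have := expR_ge1Dx (- x); rewrite expRN => h.
have : (1 - x) * expR x <= 1 by rewrite -ler_pdivlMr ?expR_gt0// mul1r.
lra.
Qed.

Lemma ln_ge_rational q : 1 <= q -> 2 * (q - 1) / (q + 1) <= ln q.
Proof.
move=> q1; have q0 : 0 < q by lra.
have := expR_pade (ln_ge0 q1); rewrite lnK ?posrE//.
by rewrite ler_pdivrMr//; lra.
Qed.

(** The numerator of the difference of the two sides of [exponent_bound] over 2 q^4 (q + 1)^2. The
    squares in h1 and h2 are chosen so that linear arithmetic can conclude from the listed
    nonnegative terms. *)
Lemma exponent_poly q : 0 <= q ->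
  0 <= 71 / 25 * q ^+ 6 - 258 / 25 * q ^+ 5 + 146 / 25 * q ^+ 4 + 6 * q ^+ 3
       + 4 * q ^+ 2 + 2 * q + 1.
Proof.
move=> q0.
have h1 := sqr_ge0 (q ^+ 3 - 20 / 11 * q ^+ 2 - 13 / 20 * q - 2 / 5).
have h2 : 0 <= q * (q - 43 / 100) ^+ 2 by rewrite mulr_ge0 ?sqr_ge0.
have h3 := sqr_ge0 q.
have h4 : 0 <= q ^+ 4 by rewrite exprn_ge0.
have h5 : 0 <= q ^+ 5 by rewrite exprn_ge0.
lra.
Qed.

Lemma exponent_bound q : 1 < q ->
  179 / 50 <= 4 * (q ^+ 2 + 1) / (q + 1) ^+ 2 + (q ^+ 2 + 1) / q ^+ 2 +
    (q ^+ 2 + 1) / (2 * q ^+ 4).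
Proof.
move=> q1; have q0 : 0 < q by lra.
have hp := exponent_poly (ltW q0).
have d0 : 0 < (2 * q ^+ 4 * (q + 1) ^+ 2)^-1.
  rewrite invr_gt0; apply: mulr_gt0; last by apply: exprn_gt0; lra.
  by apply: mulr_gt0 => //; exact: exprn_gt0.
have h := mulr_ge0 (ltW d0) hp.
rewrite -subr_ge0; apply: le_trans h _; rewrite le_eqVlt; apply/orP; left; apply/eqP.
by field; apply/andP; split; lra.
Qed.

Lemma expR_ge_sqr x : 0 <= x -> 1 + x + x ^+ 2 / 2 <= expR x.
Proof.
move=> x0; rewrite -subr_ge0.
have := @is_derive_ge0_le R (fun z => expR z - (1 + z + z ^+ 2 / 2))
  (fun z => expR z - (1 + z)) 0 x x0.
rewrite expR0 expr0n mul0r !addr0 subrr; apply => [z|z _].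
  by apply: is_derive_eq; rewrite !scaler1 /GRing.scale/= ?mulr1; field.
by rewrite subr_ge0 expR_ge1Dx.
Qed.

Lemma expR_ge_cube x : 0 <= x -> 1 + x + x ^+ 2 / 2 + x ^+ 3 / 6 <= expR x.
Proof.
move=> x0; rewrite -subr_ge0.
have := @is_derive_ge0_le R (fun z => expR z - (1 + z + z ^+ 2 / 2 + z ^+ 3 / 6))
  (fun z => expR z - (1 + z + z ^+ 2 / 2)) 0 x x0.
rewrite expR0 !expr0n !mul0r !addr0 subrr; apply => [z|z /andP[z0 _]].
  by apply: is_derive_eq; rewrite !scaler1 /GRing.scale/= ?mulr1; field.
by rewrite subr_ge0 expR_ge_sqr.
Qed.

Lemma expR_bound : 35 <= expR (179 / 50) :> R.
Proof.
have -> : 179 / 50 = 8%:R * (179 / 400) :> R by lra.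
rewrite expRM_natl (exprM _ 2 4) (exprM _ 2 2).
have h : 25 / 16 <= expR (179 / 400) :> R.
  by apply: le_trans (expR_ge_cube _); lra.
have h2 : 244 / 100 <= expR (179 / 400) ^+ 2 :> R.
  by rewrite expr2; nra.
have h4 : 595 / 100 <= (expR (179 / 400) ^+ 2) ^+ 2 :> R.
  by rewrite [leRHS]expr2; nra.
by rewrite [leRHS]expr2; nra.
Qed.

(* The maximum over y >= 0 of y - y^p, attained at y^(p-1) = 1/p. *)
Lemma sub_powR_le p y : 1 < p -> 0 <= y ->
  y - y `^ p <= (1 - p^-1) * p `^ (- (p - 1)^-1).
Proof.
move=> p1 y0; have p0 : 0 < p by lra.
set y1 := p `^ _; have y10 : 0 < y1 by rewrite powR_gt0.
have y1p : y1 `^ p = y1 / p.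
  rewrite -(mulr_powRB1 (ltW y10) p0); congr (_ * _).
  by rewrite /y1 -powRrM mulNr mulVf ?subr_eq0 ?gt_eqF// powR_inv1// ltW.
have z0 : 0 <= y / y1 by rewrite divr_ge0// ltW.
have -> : y `^ p = y1 `^ p * (y / y1) `^ p.
  by rewrite -powRM ?(ltW y10)// mulrC divfK ?gt_eqF.
have := powR_bernoulli (ltW p1) z0.
rewrite y1p -(ler_pM2l (divr_gt0 y10 p0)).
have -> : y1 / p * (1 + p * (y / y1 - 1)) = y - (1 - p^-1) * y1.
  by field; apply/andP; split; lra.
lra.
Qed.

(** y - y^p = y (1 - exp ((p - 1) ln y)) <= (p - 1) (- y ln y), and - y ln y is at most 1 / exp 1 <=
    3/8. *)
Lemma sub_powR_le_small p y : 1 < p -> 0 < y -> y - y `^ p <= 3 / 8 * (p - 1).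
Proof.
move=> p1 y0; have p0 : 0 < p by lra.
rewrite -(mulr_powRB1 (ltW y0) p0).
have -> : y `^ (p - 1) = expR ((p - 1) * ln y) by rewrite /powR gt_eqF.
have h1 := expR_ge1Dx ((p - 1) * ln y).
have h2 : - (y * ln y) <= 3 / 8.
  have h3 := expR_ge1Dx (- ln y - 1).
  have e1 : 8 / 3 <= expR 1 :> R by apply: le_trans (expR_ge_cube _) => //; lra.
  have yE : y * expR (- ln y - 1) = (expR 1)^-1.
    by rewrite expRD expRN lnK ?posrE// mulrA divff ?gt_eqF// mul1r expRN.
  have h4 : y * (- ln y) <= (expR 1)^-1 by rewrite -yE ler_pM2l//; lra.
  rewrite -mulrN; apply: (le_trans h4).
  by rewrite invf_ple ?posrE ?expR_gt0//; lra.
have h3 : y * (1 + (p - 1) * ln y) <= y * expR ((p - 1) * ln y) by rewrite ler_pM2l.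
have h4 : (p - 1) * - (y * ln y) <= (p - 1) * (3 / 8) by rewrite ler_pM2l//; lra.
lra.
Qed.

(** 1 - 1/p is at most exp (- 1/p - 1/(2 p^2)), and the other factor is exp (- ln p / (p - 1)). With
    q = sqrt p, the bound ln p = 2 ln q >= 4 (q - 1) / (q + 1) makes the exponent, multiplied by p +
    1, at most a rational function of q, itself at most - 179/50; and exp (179/50) >= 35. *)
Lemma gap_powR_le p : 2 <= p ->
  ((1 - p^-1) * p `^ (- (p - 1)^-1)) `^ (p + 1) <= 35^-1.
Proof.
move=> p2; have p0 : 0 < p by lra.
pose q := Num.sqrt p.
have q1 : 1 < q by rewrite -sqrtr1 ltr_sqrt//; lra.
have q0 : 0 < q by lra.
have pq : p = q ^+ 2 by rewrite sqr_sqrtr// ltW.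
have pV1 : p^-1 <= 1 by rewrite invf_le1//; lra.
apply: (@le_trans _ _ (expR (- (p^-1 + p^-1 ^+ 2 / 2) - ln p / (p - 1)) `^ (p + 1))).
  apply: ge0_ler_powR; rewrite ?nnegrE ?expR_ge0//; first lra.
    by rewrite mulr_ge0 ?powR_ge0//; lra.
  rewrite expRD; apply: ler_pM; rewrite ?powR_ge0//; first lra.
    by apply: one_sub_le_expR => //; rewrite invr_ge0 ltW.
  by rewrite /powR gt_eqF// -mulNr mulrC mulNr mulrN.
rewrite -expRM -[35]invrK.
apply: (@le_trans _ _ (expR (- (179 / 50)))); last first.
  by rewrite expRN invrK lef_pV2 ?posrE ?expR_gt0// expR_bound.
rewrite ler_expR.
have h := ln_ge_rational (ltW q1).
have l2 : ln p = 2 * ln q by rewrite pq lnXn// mulr_natl.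
have := exponent_bound q1.
rewrite l2 pq.
have c0 : 0 < 2 * (q ^+ 2 + 1) / (q ^+ 2 - 1).
  by rewrite divr_gt0//; nra.
rewrite -(ler_pM2l c0) in h.
have -> : (- ((q ^+ 2)^-1 + (q ^+ 2)^-1 ^+ 2 / 2) - 2 * ln q / (q ^+ 2 - 1)) * (q ^+ 2 + 1)
   = - ((q ^+ 2 + 1) / q ^+ 2 + (q ^+ 2 + 1) / (2 * q ^+ 4) + 2 * (q ^+ 2 + 1) / (q ^+ 2 - 1) * ln q).
  by field; apply/andP; split; nra.
have E : 2 * (q ^+ 2 + 1) / (q ^+ 2 - 1) * (2 * (q - 1) / (q + 1)) = 4 * (q ^+ 2 + 1) / (q + 1) ^+ 2.
  by field; apply/andP; split; nra.
rewrite E in h; lra.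
Qed.

End constant_bounds.

Section a_const_bounds.
Context {R : realType}.
Implicit Types p y : R.

(** With y = i^(-1/p) the gap i^(-1/p) - 1/i is y - y^p, so that a_p is controlled by the maximum of
    that function over y > 0. *)
Lemma natr_powR_invN p (i : nat) : 0 < p -> (0 < i)%N ->
  (i%:R `^ (- p^-1)) `^ p = i%:R^-1.
Proof.
move=> p0 i0; rewrite -powRrM mulNr mulVf ?gt_eqF// powR_inv1//.
Qed.

Let gaps p : set R := [set i%:R `^ (- p^-1) - i%:R^-1 | i in [set i : nat | (0 < i)%N]].

Lemma gaps_neq0 p : gaps p !=set0.
Proof. by exists (1%:R `^ (- p^-1) - 1%:R^-1), 1%N. Qed.

Lemma a_const_le p b : (forall y, 0 < y -> y - y `^ p <= b) -> 0 < p ->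
  a_const p <= b / 4.
Proof.
move=> hb p0; rewrite /a_const [leRHS]mulrC ler_pM2l ?invr_gt0//.
apply: ge_sup; first exact: gaps_neq0.
move=> _ [i /= i0 <-]; rewrite -(natr_powR_invN p0 i0).
by apply: hb; rewrite powR_gt0// ltr0n.
Qed.

Lemma a_const_gt0 p : 1 < p -> 0 < a_const p.
Proof.
move=> p1; rewrite mulr_gt0 ?invr_gt0//.
apply: (@lt_le_trans _ _ (2%:R `^ (- p^-1) - 2%:R^-1)).
  rewrite subr_gt0 powRN ltf_pV2 ?posrE ?powR_gt0//.
  rewrite -[ltRHS]powRr1// /powR gt_eqF// ltr_expR ltr_pM2r ?ln_gt0 ?ltr1n//.
  by rewrite invf_lt1//; lra.
apply: ub_le_sup; last by exists 2%N.
exists (3 / 8 * (p - 1)) => _ [i /= i0 <-].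
have p0 : 0 < p by lra.
rewrite -(natr_powR_invN p0 i0).
by apply: sub_powR_le_small; rewrite // powR_gt0// ltr0n.
Qed.

Lemma a_const_le_small p : 1 < p -> a_const p <= 3 / 32 * (p - 1).
Proof.
move=> p1; have p0 : 0 < p by lra.
have h : a_const p <= 3 / 8 * (p - 1) / 4.
  by apply: a_const_le => // y y0; exact: sub_powR_le_small.
lra.
Qed.

Lemma a_const_powR_le p : 2 <= p -> (4 * a_const p) `^ (p + 1) <= 35^-1.
Proof.
move=> p2; have p1 : 1 < p by lra.
have p0 : 0 < p by lra.
have a0 := a_const_gt0 p1.
apply: le_trans (gap_powR_le p2).
have h : a_const p <= (1 - p^-1) * p `^ (- (p - 1)^-1) / 4.
  by apply: a_const_le => // y y0; apply: sub_powR_le => //; exact: ltW.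
apply: ge0_ler_powR; rewrite ?nnegrE; [lra| |rewrite mulr_ge0 ?powR_ge0//|lra].
  by rewrite mulr_ge0// ltW.
by rewrite subr_ge0 invf_le1//; lra.
Qed.

Lemma a_const_lt4 p : 1 < p -> a_const p <= 4^-1.
Proof.
move=> p1; have p0 : 0 < p by lra.
rewrite -[4^-1]mul1r; apply: a_const_le => // y y0.
have [y1|y1] := leP y 1; first by have := powR_ge0 y p; lra.
by have := le1r_powR (ltW y1) (ltW p1); lra.
Qed.

Lemma ball_volume_le_pow k : ball_volume k <= 2 ^+ k :> R.
Proof.
suff : ball_volume k <= 2 ^+ k :> R /\ ball_volume k.+1 <= 2 ^+ k.+1 :> R by case.
elim: k => [|k [IH1 IH2]]; first by rewrite /= expr0 expr1.
split => //; rewrite [ball_volume _]/= 2!exprS mulrA; apply: ler_pM => //.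
- by rewrite divr_ge0// mulr_ge0// pi_ge0.
- exact: ball_volume_ge0.
- rewrite ler_pdivrMr//; have := @pi_le R.
  have : 2 <= k.+2%:R :> R by rewrite ler_nat.
  lra.
Qed.

(** 2 pi omega_k is the area of S^(k+1). Passing from k to k + 2 multiplies it by 2 pi / (k + 2), at
    most 1 once k >= 5, so only indices up to 6 are computed; with pi <= 16/5 the largest of these
    values stays just below 35. *)
Lemma ball_volume_bound k : 2 * pi * ball_volume k <= 35 :> R.
Proof.
have p0 := @pi_ge0 R; have pl := @pi_le R.
suff : 2 * pi * ball_volume k <= 35 :> R /\ 2 * pi * ball_volume k.+1 <= 35 :> R by case.
elim: k => [|k [IH1 IH2]]; first by split => /=; lra.
split => //.
have [k5|k5] := leqP 5 k.
  rewrite [ball_volume _]/=; apply: le_trans IH1.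
  rewrite mulrCA; apply: ler_piMl.
    by rewrite !mulr_ge0// ball_volume_ge0.
  rewrite ler_pdivrMr// mul1r; apply: (@le_trans _ _ 7); first lra.
  by rewrite ler_nat.
have pp : pi * pi <= 16 / 5 * (16 / 5) :> R by exact: ler_pM.
have ppp : pi * pi * pi <= 16 / 5 * (16 / 5) * (16 / 5) :> R by apply: ler_pM => //; rewrite mulr_ge0.
have pppp : pi * pi * pi * pi <= 16 / 5 * (16 / 5) * (16 / 5) * (16 / 5) :> R by apply: ler_pM => //; rewrite !mulr_ge0.
move: k5 {IH1 IH2}; do 5 (case: k => [_ /=|k]; first by lra).
by [].
Qed.

End a_const_bounds.

Section ratios.
Context {R : realType}.
Implicit Types p r s t A B K : R.

(* A point within distance [ball_ratio p * r] of the midpoint of a segment of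
   length r that is transported onto its end moves by at least
   [displacement_ratio p * r]. *)
Definition ball_ratio p : R := if 2 <= p then 4^-1 else Num.sqrt (p - 1) / 4.
Definition displacement_ratio p : R := if 2 <= p then 4^-1 else 3 / 16 * (p - 1).

Lemma ball_ratio_gt0 p : 1 < p -> 0 < ball_ratio p.
Proof.
move=> p1; rewrite /ball_ratio; case: ifPn => // _.
by rewrite divr_gt0// sqrtr_gt0; lra.
Qed.

Lemma displacement_ratio_gt0 p : 1 < p -> 0 < displacement_ratio p.
Proof. by move=> p1; rewrite /displacement_ratio; case: ifPn => // _; lra. Qed.

Lemma ball_ratio_le p : ball_ratio p <= 4^-1.
Proof.
rewrite /ball_ratio; case: ifPn => //; rewrite -ltNge => p2.
rewrite -[leRHS]mul1r ler_pM2r ?invr_gt0// -[leRHS]sqrtr1.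
by rewrite ler_wsqrtr; lra.
Qed.

Lemma displacement_lower_bound p r s t A B : 1 < p -> 0 < r -> r <= pi ->
  0 <= s -> s <= ball_ratio p * r -> 0 <= t -> 0 <= A <= pi -> 0 <= B <= pi ->
  cos A + cos B = 2 * (cos (r / 2) * cos s) ->
  `|cos A - cos B| <= 2 * (sin (r / 2) * sin s) ->
  r `^ p + t `^ p <= B `^ p + (A + t) `^ p ->
  displacement_ratio p * r <= t.
Proof.
move=> p1 r0 rpi s0 sr t0 Api Bpi AB AB' H.
have rho := ball_ratio_le p.
have sr4 : s <= r / 2 / 2.
  by apply: le_trans sr _; rewrite -(ler_pM2r r0) in rho; lra.
have rpi2 : r / 2 <= pi / 2 by lra.
have [As Bs ABs] := median_sides s0 sr4 rpi2 Api Bpi AB AB'.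
case/andP: Api => A0 _; case/andP: Bpi => B0 _.
have A3 : A <= 3 / 4 * r by lra.
have B3 : B <= 3 / 4 * r by lra.
move: sr; rewrite /displacement_ratio /ball_ratio; case: ifPn => [p2|].
  move=> sr; rewrite mulrC; apply: (displacement_ge2 p2 r0 t0 A0 B0 A3 B3) H.
  by apply: le_trans ABs _; move: s0 sr4; rewrite !expr2; nra.
rewrite -ltNge => p2 sr.
apply: (displacement_le2 p1 (ltW p2) r0 t0 A0 B0 A3 _ ABs H).
have -> : (p - 1) / 16 * r ^+ 2 = (Num.sqrt (p - 1) / 4 * r) ^+ 2.
  rewrite !exprMn sqr_sqrtr; last lra.
  by rewrite expr2; field.
by rewrite ler_sqr ?nnegrE// mulr_ge0 ?divr_ge0// ltW.
Qed.

(** K will be |S^m| times the integral of sin^m over [0, pi]. For p >= 2, the bounds K <= 35 and (4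
    a)^(p+1) <= 1/35 balance. For p < 2, the bound is K <= 32/5 * 2^m, and the 2^m is compensated by
    an extra factor 1/2 gained in each of the m sines. *)
Lemma constant_ineq p r K m : 1 < p -> 0 <= r -> r <= pi -> 0 <= K ->
  K <= 2 * pi * ball_volume m ->
  a_const p `^ (p + 1) * K * (r * sin (a_const p * pi) / pi) ^+ m <=
  displacement_ratio p `^ p * ball_ratio p * sin (ball_ratio p * r) ^+ m.
Proof.
move=> p1 r0 rpi K0 Km; have pi0 := @pi_gt0 R; have pile := @pi_le R.
have a0 := a_const_gt0 p1; have a4 := a_const_lt4 p1.
set a := a_const p in a0 a4 *.
have p0 : 0 < p by lra.
have sin_gt0 (b : R) : 0 < b -> b <= 4^-1 -> 0 <= sin (b * pi).
  move=> b0 b4; apply: sin_ge0_pi; rewrite mulr_ge0 ?(ltW b0) ?(ltW pi0)//=.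
  by rewrite ler_piMl ?(ltW pi0)//; lra.
(* On [0, pi] the concave function r |-> sin (b r) lies above its chord. *)
have chordal (b : R) : 0 < b -> b <= 4^-1 -> r * sin (b * pi) / pi <= sin (b * r).
  move=> b0 b4; rewrite ler_pdivrMr// -(ler_pM2l b0) !mulrA.
  have := @sin_div_noninc R (b * r) (b * pi).
  rewrite [_ * pi * sin (_ * r)]mulrAC; apply; first by rewrite mulr_ge0// ltW.
    by rewrite ler_pM2l.
  by rewrite ler_piMl ?(ltW pi0)//; lra.
have sa0 := sin_gt0 a a0 a4.
have q0 : 0 <= r * sin (a * pi) / pi by rewrite divr_ge0 ?mulr_ge0// ltW.
have dr0 := displacement_ratio_gt0 p1; have br0 := ball_ratio_gt0 p1.
have bl := ball_ratio_le p.
rewrite /displacement_ratio /ball_ratio in dr0 br0 bl *.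
case: ifPn dr0 br0 bl => [p2 _ _ _|].
  have K35 := le_trans Km (ball_volume_bound m).
  have ap := a_const_powR_le p2; rewrite -/a in ap.
  rewrite powRM ?(ltW a0)// in ap.
  apply: ler_pM; [by rewrite mulr_ge0 ?powR_ge0|exact: exprn_ge0| |].
    have E : 4 `^ (p + 1) * (4^-1 `^ p / 4) = 1 :> R.
      have h : 4 `^ p * 4^-1 `^ p = 1 :> R by rewrite -powRM ?mulfV ?powR1.
      rewrite powRD ?pnatr_eq0 ?implybT// powRr1//.
      by rewrite mulrACA h mul1r mulfV.
    have p40 : 0 < 4 `^ (p + 1) :> R by rewrite powR_gt0.
    rewrite -(ler_pM2l p40) E mulrA.
    have := ler_pM _ _ ap K35; rewrite mulVf//; apply => //.
    by rewrite mulr_ge0 ?powR_ge0.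
  case: m {Km} => [|m]; first by rewrite !expr0.
  rewrite lerXn2r ?nnegrE//.
    by apply: sin_ge0_pi; apply/andP; split; lra.
  apply: le_trans (chordal _ a0 a4) _.
  rewrite leNgt ltr_sin ?in_itv/= -?leNgt.
  - by nra.
  - by apply/andP; split; nra.
  - by apply/andP; split; nra.
rewrite -ltNge => p2 dr0 br0 bl.
set e := p - 1 in dr0 br0 bl *.
have e0 : 0 < e by rewrite /e; lra.
have e1 : e <= 1 by rewrite /e; lra.
have ae : a <= 3 / 32 * e by exact: a_const_le_small.
clearbody a.
set se := Num.sqrt e in br0 bl *.
have se0 : 0 < se by rewrite sqrtr_gt0.
have see : se ^+ 2 = e by rewrite sqr_sqrtr// ltW.
have se1 : se <= 1 by rewrite -sqrtr1 ler_wsqrtr.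
(* As a <= 3/32 (p - 1) while the ball has ratio sqrt (p - 1) / 4, the number sin (a pi) is at most
   half of sin (se / 4 * pi); this is the factor 1/2 to the power m. *)
have gain : r * sin (a * pi) / pi <= sin (se / 4 * r) / 2.
  rewrite ler_pdivlMr//; apply: le_trans (chordal _ br0 bl).
  rewrite mulrAC ler_pM2r ?invr_gt0// -mulrA ler_wpM2l//.
  have h1 : sin (a * pi) <= 3 / 32 * e * pi.
    by apply: (le_trans (sin_le _)); [apply: mulr_ge0; exact: ltW|rewrite ler_pM2r].
  have x0 : 0 <= se / 4 * pi by rewrite mulr_ge0 ?(ltW br0) ?(ltW pi0).
  apply: le_trans (sin_ge x0).
  have : (se / 4 * pi) ^+ 2 <= (4 / 5) ^+ 2.
    by rewrite ler_sqr ?nnegrE//; nra.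
  move=> h2; have h3 : (se / 4 * pi) ^+ 3 <= se / 4 * pi * (4 / 5) ^+ 2.
    by rewrite exprS ler_wpM2l.
  have : e * pi <= se * pi by rewrite ler_pM2r// -see expr2 ler_piMl// ltW.
  have : 0 < se * pi by rewrite mulr_gt0.
  move: h1 h3; rewrite !expr2; lra.
apply: (@le_trans _ _ (a `^ (p + 1) * (32 / 5 * 2 ^+ m) * (sin (se / 4 * r) / 2) ^+ m)).
  apply: ler_pM; [by rewrite mulr_ge0 ?powR_ge0|exact: exprn_ge0| |].
    rewrite ler_wpM2l ?powR_ge0//; apply: (le_trans Km).
    by apply: ler_pM; rewrite ?ball_volume_le_pow ?ball_volume_ge0//; lra.
  case: m {Km} => [|m]; first by rewrite !expr0.
  by rewrite lerXn2r ?nnegrE// (le_trans q0).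
rewrite expr_div_n -!mulrA [2 ^+ m * _]mulrCA divff ?expf_neq0// mulr1 !mulrA.
rewrite ler_wpM2r//.
  by rewrite exprn_ge0//; apply: sin_ge0_pi; apply/andP; split; nra.
have -> : a `^ (p + 1) = a `^ p * a.
  by rewrite powRD ?powRr1 ?(ltW a0)// gt_eqF// addr_gt0.
have h1 : a `^ p <= (3 / 16 * e) `^ p * (2^-1) `^ p.
  rewrite -powRM//; last lra.
  by apply: ge0_ler_powR; rewrite ?nnegrE; lra.
have h2 : (2^-1) `^ p <= 2^-1 * (1 - e / 2) :> R.
  rewrite -(mulr_powRB1 _ p0)// ler_pM2l//.
  have E1 : 1 <= e^-1 by rewrite -invr1 lef_pV2 ?posrE.
  have := powR_bernoulli E1 (powR_ge0 2^-1 e).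
  rewrite -powRrM mulfV ?gt_eqF// powRr1 ?invr_ge0//.
  by rewrite -lerBrDl ler_pdivrMl// -/e; lra.
apply: (@le_trans _ _ (a `^ p * (a * (32 / 5)))).
  by rewrite le_eqVlt; apply/orP; left; apply/eqP; field.
apply: (@le_trans _ _ ((3 / 16 * e) `^ p * (2^-1 * (1 - e / 2)) * (3 / 32 * e * (32 / 5)))).
  apply: ler_pM; [exact: powR_ge0|lra| |lra].
  by apply: le_trans h1 _; rewrite ler_wpM2l ?powR_ge0.
rewrite -[leLHS]mulrA -[leRHS]mulrA ler_wpM2l ?powR_ge0//.
rewrite -see; nra.
Qed.

End ratios.

(** * Hausdorff measures of spheres *)

Section hausdorff_images.
Local Open Scope ereal_scope.
Context {R : realType}.

Lemma lee_expe (x y : \bar R) k : 0 <= x -> x <= y -> x ^+ k <= y ^+ k.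
Proof.
move=> x0 xy; elim: k => [|k IH]; first by rewrite !expe0.
by rewrite !expeS lee_pmul// expe_ge0.
Qed.

Section weight.
Context {T : Type} (d : T -> T -> R) (k : nat).
Hypothesis d_ge0 : forall x y, (0 <= d x y)%R.

Lemma diameter_ge0 A : A !=set0 -> 0 <= diameter d A.
Proof.
move=> [x Ax]; apply: le_ereal_sup_tmp.
by exists (d x x)%:E; [exists (x, x)|rewrite lee_fin].
Qed.

Lemma ball_volume_div_ge0 : (0 <= ball_volume k / 2 ^+ k :> R)%R.
Proof. by rewrite divr_ge0 ?ball_volume_ge0 ?exprn_ge0. Qed.

Lemma hausdorff_weight0 : hausdorff_weight d k set0 = 0.
Proof. by rewrite /hausdorff_weight eqxx. Qed.

Lemma hausdorff_weight_ge0 A : 0 <= hausdorff_weight d k A.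
Proof.
rewrite /hausdorff_weight; case: ifPn => // /set0P A0.
by rewrite mule_ge0 ?lee_fin ?ball_volume_div_ge0// expe_ge0// diameter_ge0.
Qed.

Lemma hausdorff_weight_le A (r : R) : (0 <= r)%R -> diameter d A <= r%:E ->
  hausdorff_weight d k A <= (ball_volume k * (r / 2) ^+ k)%:E.
Proof.
move=> r0 Ar; rewrite /hausdorff_weight; case: ifPn => [_|/set0P A0].
  by rewrite lee_fin mulr_ge0 ?ball_volume_ge0// exprn_ge0// divr_ge0.
rewrite expr_div_n mulrA mulrAC [in leRHS]EFinM lee_wpmul2l ?lee_fin ?ball_volume_div_ge0//.
by rewrite EFin_expe lee_expe// diameter_ge0.
Qed.

Lemma diameter_set0 : diameter d set0 = -oo.
Proof.
rewrite /diameter (_ : [set _ | _ in _] = set0) ?ereal_sup0//.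
by rewrite -subset0 => _ [[x y] [[]]].
Qed.

Lemma diameter_le A (r : R) : (forall x y, A x -> A y -> (d x y <= r)%R) ->
  diameter d A <= r%:E.
Proof. by move=> Ar; apply: ge_ereal_sup => _ [[x y] [Ax Ay] <-]; rewrite lee_fin Ar. Qed.

Lemma hausdorff_size_le delta A : (0 < delta)%R ->
  hausdorff_size d k delta A <= hausdorff d k A.
Proof. by move=> d0; apply: ereal_sup_ubound; exists delta. Qed.

Lemma hausdorff_size_ge0 delta A : 0 <= hausdorff_size d k delta A.
Proof.
apply: le_ereal_inf_tmp => _ [F _ <-].
by apply: nneseries_ge0 => n _ _; exact: hausdorff_weight_ge0.
Qed.

End weight.

Lemma hausdorff_image {T1 T2 : Type} (d1 : T1 -> T1 -> R) (d2 : T2 -> T2 -> R)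
    (k : nat) (f : T1 -> T2) (A : set T1) (c : R) :
  (forall x y, 0 <= d1 x y)%R -> (forall x y, 0 <= d2 x y)%R -> (0 < c)%R ->
  (forall x y, A x -> A y -> (d2 (f x) (f y) <= c * d1 x y)%R) ->
  hausdorff d2 k (f @` A) <= (c ^+ k)%:E * hausdorff d1 k A.
Proof.
move=> d1_ge0 d2_ge0 c0 fc.
have diam_image B : diameter d2 (f @` (B `&` A)) <= c%:E * diameter d1 B.
  apply: ge_ereal_sup => _ [[_ _] [[x [Bx Ax] <-] [y [By Ay] <-]] <-] /=.
  apply: (@le_trans _ _ (c * d1 x y)%:E); first by rewrite lee_fin fc.
  rewrite EFinM lee_wpmul2l ?lee_fin ?(ltW c0)//.
  by apply: ereal_sup_ubound; exists (x, y).
have weight_image B : hausdorff_weight d2 k (f @` (B `&` A)) <=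
    (c ^+ k)%:E * hausdorff_weight d1 k B.
  rewrite {1}/hausdorff_weight; case: ifPn => [_|/set0P [_ [x [Bx Ax] _]]].
    rewrite mule_ge0 ?lee_fin ?exprn_ge0 ?(ltW c0)//.
    exact: hausdorff_weight_ge0.
  rewrite /hausdorff_weight ifF; last by apply/eqP => B0; rewrite B0 in Bx.
  rewrite muleCA lee_wpmul2l ?lee_fin ?ball_volume_div_ge0//.
  apply: (@le_trans _ _ ((c%:E * diameter d1 B) ^+ k)).
    by rewrite lee_expe// diameter_ge0//; exists (f x); exists x.
  elim: k => [|k IH]; first by rewrite !expe0 expr0 mul1e.
  rewrite !expeS exprS EFinM muleACA lee_pmul//.
  - rewrite mule_ge0 ?lee_fin ?(ltW c0)// diameter_ge0//; by exists x.
  - rewrite expe_ge0// mule_ge0 ?lee_fin ?(ltW c0)// diameter_ge0//; by exists x.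
apply: ge_ereal_sup => _ [e /= e0 <-].
(* A cover at scale e / c is mapped to a cover at scale e. *)
apply: (@le_trans _ _ ((c ^+ k)%:E * hausdorff_size d1 k (e / c) A)); last first.
  rewrite lee_wpmul2l ?lee_fin ?exprn_ge0 ?(ltW c0)// hausdorff_size_le//.
  by rewrite divr_gt0.
have ck0 : (0 < c ^+ k)%R by rewrite exprn_gt0.
rewrite -lee_pdivrMl//; apply: le_ereal_inf_tmp => _ [F [dF AF] <-].
rewrite lee_pdivrMl// -nneseriesZl; last by move=> *; exact: hausdorff_weight_ge0.
apply: (@le_trans _ _ (\sum_(i <oo) hausdorff_weight d2 k (f @` (F i `&` A)))).
  apply: ereal_inf_lbound; exists (fun i => f @` (F i `&` A)) => //; split => [i|].
    apply: le_trans (diam_image _) _; rewrite muleC -lee_pdivlMr//.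
  move=> _ [x Ax <-]; have [i _ Fix] := AF _ Ax.
  by exists i => //; exists x.
apply: lee_nneseries => [i _ _|i _]; last exact: weight_image.
exact: hausdorff_weight_ge0.
Qed.

Section subadditivity.
Context {T : pointedType} (d : T -> T -> R) (k : nat).
Hypothesis d_ge0 : forall x y, (0 <= d x y)%R.

Lemma hausdorff_size_weight delta A : diameter d A <= delta%:E ->
  hausdorff_size d k delta A <= hausdorff_weight d k A.
Proof.
move=> Ad; apply: ereal_inf_lbound.
exists (fun i => if i is 0%N then A else set0); first split.
- by case=> [//|i]; rewrite diameter_set0 leNye.
- by move=> x Ax; exists 0%N.
- rewrite nneseries_recl//; last by move=> *; exact: hausdorff_weight_ge0.
  rewrite eseries0 ?adde0// => i i0 _.
  by case: i i0 => // i _; rewrite hausdorff_weight0.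
Qed.

Lemma hausdorff_size_setU delta A B :
  hausdorff_size d k delta (A `|` B) <=
  hausdorff_size d k delta A + hausdorff_size d k delta B.
Proof.
have h := @mu_ext_sigma_subadditive _ (small d delta) R
  (hausdorff_weight d k) (hausdorff_weight_ge0 k d_ge0) (bigcup2 A B).
have H0 : hausdorff_size d k delta set0 = 0.
  apply/eqP; rewrite eq_le hausdorff_size_ge0// andbT.
  rewrite -(hausdorff_weight0 d k); apply: hausdorff_size_weight.
  by rewrite diameter_set0 leNye.
rewrite bigcup2E in h.
rewrite (nneseries_split 0 2) in h; last by move=> *; exact: hausdorff_size_ge0.
rewrite add0n big_nat_recl// big_nat1/= in h.
rewrite eseries0 ?adde0 in h; first exact: h.
by move=> [|[|i]]//= _ _; exact: H0.
Qed.

Lemma hausdorff_size_seq delta (I : Type) (s : seq I) (F : I -> set T) :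
  hausdorff_size d k delta (\big[setU/set0]_(i <- s) F i) <=
  \sum_(i <- s) hausdorff_size d k delta (F i).
Proof.
elim: s => [|i s IH].
  rewrite !big_nil -(hausdorff_weight0 d k); apply: hausdorff_size_weight.
  by rewrite diameter_set0 leNye.
by rewrite !big_cons; apply: le_trans (hausdorff_size_setU _ _ _) _; rewrite leeD2l.
Qed.

Lemma le_hausdorff_size delta A B : A `<=` B ->
  hausdorff_size d k delta A <= hausdorff_size d k delta B.
Proof.
move=> AB; apply: ereal_inf_le_tmp => _ [F [dF BF] <-]; exists F => //.
by split => //; exact: subset_trans BF.
Qed.

Lemma hausdorff_size_finite_cover delta (r : R) (I : finType) (F : I -> set T) A :
  (0 <= r <= delta)%R -> (forall i x y, F i x -> F i y -> (d x y <= r)%R) ->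
  A `<=` \bigcup_i F i ->
  hausdorff_size d k delta A <= (#|I|%:R * (ball_volume k * (r / 2) ^+ k))%:E.
Proof.
move=> /andP[r0 rd] Fr AF.
apply: (@le_trans _ _ (hausdorff_size d k delta (\big[setU/set0]_(i : I) F i))).
  by apply: le_hausdorff_size => x /AF [i _ Fix]; rewrite (bigD1 i)//=; left.
apply: le_trans (hausdorff_size_seq _ _ _) _.
apply: (@le_trans _ _ (\sum_(i : I) (ball_volume k * (r / 2) ^+ k)%:E)); last first.
  by rewrite sumEFin sumr_const mulr_natl.
apply: lee_sum => i _; apply: le_trans (hausdorff_size_weight _) _.
  by apply: le_trans (diameter_le (Fr i)) _; rewrite lee_fin.
by apply: hausdorff_weight_le => //; exact: diameter_le (Fr i).
Qed.

End subadditivity.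
End hausdorff_images.

(** * Geometry of the round sphere: reflections and midpoints *)

Section sphere_geometry.
Context {R : realType} {n : nat}.
Local Notation S := (sphere R n).
Implicit Types (x y z : S) (u v w : 'rV[R]_n).

Lemma dotNl u v : dot (- u) v = - dot u v.
Proof. by rewrite -scaleN1r dotZl mulN1r. Qed.

Lemma dotNr u v : dot v (- u) = - dot v u.
Proof. by rewrite dotC dotNl dotC. Qed.

Lemma dotBl u v w : dot (u - v) w = dot u w - dot v w.
Proof. by rewrite dotDl dotNl. Qed.

Lemma dotBr u v w : dot w (u - v) = dot w u - dot w v.
Proof. by rewrite dotDr dotNr. Qed.

Lemma dot0l v : dot 0 v = 0.
Proof. by rewrite /dot big1// => i _; rewrite mxE mul0r. Qed.

Lemma enormN u : enorm (- u) = enorm u.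
Proof. by rewrite /enorm dotNl dotNr opprK. Qed.

Lemma norm_dot_le u v : `|dot u v| <= enorm u * enorm v.
Proof. by rewrite ler_norml dot_le andbT lerNl -dotNl -(enormN u) dot_le. Qed.

Lemma enorm_sphere x : enorm (sphere_point x) = 1.
Proof. by case: x => x /= h; exact: (set_mem h). Qed.

Lemma dot_sphere x : dot (sphere_point x) (sphere_point x) = 1.
Proof. by rewrite -enorm_sq enorm_sphere expr1n. Qed.

Lemma sphere_point_inj : injective (@sphere_point R n).
Proof. by move=> x y /val_inj. Qed.

Definition to_sphere u (u1 : dot u u = 1) : S :=
  exist _ u (mem_set (etrans (congr1 Num.sqrt u1) (sqrtr1 R))).

Lemma to_sphereE u (u1 : dot u u = 1) : sphere_point (to_sphere u1) = u.
Proof. by []. Qed.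

Lemma dot_sphere_itv x y : -1 <= dot (sphere_point x) (sphere_point y) <= 1.
Proof.
by rewrite -ler_norml (le_trans (norm_dot_le _ _))// !enorm_sphere mulr1.
Qed.

Lemma cos_sphere_dist x y : cos (sphere_dist x y) = dot (sphere_point x) (sphere_point y).
Proof. by rewrite acosK// in_itv/= dot_sphere_itv. Qed.

Lemma sphere_dist_itv x y : 0 <= sphere_dist x y <= pi.
Proof. by rewrite acos_ge0 ?acos_lepi// dot_sphere_itv. Qed.

Lemma sphere_dist_ge0 x y : 0 <= sphere_dist x y.
Proof. by case/andP: (sphere_dist_itv x y). Qed.

Lemma sphere_distC x y : sphere_dist x y = sphere_dist y x.
Proof. by rewrite /sphere_dist dotC. Qed.

Lemma chord_sqr x y : chord x y ^+ 2 = 2 * (1 - dot (sphere_point x) (sphere_point y)).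
Proof.
rewrite enorm_sq dotBl !dotBr !dot_sphere (dotC (sphere_point y)).
by ring.
Qed.

Lemma chordC x y : chord x y = chord y x.
Proof. by rewrite /chord -opprB enormN. Qed.

Lemma chord_le_sphere_dist x y : chord x y <= sphere_dist x y.
Proof.
rewrite -ler_sqr ?nnegrE ?enorm_ge0 ?sphere_dist_ge0// chord_sqr -cos_sphere_dist.
have := cos_ge (sphere_dist_ge0 x y); lra.
Qed.

Lemma chord_triangle x y z : chord x z <= chord x y + chord y z.
Proof.
rewrite /chord (_ : sphere_point x - sphere_point z =
  (sphere_point x - sphere_point y) + (sphere_point y - sphere_point z)) ?enormD//.
by rewrite addrA subrK.
Qed.

(** Only the component of x orthogonal to z contributes, and its norm is the sine of the distance
    from x to z. *)
Lemma sphere_bessel x z w : dot (sphere_point z) w = 0 ->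
  `|dot (sphere_point x) w| <= enorm w * sin (sphere_dist x z).
Proof.
move=> zw; set c := dot (sphere_point x) (sphere_point z).
have -> : dot (sphere_point x) w = dot (sphere_point x - c *: sphere_point z) w.
  by rewrite dotBl dotZl zw mulr0 subr0.
apply: le_trans (norm_dot_le _ _) _.
rewrite mulrC ler_wpM2l ?enorm_ge0// sin_acos ?dot_sphere_itv// -/c.
rewrite /enorm dotBl !dotBr !dotZr !dotZl !dot_sphere (dotC (sphere_point z)) -/c.
by rewrite ler_wsqrtr// expr2; lra.
Qed.

(* The Householder reflection exchanging the unit vectors u and v; it is the
   identity when u = v, as then it subtracts a multiple of 0. *)
Definition reflection u v w : 'rV[R]_n :=
  w - (2 * dot w (u - v) / dot (u - v) (u - v)) *: (u - v).

Lemma reflection_dot u v w1 w2 : dot (reflection u v w1) (reflection u v w2) = dot w1 w2.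
Proof.
rewrite /reflection; move: (u - v) => d; have [d0|d0] := eqVneq (dot d d) 0.
  by rewrite d0 invr0 !mulr0 !scale0r !subr0.
rewrite !(dotBl, dotBr, dotZl, dotZr) (dotC d w2).
by field.
Qed.

Lemma reflectionE u v : dot u u = 1 -> dot v v = 1 -> reflection u v u = v.
Proof.
move=> u1 v1; rewrite /reflection.
have [uv|uv] := eqVneq (dot (u - v) (u - v)) 0.
  rewrite uv invr0 mulr0 scale0r subr0; apply/eqP; rewrite -subr_eq0; apply/eqP.
  by apply: enorm_eq0; rewrite /enorm uv sqrtr0.
suff -> : 2 * dot u (u - v) / dot (u - v) (u - v) = 1 by rewrite scale1r subKr.
apply: (mulIf uv); rewrite mulrVK ?unitfE// mul1r.
by rewrite !(dotBl, dotBr) u1 v1 (dotC v); ring.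
Qed.

Lemma reflectionK u v w : reflection u v (reflection u v w) = w.
Proof.
rewrite /reflection; move: (u - v) => d; have [d0|d0] := eqVneq (dot d d) 0.
  by rewrite d0 invr0 !mulr0 !scale0r !subr0.
rewrite dotBl dotZl; apply/rowP => i; rewrite !mxE.
by field.
Qed.

Lemma reflection_unit u v x :
  dot (reflection u v (sphere_point x)) (reflection u v (sphere_point x)) = 1.
Proof. by rewrite reflection_dot dot_sphere. Qed.

Definition sphere_reflection (x y z : S) : S :=
  to_sphere (reflection_unit (sphere_point x) (sphere_point y) z).

Lemma sphere_reflection_dot x y z1 z2 :
  dot (sphere_point (sphere_reflection x y z1)) (sphere_point (sphere_reflection x y z2)) =
  dot (sphere_point z1) (sphere_point z2).
Proof. by rewrite !to_sphereE reflection_dot. Qed.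

Lemma sphere_reflection_chord x y z1 z2 :
  chord (sphere_reflection x y z1) (sphere_reflection x y z2) = chord z1 z2.
Proof.
by apply: (@pexpIrn _ 2); rewrite ?nnegrE ?enorm_ge0// !chord_sqr sphere_reflection_dot.
Qed.

Lemma sphere_reflectionE x y : sphere_reflection x y x = y.
Proof. by apply: sphere_point_inj; rewrite to_sphereE reflectionE ?dot_sphere. Qed.

Lemma sphere_reflectionK x y : involutive (sphere_reflection x y).
Proof. by move=> z; apply: sphere_point_inj; rewrite !to_sphereE reflectionK. Qed.

End sphere_geometry.

(** Provides a midpoint for antipodal points, whose sum vanishes and gives no direction. The vector
    u_1 e_0 - u_0 e_1 is orthogonal to u; if it vanishes, then u_0 = 0 and e_0 does the job. *)
Lemma exists_orthogonal_unit (R : realType) n (u : 'rV[R]_n.+2) :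
  exists2 z : sphere R n.+2, dot (sphere_point z) u = 0 & True.
Proof.
pose e (i : 'I_n.+2) : 'rV[R]_n.+2 := delta_mx 0 i.
have eu i w : dot (e i) w = w 0 i.
  rewrite /dot (bigD1 i)//= big1 ?addr0 ?mxE ?eqxx ?mul1r// => j ji.
  by rewrite mxE (negbTE ji) andbF mul0r.
pose i1 : 'I_n.+2 := lift ord0 ord0.
pose v := u 0 i1 *: e ord0 - u 0 ord0 *: e i1.
have vu : dot v u = 0 by rewrite dotBl !dotZl !eu mulrC subrr.
have vv : dot v v = u 0 i1 ^+ 2 + u 0 ord0 ^+ 2.
  by rewrite dotBl !dotBr !dotZl !dotZr !eu !mxE/=; ring.
have [v0|v0] := eqVneq (dot v v) 0.
  have u00 : u 0 ord0 = 0.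
    apply/eqP; rewrite -sqrf_eq0; apply/eqP.
    by move: v0; rewrite vv; have := sqr_ge0 (u 0 i1); have := sqr_ge0 (u 0 ord0); lra.
  have e1 : dot (e ord0) (e ord0) = 1 by rewrite eu mxE !eqxx.
  by exists (to_sphere e1) => //; rewrite to_sphereE eu.
have v1 : dot ((enorm v)^-1 *: v) ((enorm v)^-1 *: v) = 1.
  by rewrite dotZl dotZr mulrA -expr2 exprVn enorm_sq mulVf.
by exists (to_sphere v1) => //; rewrite to_sphereE dotZl vu mulr0.
Qed.

(** Unless the points are antipodal, z is x + y divided by its norm 2 cos k. The first relation is
    then linear; the second is [sphere_bessel] for x - y, which is orthogonal to z and has norm 2
    sin k. *)
Lemma sphere_midpoint (R : realType) n (x y : sphere R n.+2) :
  exists z : sphere R n.+2, forall x' : sphere R n.+2,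
    cos (sphere_dist x' x) + cos (sphere_dist x' y) =
      2 * (cos (sphere_dist x y / 2) * cos (sphere_dist x' z)) /\
    `|cos (sphere_dist x' x) - cos (sphere_dist x' y)| <=
      2 * (sin (sphere_dist x y / 2) * sin (sphere_dist x' z)).
Proof.
set k := sphere_dist x y / 2.
have /andP[r0 rpi] := sphere_dist_itv x y.
have pi0 := @pi_gt0 R.
have ck0 : 0 <= cos k by apply: cos_ge0_pihalf; apply/andP; split; rewrite /k; lra.
have sk0 : 0 <= sin k by apply: sin_ge0_pi; apply/andP; split; rewrite /k; lra.
have cos2k : dot (sphere_point x) (sphere_point y) = cos k ^+ 2 *+ 2 - 1.
  by rewrite -cos_sphere_dist -cos_mulr2n; congr cos; rewrite /k -[RHS]mulr_natr divfK.
have diff : enorm (sphere_point x - sphere_point y) = 2 * sin k.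
  apply: (@pexpIrn _ 2); rewrite ?nnegrE ?enorm_ge0 ?mulr_ge0//.
  rewrite [LHS]chord_sqr cos2k exprMn sin2cos2; ring.
suff [z zd zs] : exists2 z : sphere R n.+2,
    dot (sphere_point z) (sphere_point x - sphere_point y) = 0 &
    sphere_point x + sphere_point y = (2 * cos k) *: sphere_point z.
  exists z => x'; rewrite !cos_sphere_dist -dotDr -dotBr zs dotZr mulrA; split => //.
  by apply: le_trans (sphere_bessel x' zd) _; rewrite diff mulrA.
have [ck|ck] := eqVneq (cos k) 0.
  have [z zxy _] := exists_orthogonal_unit (sphere_point x - sphere_point y).
  exists z => //; rewrite ck mulr0 scale0r; apply: enorm_eq0.
  rewrite /enorm dotDl !dotDr !dot_sphere (dotC (sphere_point y)) cos2k ck.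
  by rewrite expr0n/= mul0rn; apply/eqP; rewrite sqrtr_eq0; lra.
have ck2 : 2 * cos k != 0 by rewrite mulf_neq0.
have z1 : dot ((2 * cos k)^-1 *: (sphere_point x + sphere_point y))
    ((2 * cos k)^-1 *: (sphere_point x + sphere_point y)) = 1.
  rewrite dotZl dotZr dotDl !dotDr !dot_sphere (dotC (sphere_point y)) cos2k.
  by field.
exists (to_sphere z1); rewrite to_sphereE.
  by rewrite dotZl dotDl !dotBr !dot_sphere (dotC (sphere_point y)); ring.
by rewrite scalerA mulfV// scale1r.
Qed.

(** * Positivity and finiteness of the area of the sphere *)

Section box_cover.
Local Open Scope ereal_scope.
Context {R : realType}.

Definition in_box (c : nat -> nat -> R) (d : nat -> R) (n : nat) (q : nat -> R) (i : nat) : R :=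
  \prod_(j < n) \1_(`[c i j, c i j + d i]%classic) (q j).

(* Integrating out the coordinates of the cube one at a time. *)
Lemma box_cover_volume (c : nat -> nat -> R) (d : nat -> R) (l : R) n :
  (forall i, 0 <= d i)%R -> (0 <= l)%R -> forall (w : nat -> R) (a : R),
  (forall i, 0 <= w i)%R ->
  (forall q : nat -> R, (forall j, (0 <= q j <= l)%R) ->
     a%:E <= \sum_(i <oo) (w i * in_box c d n q i)%:E) ->
  (a * l ^+ n)%:E <= \sum_(i <oo) (w i * d i ^+ n)%:E.
Proof.
move=> d0 l0; elim: n => [|n IH] w a w0 H.
  have := H (fun=> 0%R); rewrite lexx l0/= expr0 mulr1 => /(_ (fun=> isT)) H0.
  apply: (le_trans H0); apply: lee_nneseries => i *; rewrite /in_box big_ord0 ?expr0//.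
  by rewrite mulr1 lee_fin.
have -> : (a * l ^+ n.+1)%R = (a * l * l ^+ n)%R by rewrite exprS mulrA.
under eq_eseriesr do rewrite exprS mulrA.
apply: IH => [i|q ql]; first exact: mulr_ge0.
have box_ge0 i : (0 <= in_box c d n q i)%R by apply: prodr_ge0 => j _; rewrite indicE.
pose J i : set R := `[c i n, (c i n + d i)%R]%classic.
pose f i (t : R) := (w i * in_box c d n q i)%:E * (\1_(J i) t)%:E.
have wb0 i : (0 <= w i * in_box c d n q i)%R by rewrite mulr_ge0.
have f0 i t : 0 <= f i t by rewrite mule_ge0 // lee_fin// indicE.
have mJ i : measurable (J i : set (measurableTypeR R)) by exact: measurable_itv.
have mJl i : measurable (J i `&` `[0%R, l] : set (measurableTypeR R)).
  by apply: measurableI => //; exact: measurable_itv.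
pose g i (t : R) : \bar R := (\1_(J i) t)%:E.
have m1 i : measurable_fun (`[0%R, l]%classic : set (measurableTypeR R)) (g i).
  apply/measurable_EFinP; apply: measurable_funTS; exact: (measurable_indic (mJ i)).
have mf i : measurable_fun (`[0%R, l]%classic : set (measurableTypeR R)) (f i).
  apply: measurable_funeM; exact: m1.
have lam : lebesgue_measure (`[0%R, l]%classic : set R) = l%:E.
  rewrite lebesgue_measure_itv/= lte_fin; case: ltP => [_|l0']; first by rewrite sube0.
  by congr EFin; apply/eqP; rewrite eq_le l0 l0'.
have int_f i : \int[lebesgue_measure]_(t in `[0%R, l]) f i t <=
    (w i * d i * in_box c d n q i)%:E.
  rewrite ge0_integralZl_EFin//; last exact: m1.
  rewrite integral_indic//.
  have -> : (w i * d i * in_box c d n q i = w i * in_box c d n q i * d i)%R by rewrite mulrAC.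
  rewrite [leRHS]EFinM; apply: lee_wpmul2l; first by rewrite lee_fin.
  apply: (@le_trans _ _ (lebesgue_measure (J i))).
    by apply: le_measure; rewrite ?inE.
  rewrite lebesgue_measure_itv/= lte_fin; case: ifPn => _; last by rewrite lee_fin.
  by rewrite -EFinB lee_fin addrAC subrr add0r.
apply: (@le_trans _ _ (\sum_(i <oo) \int[lebesgue_measure]_(t in `[0%R, l]) f i t)); last first.
  by apply: lee_nneseries => [i _ _|i _]; [apply: integral_ge0 => t _|exact: int_f].
rewrite -integral_nneseries//.
apply: (@le_trans _ _ (\int[lebesgue_measure]_(t in `[0%R, l]%classic) a%:E)).
  by rewrite integral_cst//= lam.
have [a0|a0] := leP 0%R a; last first.
  apply: (@le_trans _ _ 0); last first.
    by apply: integral_ge0 => t _; apply: nneseries_ge0.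
  by rewrite integral_cst//= lam lee_fin mulr_le0_ge0// ltW.
apply: ge0_le_integral => //.
- exact: ge0_emeasurable_sum.
- move=> t /=; rewrite in_itv/= => tl.
  have qP j : (0 <= (if j == n then t else q j) <= l)%R by case: ifP.
  apply: (le_trans (H _ qP)); rewrite le_eqVlt; apply/orP; left; apply/eqP.
  apply: eq_eseriesr => i _; rewrite /f -EFinM -mulrA; congr (_ * _)%:E.
  rewrite /in_box big_ord_recr/= eqxx; congr (_ * _)%R.
  by apply: eq_bigr => j _; rewrite ltn_eqF.
Qed.

End box_cover.

Lemma enorm_le_sum (R : realType) n (u : 'rV[R]_n) : enorm u <= \sum_i `|u 0 i|.
Proof.
have s0 : 0 <= \sum_i `|u 0 i| by exact: sumr_ge0.
rewrite -ler_sqr ?nnegrE ?enorm_ge0// enorm_sq /dot expr2 mulr_suml.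
apply: ler_sum => i _; rewrite -expr2 -real_normK ?num_real// expr2 ler_wpM2l//.
by rewrite (bigD1 i)//= lerDl sumr_ge0.
Qed.

Section sphere_area.
Context {R : realType} {n : nat}.
Local Notation S := (sphere R n.+1).
Local Notation H := (hausdorff (@chord R n.+1) n).

(** Forgetting the first coordinate does not increase distances, and the image of the sphere
    contains the cube [0, l]^n. A cover of the sphere thus yields a cover of the cube by boxes whose
    sides are the diameters of its members, and [box_cover_volume] bounds its weight below. *)
Lemma hausdorff_sphere_gt0 : (0 < H [set: S])%E.
Proof.
(* Small enough for the coordinates of a point of the cube to have squares of sum at most 1, so that
   the point lifts to the sphere. *)
pose l : R := n.+1%:R^-1.
have l0 : 0 < l by rewrite invr_gt0.
pose w : R := ball_volume n / 2 ^+ n.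
have bv0 : forall k, 0 < ball_volume k :> R.
  move=> k; suff : 0 < ball_volume k :> R /\ 0 < ball_volume k.+1 :> R by case.
  elim: k => [|k [IH1 IH2]]; first by rewrite /= ltr01 ltr0n.
  split => //; rewrite [ball_volume _]/=; apply: mulr_gt0 => //.
  by apply: divr_gt0 => //; apply: mulr_gt0 => //; exact: pi_gt0.
have w0 : 0 < w by apply: divr_gt0 => //; exact: exprn_gt0.
apply: (@lt_le_trans _ _ (w * l ^+ n)%:E); first by rewrite lte_fin mulr_gt0 ?exprn_gt0.
apply: le_trans (hausdorff_size_le (@chord R n.+1) n setT ltr01).
apply: le_ereal_inf_tmp => _ [F [dF SF] <-].
have chord_le1 i x y : F i x -> F i y -> chord x y <= 1.
  by move=> Fx Fy; rewrite -lee_fin; apply: le_trans (dF i); apply: ereal_sup_ubound; exists (x, y).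
pose d i : R := if pselect (F i !=set0) then fine (diameter (@chord R n.+1) (F i)) else 0.
have diam_fin i : F i !=set0 -> diameter (@chord R n.+1) (F i) \is a fin_num.
  move=> F0; rewrite ge0_fin_numE ?diameter_ge0//; last exact: chord_ge0.
  by apply: le_lt_trans (dF i) _; rewrite ltry.
have d_ge0 i : 0 <= d i.
  rewrite /d; case: pselect => // F0; rewrite fine_ge0// diameter_ge0//.
  exact: chord_ge0.
pose x_ (x : S) (j : nat) : R := if insub j is Some j' then sphere_point x 0 (lift ord0 j') else 0.
pose c i j : R := inf [set x_ x j | x in F i].
have dP i x y : F i x -> F i y -> chord x y <= d i.
  move=> Fx Fy; have F0 : F i !=set0 by exists x.
  rewrite /d; case: pselect => // ?; rewrite -lee_fin fineK ?diam_fin//.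
  by apply: ereal_sup_ubound; exists (x, y).
have coord_le x y j : `|x_ x j - x_ y j| <= chord x y.
  rewrite /x_; case: insub => [j'|]; last by rewrite subrr normr0 enorm_ge0.
  by have := normr_coord_le (sphere_point x - sphere_point y) (lift ord0 j'); rewrite !mxE.
have boxP i x j : F i x -> c i j <= x_ x j <= c i j + d i.
  move=> Fx; have lb : forall y, F i y -> x_ x j - d i <= x_ y j.
    move=> y Fy; rewrite lerBlDr -lerBlDl.
    by apply: le_trans (ler_norm _) _; apply: le_trans (coord_le _ _ _) (dP _ _ _ Fx Fy).
  apply/andP; split.
    by apply: ge_inf; [exists (x_ x j - d i) => _ [y Fy <-]; exact: lb|exists x].
  rewrite -lerBlDr; apply: lb_le_inf; first by exists (x_ x j), x.
  by move=> _ [y Fy <-]; exact: lb.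
(* Empty members must weigh 0, which the factor d i ^+ n does not ensure when n = 0. *)
have weightE i : ((if pselect (F i !=set0) then w else 0) * d i ^+ n)%:E =
    hausdorff_weight (@chord R n.+1) n (F i).
  rewrite /hausdorff_weight /d; case: pselect => [F0|F0]; last first.
    by rewrite mul0r ifT//; apply/eqP; rewrite -subset0 => x Fx; apply: F0; exists x.
  rewrite ifF; last by apply/eqP => FE; case: F0 => x; rewrite FE.
  by rewrite EFinM EFin_expe fineK ?diam_fin.
under eq_eseriesr do rewrite -weightE.
apply: (box_cover_volume d_ge0 (ltW l0) (c := c)).
  by move=> i; case: pselect => // ?; exact: ltW.
move=> q ql.
pose u : 'rV[R]_n.+1 := \row_i (if unlift ord0 i is Some j then q j else
   Num.sqrt (1 - \sum_(j < n) q j ^+ 2)).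
have q1 : \sum_(j < n) q j ^+ 2 <= 1.
  apply: (@le_trans _ _ (\sum_(j < n) l)).
    apply: ler_sum => j _; have /andP[q0 ql'] := ql j.
    rewrite expr2; apply: (@le_trans _ _ (l * 1)); last by rewrite mulr1.
    apply: ler_pM => //; apply: le_trans ql' _.
    by rewrite invf_le1// ler1n.
  rewrite sumr_const card_ord -[l *+ n]mulr_natr mulrC ler_pdivrMr// mul1r ler_nat.
  exact: leqnSn.
have u1 : dot u u = 1.
  rewrite /dot big_ord_recl !mxE unlift_none -expr2 sqr_sqrtr ?subr_ge0//.
  rewrite [X in _ + X](eq_bigr (fun j : 'I_n => q j ^+ 2)) ?subrK// => j _.
  by rewrite mxE liftK expr2.
have [i _ Fi] := SF (to_sphere u1) I.
have xq j : (j < n)%N -> x_ (to_sphere u1) j = q j.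
  by move=> jn; rewrite /x_ insubT to_sphereE mxE liftK.
apply: (@le_trans _ _ (w * in_box c d n q i)%:E).
  rewrite lee_fin ler_peMr ?(ltW w0)// /in_box.
  rewrite big1 ?lexx// => j _; rewrite indicE mem_set//= in_itv/= -(xq j)//.
  exact: boxP.
rewrite (@nneseriesD1 _ _ i)//; last first.
  move=> k _; rewrite lee_fin; apply: mulr_ge0; first by case: pselect => // ?; exact: ltW.
  by apply: prodr_ge0 => j _; rewrite indicE.
case: pselect => [?|[]]; last by exists (to_sphere u1).
rewrite leeDl//; apply: nneseries_ge0 => k _ _; rewrite lee_fin; apply: mulr_ge0.
  by case: pselect => // ?; exact: ltW.
by apply: prodr_ge0 => j _; rewrite indicE.
Qed.

(** Some coordinate has absolute value at least 1 / (n + 1), and where this holds with a given sign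
    it is a Lipschitz function of the n others. Rounding those to a grid of mesh 1 / N gives O(N^n)
    pieces of diameter at most C / N, whose total weight is bounded independently of N. *)
Lemma hausdorff_sphere_lty : (H [set: S] < +oo)%E.
Proof.
pose C : R := n%:R + 2 * n%:R * n.+1%:R + 1.
have C0 : 0 < C by rewrite ltr_wpDl// addr_ge0// mulr_ge0// mulr_ge0.
pose K : R := 2 * n.+1%:R * (ball_volume n * (3 * C / 2) ^+ n).
apply: (@le_lt_trans _ _ K%:E); last exact: ltry.
apply: ge_ereal_sup => _ [e /= e0 <-].
pose N := (Num.truncn (C / e)).+1.
have N0 : 0 < N%:R :> R by rewrite ltr0n.
have CN : C / N%:R <= e.
  rewrite ler_pdivrMr// mulrC -ler_pdivrMr// ltW// /N.
  by rewrite truncnS_gt// num_real.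
pose label (x : S) (i : 'I_n.+1) (j : 'I_n) : nat :=
  Num.truncn ((sphere_point x 0 (lift i j) + 1) * N%:R).
pose I := ('I_n.+1 * bool * {ffun 'I_n -> 'I_(N.*2.+1)})%type.
pose F (a : I) : set S := [set x | [/\ 1 <= n.+1%:R * `|sphere_point x 0 a.1.1|,
  (0 <= sphere_point x 0 a.1.1) = a.1.2 & forall j, label x a.1.1 j = a.2 j]].
have coord1 (x : S) i : `|sphere_point x 0 i| <= 1.
  by rewrite -(enorm_sphere x) normr_coord_le.
have Fd a x y : F a x -> F a y -> chord x y <= C / N%:R.
  case: a => -[i b] g [/= x1 xb xg] [/= y1 yb yg].
  have close j : `|sphere_point x 0 (lift i j) - sphere_point y 0 (lift i j)| <= N%:R^-1.
    have := xg j; rewrite -(yg j) /label => h.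
    have pos (z : S) : 0 <= (sphere_point z 0 (lift i j) + 1) * N%:R.
      rewrite mulr_ge0//; have := coord1 z (lift i j).
      by rewrite ler_norml => /andP[]; lra.
    have /andP[y_1 y_2] := truncn_itv (pos y); have /andP[x_1 x_2] := truncn_itv (pos x).
    rewrite h -natr1 in x_1 x_2; rewrite -natr1 in y_2.
    rewrite -[leRHS]mul1r ler_pdivlMr// -[N%:R]gtr0_norm// -normrM ler_norml.
    by apply/andP; split; lra.
  (* The difference of the squares of the i-th coordinates is controlled by the other coordinates,
     and their sum has absolute value at least 1 / (n + 1) since the signs agree. *)
  have key : `|sphere_point x 0 i - sphere_point y 0 i| <= 2 * n%:R * n.+1%:R / N%:R.
    have sq (z : S) : sphere_point z 0 i ^+ 2 = 1 - \sum_(j < n) sphere_point z 0 (lift i j) ^+ 2.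
      have := dot_sphere z; rewrite /dot (bigD1_ord i)//= => <-.
      by rewrite -!expr2 [X in _ + X - _](eq_bigr (fun j => sphere_point z 0 (lift i j) ^+ 2)) ?addrK.
    have sumle : `|sphere_point x 0 i ^+ 2 - sphere_point y 0 i ^+ 2| <= 2 * n%:R / N%:R.
      rewrite !sq (_ : 1 - _ - _ = \sum_(j < n) (sphere_point y 0 (lift i j) ^+ 2 - sphere_point x 0 (lift i j) ^+ 2)); last first.
        by rewrite sumrB; ring.
      apply: le_trans (ler_norm_sum _ _ _) _.
      apply: (@le_trans _ _ (\sum_(j < n) (2 / N%:R))); last first.
        by rewrite sumr_const card_ord -[_ *+ n]mulr_natr mulrAC.
      apply: ler_sum => j _; rewrite subr_sqr normrM mulrC.
      apply: ler_pM => //; last by rewrite distrC.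
      apply: le_trans (ler_normD _ _) _.
      by have := coord1 x (lift i j); have := coord1 y (lift i j); lra.
    move: sumle; rewrite subr_sqr normrM.
    set D := `|_ - _|; set E := `|_ + _| => DE.
    have E1 : 1 <= n.+1%:R * E.
      apply: le_trans x1 _; rewrite ler_wpM2l// /E.
      move: xb yb; case: b => [x0 y0|/negbT + /negbT]; rewrite -?ltNge.
        by rewrite !ger0_norm// ?addr_ge0// lerDl.
      move=> x0 y0; rewrite !ltr0_norm ?addr_lt0//; lra.
    have D0 : 0 <= D by rewrite normr_ge0.
    have h1 : D * 1 <= D * (n.+1%:R * E) by rewrite ler_wpM2l.
    have h2 : n.+1%:R * (D * E) <= n.+1%:R * (2 * n%:R / N%:R) by rewrite ler_wpM2l.
    apply: (le_trans _ (le_trans h2 _)); first by move: h1; rewrite mulr1 mulrCA.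
    by rewrite le_eqVlt; apply/orP; left; apply/eqP; ring.
  apply: le_trans (enorm_le_sum _) _; rewrite (bigD1_ord i)//= !mxE.
  apply: (@le_trans _ _ (2 * n%:R * n.+1%:R / N%:R + \sum_(j < n) N%:R^-1)).
    by apply: lerD => //; apply: ler_sum => j _; rewrite !mxE.
  rewrite sumr_const card_ord -[_ *+ n]mulr_natl /C !mulrDl mul1r.
  have : 0 <= N%:R^-1 :> R by rewrite invr_ge0. lra.
have cover : [set: S] `<=` \bigcup_a F a.
  move=> x _.
  have [i xi] : exists i, 1 <= n.+1%:R * `|sphere_point x 0 i|.
    apply: contrapT => /forallNP h.
    have : dot (sphere_point x) (sphere_point x) < 1.
      rewrite /dot; apply: (@lt_le_trans _ _ (\sum_(i < n.+1) n.+1%:R^-1)).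
        apply: ltr_sum => [|i _]; first by apply/hasP; exists ord0; rewrite ?mem_index_enum.
        have /negP := h i; rewrite -ltNge => hi.
        rewrite -expr2 -real_normK ?num_real// expr2.
        rewrite -[ltRHS]mul1r ltr_pdivlMr// mulrC mulrA.
        apply: (@le_lt_trans _ _ (n.+1%:R * `|sphere_point x 0 i|)) => //.
        by rewrite ler_piMr// mulr_ge0.
      by rewrite sumr_const card_ord -[_ *+ n.+1]mulr_natr mulVf// pnatr_eq0.
    by rewrite dot_sphere ltxx.
  have lab j : (label x i j < N.*2.+1)%N.
    rewrite /label -(ltr_nat R).
    have pos : 0 <= (sphere_point x 0 (lift i j) + 1) * N%:R.
      rewrite mulr_ge0//; have := coord1 x (lift i j).
      by rewrite ler_norml => /andP[]; lra.
    apply: (@le_lt_trans _ _ ((sphere_point x 0 (lift i j) + 1) * N%:R)).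
      by rewrite truncn_le.
    apply: (@le_lt_trans _ _ (2 * N%:R)).
      by rewrite ler_wpM2r//; have := coord1 x (lift i j); rewrite ler_norml => /andP[]; lra.
    by rewrite -natrM ltr_nat mul2n.
  exists (i, 0 <= sphere_point x 0 i, [ffun j => Ordinal (lab j)]) => //.
  by split => //= j; rewrite ffunE.
have CN0 : 0 <= C / N%:R <= e by rewrite CN divr_ge0// ltW.
apply: le_trans (hausdorff_size_finite_cover n chord_ge0 CN0 Fd cover) _.
rewrite lee_fin /K !card_prod card_bool card_ffun !card_ord !natrM natrX.
have -> : n.+1%:R * 2 * N.*2.+1%:R ^+ n * (ball_volume n * (C / N%:R / 2) ^+ n) =
    2 * n.+1%:R * (ball_volume n * (N.*2.+1%:R * (C / N%:R / 2)) ^+ n) :> R.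
  by rewrite [X in _ = _ * (_ * X)]exprMn; ring.
rewrite ler_wpM2l ?mulr_ge0// ler_wpM2l ?ball_volume_ge0//.
have N3 : N.*2.+1%:R <= 3 * N%:R :> R by rewrite -natrM ler_nat; lia.
have -> : 3 * C / 2 = 3 * N%:R * (C / N%:R / 2) by field; rewrite gt_eqF.
have CN2 : 0 <= C / N%:R / 2 by rewrite !divr_ge0// ltW.
case: (n) => [|k]; first by rewrite !expr0.
by apply: lerXn2r; rewrite ?nnegrE; [apply: mulr_ge0|apply: mulr_ge0 => //; apply: mulr_ge0|exact: ler_wpM2r].
Qed.

End sphere_area.

(** * Wallis integrals *)

Section sine_integrals.
Context {R : realType}.
Notation mu := lebesgue_measure.

Lemma FTC2_derive (F f : R -> R) (a b : R) : a < b ->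
  (forall x : R, is_derive x 1 F (f x)) -> continuous f ->
  (\int[mu]_(t in `[a, b]) (f t)%:E = (F b - F a)%:E)%E.
Proof.
move=> ab dF cf.
have cF : continuous F.
  move=> x; apply: differentiable_continuous; apply/derivable1_diffP.
  by have [] := dF x.
rewrite (continuous_FTC2 ab (F := F)) ?EFinB//.
- exact: continuous_subspaceT.
- split; first by move=> x _; have [] := dF x.
    by apply: cvg_at_right_filter; exact: cF.
  by apply: cvg_at_left_filter; exact: cF.
- by move=> x _; rewrite derive1E; have [_ ->] := dF x.
Qed.

Lemma continuous_integrable (f : R -> R) (a b : R) : continuous f ->
  mu.-integrable `[a, b] (EFin \o f).
Proof.
move=> cf; apply: continuous_compact_integrable; first exact: segment_compact.
exact: continuous_subspaceT.
Qed.

Lemma continuous_sinX k : continuous (fun t : R => sin t ^+ k).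
Proof.
move=> x; apply: (@continuous_comp _ _ _ (@sin R) (fun y => y ^+ k)).
  exact: continuous_sin.
exact: exprn_continuous.
Qed.

(** The Wallis integral I_k, classically the ratio |S^(k+1)| / |S^k|. *)
Definition sin_integral k : R := \int[mu]_(t in `[0, pi]) (sin t ^+ k).

Lemma sin_integralE k : (\int[mu]_(t in `[0%R, pi]) (sin t ^+ k)%:E = (sin_integral k)%:E)%E.
Proof.
rewrite /sin_integral /Rintegral fineK//.
by apply: integrable_fin_num => //; apply: continuous_integrable; exact: continuous_sinX.
Qed.

Lemma sin_integral0 : sin_integral 0 = pi.
Proof.
have := @FTC2_derive id (fun=> 1) 0 pi (@pi_gt0 R) _ (@cst_continuous _ _ _).
rewrite subr0 => h; apply: EFin_inj; rewrite -sin_integralE -h.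
  by apply: eq_integral => t _; rewrite expr0.
Qed.

Lemma sin_integral1 : sin_integral 1 = 2.
Proof.
have := @FTC2_derive (fun t => - cos t) (@sin R) 0 pi (@pi_gt0 R) _ (@continuous_sin R).
rewrite cospi cos0 opprK => h; apply: EFin_inj; rewrite -sin_integralE.
transitivity (\int[mu]_(t in `[0%R, pi]) (@sin R t)%:E)%E.
  by apply: eq_integral => t _; rewrite expr1.
by apply: h => x; apply: is_derive_eq; rewrite ?opprK.
Qed.

(** The function - cos t sin^(k+1) t vanishes at both ends, so its derivative has integral 0. *)
Lemma sin_integral_recurrence k :
  k.+2%:R * sin_integral k.+2 = k.+1%:R * sin_integral k.
Proof.
pose f (t : R) := k.+2%:R * sin t ^+ k.+2 - k.+1%:R * sin t ^+ k.
have df (x : R) : is_derive x 1 (fun t => - (cos t * sin t ^+ k.+1)) (f x).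
  have dX : is_derive x 1 (fun t => sin t ^+ k.+1) (k.+1%:R * sin x ^+ k * cos x).
    have -> : (fun t : R => sin t ^+ k.+1) = (@sin R) ^+ k.+1.
      by apply/funext => t; rewrite exprfctE.
    exact: is_deriveX.
  apply: is_derive_eq; rewrite /GRing.scale/= /f.
  have c2 : cos x * cos x = 1 - sin x ^+ 2 by rewrite -expr2 cos2sin2.
  transitivity (sin x ^+ k.+2 - k.+1%:R * sin x ^+ k * (cos x * cos x)).
    by rewrite !exprS; ring.
  by rewrite c2 !exprS -[k.+2%:R]natr1; ring.
have i2 := @continuous_integrable _ 0 pi (@continuous_sinX k.+2).
have i0 := @continuous_integrable _ 0 pi (@continuous_sinX k).
have iZ j c : mu.-integrable `[0, pi] (EFin \o (fun t : R => c * sin t ^+ j)).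
  by apply: continuous_integrable => x; apply: cvgM; [exact: cvg_cst|exact: continuous_sinX].
have cf : continuous f.
  move=> x; apply: cvgB; apply: cvgM; try exact: cvg_cst; exact: continuous_sinX.
have := FTC2_derive (@pi_gt0 R) df cf.
rewrite sin0 sinpi !expr0n !mulr0 subrr => fI.
apply/eqP; rewrite -subr_eq0 -!RintegralZl// -RintegralB//; apply/eqP.
by rewrite /Rintegral fI.
Qed.

Lemma sin_integral_gt0 k : 0 < sin_integral k.
Proof.
suff : 0 < sin_integral k /\ 0 < sin_integral k.+1 by case.
elim: k => [|k [IH1 IH2]]; first by rewrite sin_integral0 sin_integral1 pi_gt0.
split => //; have := sin_integral_recurrence k.
by rewrite -(pmulr_rgt0 (sin_integral k.+2) (ltr0Sn R k.+1)) => ->; rewrite mulr_gt0.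
Qed.

(** By the recurrence (k + 1) I_k I_(k+1) does not depend on k. This converts the area bound of the
    covering argument, which contains I_k, into a bound for the area times I_(k+1). *)
Lemma sin_integral_mulS k : sin_integral k * sin_integral k.+1 = 2 * pi / k.+1%:R.
Proof.
elim: k => [|k IH]; first by rewrite sin_integral0 sin_integral1 divr1 mulrC.
have k2 : k.+2%:R != 0 :> R by rewrite pnatr_eq0.
apply: (mulfI k2); rewrite mulrCA sin_integral_recurrence mulrCA [_ * sin_integral k]mulrC IH.
by rewrite [LHS]mulrC [RHS]mulrC !divfK ?pnatr_eq0.
Qed.

(** By concavity sin t >= t sin rho / rho on [0, rho]; integrating the k-th power of the right-hand
    side gives the factor 1 / (k + 1). *)
Lemma sin_integral_partial_ge k (rho : R) : 0 <= rho -> rho <= pi ->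
  (((rho * sin rho ^+ k) / k.+1%:R)%:E <= \int[mu]_(t in `[0%R, rho]) (sin t ^+ k)%:E)%E.
Proof.
move=> rho0 rhopi; move: rho0; rewrite le_eqVlt => /predU1P[<-|rho0].
  rewrite !mul0r; apply: integral_ge0 => t /=; rewrite in_itv/= => /andP[t0 t1].
  rewrite lee_fin exprn_ge0// sin_ge0_pi// t0/=; apply: le_trans t1 _.
  exact: pi_ge0.
have sr : 0 <= sin rho by apply: sin_ge0_pi; rewrite ltW.
pose c : R := (sin rho / rho) ^+ k.
have df (x : R) : is_derive x 1 (fun t => c / k.+1%:R * t ^+ k.+1) (c * x ^+ k).
  have dX : is_derive x 1 (fun t : R => t ^+ k.+1) (k.+1%:R * x ^+ k).
    have -> : (fun t : R => t ^+ k.+1) = (@idfun R) ^+ k.+1.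
      by apply/funext => t; rewrite exprfctE.
    by apply: is_derive_eq; rewrite /GRing.scale/= mulr1.
  apply: is_derive_eq; rewrite /GRing.scale/= ?mulr0 ?addr0.
  by rewrite -mulrA mulKf ?pnatr_eq0.
have cf : continuous (fun t : R => c * t ^+ k).
  by move=> x; apply: cvgM; [exact: cvg_cst|exact: exprn_continuous].
have -> : rho * sin rho ^+ k / k.+1%:R = c / k.+1%:R * rho ^+ k.+1 - c / k.+1%:R * 0 ^+ k.+1.
  rewrite expr0n/= mulr0 subr0 /c expr_div_n exprS.
  have P0 : rho ^+ k != 0 by rewrite expf_neq0// gt_eqF.
  have K0 : k.+1%:R != 0 :> R by rewrite pnatr_eq0.
  by move: (rho ^+ k) (k.+1%:R) P0 K0 => P K P0 K0; field; apply/andP.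
rewrite -(FTC2_derive rho0 df cf); apply: ge0_le_integral => //.
- move=> t /=; rewrite in_itv/= => /andP[t0 _].
  by rewrite lee_fin mulr_ge0 ?exprn_ge0// divr_ge0// ltW.
- by apply/measurable_EFinP; apply: measurable_funTS; exact: continuous_measurable_fun.
- by apply/measurable_EFinP; apply: measurable_funTS; apply: continuous_measurable_fun; exact: continuous_sinX.
- move=> t /=; rewrite in_itv/= => /andP[t0 t1]; rewrite lee_fin /c -exprMn.
  case: (k) => [|j]; first by rewrite !expr0.
  apply: lerXn2r; rewrite ?nnegrE.
  + by rewrite mulr_ge0// divr_ge0// ltW.
  + by apply: sin_ge0_pi; rewrite t0 (le_trans t1).
  + rewrite mulrAC ler_pdivrMr// mulrC [leRHS]mulrC.
    exact: sin_div_noninc.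
Qed.

End sine_integrals.

(** * Conformal dilations of the sphere *)

Section moebius.
Context {R : realType} {n : nat}.
Local Notation S := (sphere R n.+1).
Implicit Types (x y : S) (s t z : R).

Definition height x : R := dot (sphere_point x) pole.

Lemma dot_pole : dot (@pole R n) pole = 1.
Proof. by rewrite -enorm_sq enorm_pole expr1n. Qed.

Lemma height_itv x : -1 <= height x <= 1.
Proof. exact: (dot_sphere_itv x (to_sphere dot_pole)). Qed.

(* The conformal dilation of the sphere fixing the two poles; it acts on the
   heights by the velocity addition h |-> (h + s) / (1 + s h). *)
Definition moebius_vec s x : 'rV[R]_n.+1 :=
  (1 + s * height x)^-1 *: (Num.sqrt (1 - s ^+ 2) *: sphere_point x +
    (height x + s - Num.sqrt (1 - s ^+ 2) * height x) *: pole).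

Lemma moebius_den_gt0 s h : -1 < s < 1 -> -1 <= h <= 1 -> 0 < 1 + s * h.
Proof.
move=> /andP[s0 s1] /andP[h0 h1]; have [s_ge0|s_lt0] := leP 0 s.
  have : 0 <= s * (h + 1) by rewrite mulr_ge0//; lra.
  lra.
have : 0 <= - s * (1 - h) by rewrite mulr_ge0//; lra.
lra.
Qed.

Lemma sqr_lt1 s : -1 < s < 1 -> 0 < 1 - s ^+ 2.
Proof.
move=> /andP[s0 s1]; have : 0 < (1 - s) * (1 + s) by rewrite mulr_gt0; lra.
by rewrite expr2; lra.
Qed.

(** In terms of chords: the squared chord is multiplied by (1 - s^2) / ((1 + s h(x)) (1 + s h(y))).
    So the map is conformal, with factor sqrt (1 - s^2) / (1 + s h) depending only on the height
    h. *)
Lemma moebius_dot s x y : -1 < s < 1 ->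
  dot (moebius_vec s x) (moebius_vec s y) =
  1 - (1 - s ^+ 2) * (1 - dot (sphere_point x) (sphere_point y)) /
      ((1 + s * height x) * (1 + s * height y)).
Proof.
move=> s1; have dx := moebius_den_gt0 s1 (height_itv x).
have dy := moebius_den_gt0 s1 (height_itv y).
have c2 : Num.sqrt (1 - s ^+ 2) ^+ 2 = 1 - s ^+ 2.
  by rewrite sqr_sqrtr// ltW// sqr_lt1.
rewrite /moebius_vec; move: c2; set c := Num.sqrt _ => c2.
rewrite !(dotZl, dotZr, dotDl, dotDr) (dotC pole (sphere_point y)) dot_pole.
rewrite -/(height x) -/(height y).
move: (height x) (height y) (dot _ _) dx dy => hx hy d dx dy.
apply: (@mulfI _ ((1 + s * hx) * (1 + s * hy))); first by rewrite mulf_neq0// gt_eqF.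
rewrite [RHS]mulrBr mulr1.
transitivity (c ^+ 2 * d - c ^+ 2 * hx * hy + (hx + s) * (hy + s)).
  by field; rewrite !gt_eqF.
rewrite [in RHS]mulrCA mulfV ?mulr1; last by rewrite mulf_neq0// gt_eqF.
by rewrite c2; ring.
Qed.

Lemma moebius_unit s x : -1 < s < 1 -> dot (moebius_vec s x) (moebius_vec s x) = 1.
Proof. by move=> s1; rewrite moebius_dot// dot_sphere subrr mulr0 mul0r subr0. Qed.

Definition moebius s (s1 : -1 < s < 1) x : S := to_sphere (moebius_unit x s1).

Lemma moebius_height s (s1 : -1 < s < 1) x :
  height (moebius s1 x) = (height x + s) / (1 + s * height x).
Proof.
rewrite {1}/height to_sphereE /moebius_vec dotZl dotDl !dotZl dot_pole -/(height x).
by rewrite mulr1 [X in _ * X]addrC subrK mulrC.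
Qed.

Lemma moebiusK s (s1 : -1 < s < 1) (s1' : -1 < - s < 1) x :
  moebius s1 (moebius s1' x) = x.
Proof.
apply: sphere_point_inj; rewrite [LHS]to_sphereE /moebius_vec moebius_height to_sphereE.
rewrite /moebius_vec sqrrN.
have c2 : Num.sqrt (1 - s ^+ 2) ^+ 2 = 1 - s ^+ 2.
  by rewrite sqr_sqrtr// ltW// sqr_lt1.
have d0 := sqr_lt1 s1; have dx := moebius_den_gt0 s1' (height_itv x).
move: c2; set c := Num.sqrt _ => c2.
apply/rowP => i; rewrite !mxE; move: (height x) (sphere_point x 0 i) (_ && _)%:R dx => h a e dx.
have E : 1 + s * ((h + - s) / (1 + - s * h)) = (1 - s ^+ 2) / (1 + - s * h).
  by field; rewrite gt_eqF.
rewrite E invf_div.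
apply: (@mulfI _ (1 - s ^+ 2)); first by rewrite gt_eqF.
transitivity (c ^+ 2 * a + e * h * (1 - s ^+ 2 - c ^+ 2)).
  by field; rewrite !gt_eqF.
by rewrite c2 subrr mulr0 addr0.
Qed.

Lemma moebius_chord s (s1 : -1 < s < 1) x y (c : R) :
  0 < c -> c <= 1 + s * height x -> c <= 1 + s * height y ->
  chord (moebius s1 x) (moebius s1 y) <= Num.sqrt (1 - s ^+ 2) / c * chord x y.
Proof.
move=> c0 cx cy.
rewrite -ler_sqr ?nnegrE ?mulr_ge0 ?enorm_ge0 ?divr_ge0 ?sqrtr_ge0 ?(ltW c0)//.
rewrite [leRHS]exprMn !chord_sqr moebius_dot//.
have /andP[_ d1] := dot_sphere_itv x y.
move: (dot _ _) d1 => d d1.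
have dx := lt_le_trans c0 cx; have dy := lt_le_trans c0 cy.
rewrite subKr [leRHS]mulrCA ler_pM2l// expr_div_n sqr_sqrtr ?(ltW (sqr_lt1 s1))//.
have -> : (1 - s ^+ 2) / c ^+ 2 * (1 - d) = (1 - s ^+ 2) * (1 - d) / c ^+ 2 by rewrite mulrAC.
rewrite ler_wpM2l//; first by apply: mulr_ge0; [exact: ltW (sqr_lt1 s1)|rewrite subr_ge0].
by rewrite lef_pV2 ?posrE ?mulr_gt0 ?exprn_gt0// expr2; apply: ler_pM => //; exact: ltW.
by rewrite invr_ge0 ltW.
Qed.

End moebius.

(** * The measure of caps *)

Section bands.
Context {R : realType} {n : nat}.
Local Notation S := (sphere R n.+1).
Local Notation H := (hausdorff (@chord R n.+1) n).
Implicit Types (x y : S) (s t z tau : R).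

(** The heights run from z to the velocity sum (z + tau) / (1 + tau z), here with the denominator
    cleared. In the coordinate artanh h all bands have the same width, so dilations carry bands to
    bands. *)
Definition band tau z : set S :=
  [set x | z <= height x /\ height x * (1 + tau * z) <= z + tau].

(** The dilation of parameter s = (z' - z) / (1 - z z') moves the height z to z' and the band at z
    onto the band at z'. Its factor at height z is sqrt ((1 - z'^2) / (1 - z^2)) <= c, and within
    the band this grows at most by the factor 1 / (1 - 2 tau). *)
Lemma hausdorff_band_le tau z z' c : 0 < tau -> tau < 2^-1 ->
  -1 < z < 1 -> -1 < z' < 1 -> 0 < c ->
  (1 - z' ^+ 2) <= c ^+ 2 * (1 - z ^+ 2) ->
  (H (band tau z') <= ((c / (1 - 2 * tau)) ^+ n)%:E * H (band tau z))%E.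
Proof.
move=> tau0 tau1 /andP[z0 z1] /andP[z0' z1'] c0 cz.
have d0 : 0 < 1 - z * z' by nra.
pose s := (z' - z) / (1 - z * z').
have s1 : -1 < s < 1.
  rewrite /s ltr_pdivlMr// ltr_pdivrMr// mulN1r mul1r.
  by apply/andP; split; nra.
have s1' : -1 < - s < 1 by case/andP: s1 => *; apply/andP; split; lra.
have sz : 0 < 1 + s * z by apply: moebius_den_gt0 => //; apply/andP; split; lra.
have zE : z' * (1 + s * z) = z + s by rewrite /s; field; rewrite gt_eqF.
have sE : 1 - s ^+ 2 = (1 - z ^+ 2) * (1 - z' ^+ 2) / (1 - z * z') ^+ 2.
  by rewrite /s; field; rewrite gt_eqF.
have szE : 1 + s * z = (1 - z ^+ 2) / (1 - z * z') by rewrite /s; field; rewrite gt_eqF.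
clearbody s.
have tau2 : 0 < 1 - 2 * tau by lra.
pose C := (1 - 2 * tau) * (1 + s * z).
have C0 : 0 < C by rewrite mulr_gt0.
have inband x : band tau z x -> C <= 1 + s * height x.
  move=> [zx xz]; have /andP[h0 h1] := height_itv x.
  have [s_ge0|s_lt0] := leP 0 s.
    apply: (@le_trans _ _ (1 + s * z)); last by rewrite lerD2l ler_wpM2l.
    by rewrite /C ler_piMl ?(ltW sz)//; lra.
  have tz : 0 < 1 + tau * z by apply: moebius_den_gt0; apply/andP; split; lra.
  have h2 : (height x - z) * (1 + tau * z) <= tau * ((1 - z) * (1 + z)) by lra.
  have h3 : (1 - z) * (- s) <= 1 + s * z by lra.
  have h4 : (1 + z) <= 2 * (1 + tau * z) by nra.
  have h5 : - s * (height x - z) <= 2 * tau * (1 + s * z).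
    rewrite -(ler_pM2r tz).
    have : - s * ((height x - z) * (1 + tau * z)) <= - s * (tau * ((1 - z) * (1 + z))).
      by rewrite ler_wpM2l//; lra.
    have : (1 - z) * (- s) * ((1 + z) * tau) <= (1 + s * z) * (2 * (1 + tau * z) * tau).
      apply: ler_pM => //; first by rewrite mulr_ge0; lra.
        by rewrite mulr_ge0; lra.
      by rewrite ler_wpM2r// ltW.
    lra.
  by rewrite /C; lra.
have sub : band tau z' `<=` moebius s1 @` band tau z.
  move=> x [zx xz]; exists (moebius s1' x); last exact: moebiusK.
  have hx := moebius_den_gt0 s1' (height_itv x).
  rewrite /band /= moebius_height; split.
    rewrite ler_pdivlMr//.
    have : z' * (1 + s * z) <= height x * (1 + s * z) by rewrite ler_wpM2r// ltW.
    by rewrite zE; lra.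
  rewrite mulrAC ler_pdivrMr//.
  have : height x * (1 + tau * z') * (1 + s * z) <= (z' + tau) * (1 + s * z).
    by rewrite ler_wpM2r// ltW.
  have -> : height x * (1 + tau * z') * (1 + s * z) =
            height x * (1 + s * z) + height x * tau * (z' * (1 + s * z)) by ring.
  have -> : (z' + tau) * (1 + s * z) = z' * (1 + s * z) + tau * (1 + s * z) by ring.
  by rewrite zE; lra.
apply: (le_trans (@le_hausdorff R S chord n _ _ sub)).
apply: hausdorff_image; [exact: chord_ge0|exact: chord_ge0|by rewrite divr_gt0|].
move=> x y Bx By; apply: (le_trans (moebius_chord s1 C0 (inband x Bx) (inband y By))).
rewrite ler_wpM2r ?enorm_ge0// /C invfM mulrA [leRHS]mulrC mulrAC.
rewrite [leLHS]mulrC ler_wpM2l ?invr_ge0 ?(ltW tau2)// ler_pdivrMr//.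
rewrite -ler_sqr ?nnegrE ?sqrtr_ge0 ?mulr_ge0 ?(ltW c0) ?(ltW sz)//.
rewrite sqr_sqrtr ?(ltW (sqr_lt1 s1))// exprMn.
rewrite sE szE expr_div_n mulrA ler_wpM2r ?invr_ge0 ?sqr_ge0//.
have -> : c ^+ 2 * (1 - z ^+ 2) ^+ 2 = (1 - z ^+ 2) * (c ^+ 2 * (1 - z ^+ 2)) by ring.
by rewrite ler_wpM2l// ltW// sqr_lt1//; apply/andP.
Qed.

End bands.

Section sphere_measure.
Context {R : realType} {n : nat}.
Local Notation S := (sphere R n.+1).
Local Notation H := (hausdorff (@chord R n.+1) n).
Local Notation sigma := (sphere_prob R n).
Implicit Types (x y : S).

Lemma sphere_point_continuous : continuous (@sphere_point R n.+1).
Proof. exact: initial_continuous. Qed.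

Lemma dot_continuous (m : nat) (v : 'rV[R]_m) : continuous (fun u => dot u v).
Proof.
apply: continuous_big => [|i _]; first exact: add_continuous.
move=> x; apply: cvgMr_tmp; first exact: (@nbhs_filter _ x).
exact: coord_continuous.
Qed.

Lemma sphere_dot_continuous (v : 'rV[R]_n.+1) : continuous (fun x => dot (sphere_point x) v).
Proof.
move=> x; apply: (@continuous_comp _ _ _ (@sphere_point R n.+1) (fun u => dot u v)).
  exact: sphere_point_continuous.
exact: dot_continuous.
Qed.

Lemma sphere_continuous_measurable (f : S -> R) : continuous f -> measurable_fun setT f.
Proof.
move=> /continuousP cf.
apply: (measurability _ (measurable_realfun.RGenOpens.measurableE R)) => _ [_ [a [b ->] <-]].
rewrite setTI; apply: sub_sigma_algebra; apply: cf.
exact: interval_open.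
Qed.

Lemma sphere_probE (A : set S) : sigma A = (H A * (fine (H setT))^-1%:E)%E.
Proof.
rewrite /= /mnormalize ifF//; apply/negbTE; rewrite negb_or.
by rewrite gt_eqF ?hausdorff_sphere_gt0//= lt_eqF// hausdorff_sphere_lty.
Qed.

Lemma hausdorff_sphere_fin : H [set: S] \is a fin_num.
Proof. by rewrite ge0_fin_numE ?hausdorff_sphere_lty// ltW// hausdorff_sphere_gt0. Qed.

Lemma sphere_area_gt0 : 0 < sphere_area R n.+1.
Proof. by rewrite fine_gt0// hausdorff_sphere_gt0 hausdorff_sphere_lty. Qed.

Lemma sphere_prob_le (A B : set S) (c : R) : 0 <= c ->
  (H A <= c%:E * H B)%E -> (sigma A <= c%:E * sigma B)%E.
Proof.
move=> c0 AB; rewrite !sphere_probE muleA lee_wpmul2r// lee_fin invr_ge0 ltW//.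
exact: sphere_area_gt0.
Qed.

Lemma open_measurable_sphere (A : set S) : open A -> measurable A.
Proof. by move=> oA; apply: sub_sigma_algebra. Qed.

Lemma measurable_le_sphere (f g : S -> R) : continuous f -> continuous g ->
  measurable [set x | f x <= g x].
Proof.
move=> cf cg; rewrite -[X in measurable X]setTI.
by apply: measurable_fun_le => //; exact: sphere_continuous_measurable.
Qed.

Lemma hausdorff_set1 x : (0 < n)%N -> H [set x] = 0%E.
Proof.
move=> n0; apply/eqP; rewrite eq_le hausdorff_ge0 ?andbT//; last exact: chord_ge0.
apply: ge_ereal_sup => _ [e /= e0 <-].
have dx : (diameter (@chord R n.+1) [set x] <= 0%:E)%E.
  apply: diameter_le => _ _ -> ->; rewrite /chord subrr /enorm dot0l sqrtr0//.
apply: le_trans (hausdorff_size_weight n chord_ge0 _) _.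
  by apply: le_trans dx _; rewrite lee_fin ltW.
apply: le_trans (hausdorff_weight_le n chord_ge0 (lexx 0) dx) _.
by rewrite mul0r expr0n gtn_eqF// mulr0.
Qed.

Lemma dot_sphere_eq1 x y : dot (sphere_point x) (sphere_point y) = 1 -> x = y.
Proof.
move=> xy; apply: sphere_point_inj; apply/eqP; rewrite -subr_eq0; apply/eqP.
apply: enorm_eq0; apply/eqP; rewrite -sqrf_eq0; apply/eqP.
by rewrite [LHS]chord_sqr xy subrr mulr0.
Qed.

(** The poles are fixed by the dilations, and the integral of the weight over the bands through a
    point is computed away from them. Being points, they are null once n > 0. *)
Lemma height_poles : (0 < n)%N -> sigma [set x : S | -1 < height x < 1] = 1%E.
Proof.
move=> n0; pose P : S := to_sphere (@dot_pole R n).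
have N1 : dot (- @pole R n) (- pole) = 1 by rewrite dotNl dotNr opprK dot_pole.
pose N : S := to_sphere N1.
have sub : [set: S] `<=` [set x | -1 < height x < 1] `|` ([set P] `|` [set N]).
  move=> x _; have /andP[h0 h1] := height_itv x.
  have [hx|hx] := eqVneq (height x) 1; first by right; left; apply: dot_sphere_eq1.
  have [hx'|hx'] := eqVneq (height x) (-1).
    by right; right; apply: dot_sphere_eq1; rewrite /N to_sphereE dotNr -/(height x) hx' opprK.
  by left; rewrite /= !lt_neqAle h0 h1 !andbT hx eq_sym hx'.
have s0 y : sigma [set y] = 0%E by rewrite sphere_probE hausdorff_set1// mul0e.
have mset1 y : measurable [set y].
  rewrite (_ : [set y] = [set z | 1 <= dot (sphere_point z) (sphere_point y)]).
    apply: measurable_le_sphere; first exact: cst_continuous.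
    exact: sphere_dot_continuous.
  apply/seteqP; split => [_ -> /=|z /= zy]; first by rewrite dot_sphere.
  have /andP[_ d1] := dot_sphere_itv z y.
  by apply: dot_sphere_eq1; apply/eqP; rewrite eq_le d1.
have ch : continuous (@height R n) by exact: sphere_dot_continuous.
have mh : measurable [set x : S | -1 < height x < 1].
  have -> : [set x : S | -1 < height x < 1] =
      ~` [set x : S | 1 <= height x] `&` ~` [set x : S | height x <= -1].
    apply/seteqP; split => x /=.
      by move=> /andP[h1 h2]; split; apply/negP; rewrite -ltNge.
    by move=> [/negP + /negP]; rewrite -!ltNge => -> ->.
  by apply: measurableI; apply: measurableC; apply: measurable_le_sphere => //; exact: cst_continuous.
apply/eqP; rewrite eq_le probability_le1//= -(@probability_setT _ _ _ sigma).
have mU : measurable ([set P] `|` [set N]) by apply: measurableU.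
apply: (@le_trans _ _ (sigma ([set x | -1 < height x < 1] `|` ([set P] `|` [set N])))).
  by apply: le_measure; rewrite ?inE//; exact: measurableU.
apply: le_trans (measureU2 _ _ _) _ => //; rewrite -[leRHS]adde0; apply: leeD => //.
apply: le_trans (measureU2 _ _ _) _ => //; rewrite -[leRHS]adde0; apply: leeD.
  by rewrite -(s0 P).
by rewrite -(s0 N).
Qed.

End sphere_measure.

Section cap.
Context {R : realType} {n : nat}.
Local Notation S := (sphere R n.+2).
Local Notation sigma := (sphere_prob R n.+1).
Local Notation mu := lebesgue_measure.
Implicit Types (x y : S) (t rho tau : R).

(** The inverse hyperbolic tangent of tau. *)
Definition rapidity tau : R := (ln (1 + tau) - ln (1 - tau)) / 2.

Lemma rapidity_gt0 tau : 0 < tau -> tau < 1 -> 0 < rapidity tau.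
Proof.
move=> t0 t1; rewrite divr_gt0// subr_gt0 ltr_ln ?posrE; lra.
Qed.

Lemma cos_lt_pi t : 0 < t < pi -> -1 < cos t < 1.
Proof.
move=> /andP[t0 tpi]; rewrite -cospi -cos0.
by rewrite !ltr_cos ?in_itv/= ?lexx ?pi_ge0 ?(ltW t0) ?(ltW tpi)// t0 tpi.
Qed.

(* The antiderivative of 1 / sin is minus the rapidity of the height. *)
Lemma integral_inv_sin h tau : 0 < tau -> tau < 1 -> -1 < h < 1 ->
  (\int[mu]_(t in `[acos h, acos ((h - tau) / (1 - tau * h))]) ((sin t)^-1)%:E
   = (rapidity tau)%:E)%E.
Proof.
move=> t0 t1 /andP[h0 h1].
have d0 : 0 < 1 - tau * h by nra.
set h' := (h - tau) / (1 - tau * h).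
have p1 : 0 < (1 + h) * (1 - tau) by rewrite mulr_gt0//; lra.
have p2 : 0 < tau * ((1 - h) * (1 + h)) by rewrite !mulr_gt0//; lra.
have h'0 : -1 < h' by rewrite /h' ltr_pdivlMr//; lra.
have hh' : h' < h by rewrite /h' ltr_pdivrMr//; lra.
have h'1 : h' < 1 by exact: lt_trans hh' h1.
have in1 (z : R) : -1 < z -> z < 1 -> z \in `[-1, 1] by move=> ? ?; rewrite in_itv/= !ltW.
have acos_in (z : R) : -1 < z -> z < 1 -> 0 < acos z < pi.
  by move=> z0 z1; rewrite acos_gt0 ?acos_ltpi ?z0 ?z1 ?ltW.
have ab : acos h < acos h'.
  have /andP[a0 a1] := acos_in _ h0 h1; have /andP[b0 b1] := acos_in _ h'0 h'1.
  rewrite -ltr_cos ?in_itv/= ?(ltW a0) ?(ltW a1) ?(ltW b0) ?(ltW b1)//.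
  by rewrite !acosK ?in1.
pose L (t : R) : R := (ln (1 - cos t) - ln (1 + cos t)) / 2.
have dom (t : R) : t \in `[acos h, acos h'] -> 0 < t < pi.
  rewrite in_itv/= => /andP[t0' t1']; have /andP[a0 a1] := acos_in _ h0 h1.
  have /andP[b0 b1] := acos_in _ h'0 h'1.
  by rewrite (lt_le_trans a0)// (le_lt_trans t1').
have dL (t : R) : 0 < t < pi -> is_derive t 1 L (sin t)^-1.
  move=> tpi; have /andP[c0 c1] := cos_lt_pi tpi.
  have st : 0 < sin t by exact: sin_gt0_pi.
  have d1 : is_derive t 1 (fun t => ln (1 - cos t)) ((1 - cos t)^-1 * sin t).
    apply: (@is_derive1_comp R (@ln R) (fun t => 1 - cos t)).
      by apply: is_derive1_ln; lra.
    by apply: is_derive_eq; rewrite ?scaler1 /GRing.scale/=; ring.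
  have d2 : is_derive t 1 (fun t => ln (1 + cos t)) ((1 + cos t)^-1 * - sin t).
    apply: (@is_derive1_comp R (@ln R) (fun t => 1 + cos t)).
      by apply: is_derive1_ln; lra.
    by apply: is_derive_eq; rewrite ?scaler1 /GRing.scale/=; ring.
  have -> : L = 2^-1 *: ((fun t => ln (1 - cos t)) - (fun t => ln (1 + cos t))).
    by apply/funext => u; rewrite /L /GRing.scale/= mulrC.
  apply: is_derive_eq; rewrite /GRing.scale/=.
  have s2 : sin t * sin t = (1 - cos t) * (1 + cos t) by rewrite -expr2 sin2cos2; ring.
  apply: (@mulfI _ (sin t)); first by rewrite gt_eqF.
  rewrite mulfV ?gt_eqF//.
  transitivity (2^-1 * (sin t * sin t) * ((1 - cos t)^-1 + (1 + cos t)^-1)); first by ring.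
  by rewrite s2; field; apply/andP; split; rewrite gt_eqF//; lra.
have cL (t : R) : 0 < t < pi -> {for t, continuous L}.
  move=> tpi; apply: differentiable_continuous; apply/derivable1_diffP.
  by have [] := dL _ tpi.
rewrite (@continuous_FTC2 _ _ L _ _ ab).
- have lnE (z : R) : -1 < z -> z < 1 -> L (acos z) = (ln (1 - z) - ln (1 + z)) / 2.
    by move=> z0 z1; rewrite /L acosK// in1.
  rewrite -EFinB !lnE//; congr EFin; rewrite /rapidity.
  have e1 : 1 - h' = (1 + tau) * (1 - h) / (1 - tau * h) by rewrite /h'; field; lra.
  have e2 : 1 + h' = (1 - tau) * (1 + h) / (1 - tau * h) by rewrite /h'; field; lra.
  rewrite e1 e2 !ln_div ?lnM ?posrE ?mulr_gt0//; lra.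
- apply/continuous_within_itvP => //; split.
  + move=> t tab; apply: cvgV; last exact: continuous_sin.
    by rewrite gt_eqF// sin_gt0_pi// dom// subset_itv_oo_cc.
  + apply: cvgV; last by apply: cvg_at_right_filter; exact: continuous_sin.
    by rewrite gt_eqF// sin_gt0_pi// acos_in.
  + apply: cvgV; last by apply: cvg_at_left_filter; exact: continuous_sin.
    by rewrite gt_eqF// sin_gt0_pi// acos_in.
- split.
  + by move=> t tab; have [] := dL _ (dom _ (subset_itv_oo_cc tab)).
  + by apply: cvg_at_right_filter; apply: cL; exact: acos_in.
  + by apply: cvg_at_left_filter; apply: cL; exact: acos_in.
- by move=> t tab; rewrite derive1E; have [_ ->] := dL _ (dom _ (subset_itv_oo_cc tab)).
Qed.

Definition band_strip tau rho : set (measurableTypeR R * S) :=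
  [set z | (0 < z.1 < rho) /\ band tau (cos z.1) z.2].

(** The variable t is the angle of the lower edge cos t of a band. With the weight 1 / sin t, the
    bands through a point have total weight [rapidity tau], the same for all points except the
    poles; this is what makes Fubini effective. On (0, pi) the power of exponent -1 is the
    inverse. *)
Definition band_weight tau rho (z : measurableTypeR R * S) : \bar R :=
  (sin z.1 `^ (-1) * \1_(band_strip tau rho) z)%:E.

Lemma height_continuous : continuous (@height R n.+1).
Proof. exact: sphere_dot_continuous. Qed.

Lemma measurable_band_strip tau rho : measurable (band_strip tau rho).
Proof.
have mh : measurable_fun setT (fun z : measurableTypeR R * S => height z.2).
  apply: measurableT_comp; last exact: measurable_snd.
  by apply: sphere_continuous_measurable; exact: height_continuous.
have mc : measurable_fun setT (fun z : measurableTypeR R * S => cos z.1).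
  apply: (@measurableT_comp _ _ _ _ _ _ (@cos R)); last exact: measurable_fst.
  by apply: continuous_measurable_fun; exact: continuous_cos.
have -> : band_strip tau rho =
    ((fun z => z.1) @^-1` `]0, rho[) `&`
    ([set z | cos z.1 <= height z.2] `&`
     [set z | height z.2 * (1 + tau * cos z.1) <= cos z.1 + tau]).
  by apply/seteqP; split => z /=; rewrite in_itv.
apply: measurableI.
  by rewrite -[X in measurable X]setTI; apply: measurable_fst => //; exact: measurable_itv.
apply: measurableI.
  by rewrite -[X in measurable X]setTI; apply: measurable_fun_le.
rewrite -[X in measurable X]setTI; apply: measurable_fun_le => //.
  apply: measurable_funM => //; apply: measurable_funD => //.
  exact: measurable_funM.
exact: measurable_funD.
Qed.

Lemma measurable_band_weight tau rho : measurable_fun setT (band_weight tau rho).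
Proof.
apply/measurable_EFinP; apply: measurable_funM; last first.
  by apply: measurable_indic; exact: measurable_band_strip.
apply: (@measurableT_comp _ _ _ _ _ _ (fun y : R => y `^ (-1))).
  exact: measurable_powR.
apply: (@measurableT_comp _ _ _ _ _ _ (@sin R)); last exact: measurable_fst.
by apply: continuous_measurable_fun; exact: continuous_sin.
Qed.

Lemma band_weight_ge0 tau rho z : (0 <= band_weight tau rho z)%E.
Proof. by rewrite lee_fin mulr_ge0// powR_ge0. Qed.

Lemma band_weight_in tau rho t x : rho <= pi -> 0 < t < rho -> band tau (cos t) x ->
  band_weight tau rho (t, x) = ((sin t)^-1)%:E.
Proof.
move=> rpi /andP[t0 tr] b; rewrite /band_weight/= indicE mem_set ?mulr1; last first.
  by split => //=; rewrite t0.
by rewrite -powR_inv1// ltW// sin_gt0_pi// t0 (lt_le_trans tr).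
Qed.

Lemma band_weight_out tau rho t x : ~ (0 < t < rho /\ band tau (cos t) x) ->
  band_weight tau rho (t, x) = 0%E.
Proof. by move=> nb; rewrite /band_weight indicE memNset ?mulr0. Qed.

Lemma band_itv tau t x : 0 < tau -> tau < 1 -> 0 < t < pi -> -1 < height x < 1 ->
  band tau (cos t) x <->
  t \in `[acos (height x), acos ((height x - tau) / (1 - tau * height x))].
Proof.
move=> t0 t1 tpi /andP[h0 h1]; have /andP[t_gt0 t_ltpi] := tpi.
have d0 : 0 < 1 - tau * height x by nra.
set h' := (height x - tau) / (1 - tau * height x).
have p1 : 0 < (1 + height x) * (1 - tau) by rewrite mulr_gt0//; lra.
have p2 : 0 < tau * ((1 - height x) * (1 + height x)) by rewrite !mulr_gt0//; lra.
have h'0 : -1 <= h' by rewrite ltW// /h' ltr_pdivlMr//; lra.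
have h'1 : h' <= 1 by rewrite ltW// /h' ltr_pdivrMr//; nra.
have hin : -1 <= height x <= 1 by rewrite !ltW.
have hin' : -1 <= h' <= 1 by rewrite h'0.
have tin : t \in `[0, pi] by rewrite in_itv/= !ltW.
rewrite in_itv/=.
have -> : (acos (height x) <= t) = (cos t <= height x).
  rewrite -[X in _ = (_ <= X)](acosK (x := height x)) ?in_itv//=.
  by rewrite !leNgt ltr_cos// in_itv/= acos_ge0//= acos_lepi.
have -> : (t <= acos h') = (h' <= cos t).
  rewrite -[X in _ = (X <= _)](acosK (x := h')) ?in_itv//=.
  by rewrite !leNgt ltr_cos// in_itv/= acos_ge0//= acos_lepi.
rewrite /h' ler_pdivrMr//; split => [[c b]|/andP[c b]]; [apply/andP; split => //|split => //]; lra.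
Qed.

Lemma integral_band_weight_in tau x : 0 < tau -> tau < 1 -> -1 < height x < 1 ->
  (\int[mu]_t band_weight tau pi (t, x) = (rapidity tau)%:E)%E.
Proof.
move=> t0 t1 hx; rewrite -(integral_inv_sin t0 t1 hx) [RHS]integral_mkcond.
apply: eq_integral => t _; rewrite patchE.
have tr (u : R) : u \in `[acos (height x), acos ((height x - tau) / (1 - tau * height x))] ->
    0 < u < pi.
  have /andP[h0 h1] := hx; have d0 : 0 < 1 - tau * height x by nra.
  have p1 : 0 < (1 + height x) * (1 - tau) by rewrite mulr_gt0//; lra.
  rewrite in_itv/= => /andP[u0 u1]; rewrite (lt_le_trans _ u0)/=; last by rewrite acos_gt0// ltW.
  rewrite (le_lt_trans u1)// acos_ltpi// ltr_pdivlMr// ler_pdivrMr//.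
  have p2 : 0 < tau * (1 - height x) by rewrite mulr_gt0//; lra.
  by apply/andP; split; nra.
case: ifPn => [|/negP tn].
  rewrite inE/= => tin; have tpi := tr _ tin.
  by rewrite band_weight_in//; apply/(band_itv t0 t1 tpi hx).
rewrite band_weight_out// => -[tpi b]; apply: tn; rewrite inE/=.
exact/(band_itv t0 t1 tpi hx).
Qed.

Lemma integral_band_weight_le tau rho x : 0 < tau -> tau < 1 -> 0 < rho -> rho <= pi ->
  (\int[mu]_t band_weight tau rho (t, x) <=
   (rapidity tau)%:E * (\1_[set y | cos rho < height y] x)%:E)%E.
Proof.
move=> t0 t1 r0 rpi.
have cos_gt (t : R) : 0 < t < rho -> cos rho < cos t.
  move=> /andP[tt0 tr]; rewrite ltr_cos// in_itv/= ?(ltW r0)// (ltW tt0)/=.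
  exact: le_trans (ltW tr) rpi.
have [hx|hx] := boolP ((cos rho < height x) && (-1 < height x < 1)); last first.
  rewrite integral0_eq => [|t _].
    by rewrite -EFinM lee_fin mulr_ge0// ltW// rapidity_gt0.
  rewrite band_weight_out// => -[tr [b1 b2]]; move/negP: hx; apply.
  have c1 := cos_gt _ tr; have /andP[_ h1] := height_itv x.
  have /cos_lt_pi /andP[c2 c3] : 0 < t < pi by case/andP: tr => -> /lt_le_trans ->.
  apply/andP; split; [lra|apply/andP; split; first by lra].
  rewrite lt_neqAle h1 andbT; apply/eqP => h1'; rewrite h1' in b2; nra.
case/andP: hx => hx hx1; rewrite indicE mem_set// mule1 -(integral_band_weight_in t0 t1 hx1).
apply: ge0_le_integral => //.
- by move=> t _; exact: band_weight_ge0.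
- by apply: (measurableT_comp (measurable_band_weight tau rho)); exact: pair2_measurable.
- by apply: (measurableT_comp (measurable_band_weight tau pi)); exact: pair2_measurable.
move=> t _; have [[tr b]|nb] := pselect (0 < t < rho /\ band tau (cos t) x); last first.
  by rewrite band_weight_out// band_weight_ge0.
by rewrite !band_weight_in//; case/andP: tr => -> /lt_le_trans ->.
Qed.

Lemma measurable_band tau z : measurable (band tau z : set S).
Proof.
apply: measurableI; first by apply: measurable_le_sphere => //;
  [exact: cst_continuous|exact: height_continuous].
apply: measurable_le_sphere; last exact: cst_continuous.
move=> y; apply: cvgMr_tmp; first exact: (@nbhs_filter _ y).
exact: height_continuous.
Qed.

Lemma integral_band_weightE tau rho t : rho <= pi -> 0 < t < rho ->
  (\int[sigma]_x band_weight tau rho (t, x) = ((sin t)^-1)%:E * sigma (band tau (cos t)))%E.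
Proof.
move=> rpi tr.
rewrite -integral_cst; last exact: measurable_band.
rewrite [RHS]integral_mkcond; apply: eq_integral => x _.
rewrite patchE; case: ifPn => [|/negP nb]; first by rewrite inE => b; rewrite band_weight_in.
by rewrite band_weight_out// => -[_ b]; apply: nb; rewrite inE.
Qed.

End cap.

Section cap_measure.
Context {R : realType} {n : nat}.
Local Notation S := (sphere R n.+2).
Local Notation sigma := (sphere_prob R n.+1).
Local Notation mu := lebesgue_measure.
Implicit Types (x y : S) (t rho tau : R).

Lemma open_cap v (h : R) : open [set y : S | h < dot (sphere_point y) v].
Proof.
have /continuousP := @sphere_dot_continuous R n.+1 v.
by move=> cd; apply: (cd [set z : R | h < z]); exact: (@open_gt R h).
Qed.

Lemma measurable_cap (h : R) : measurable [set y : S | h < height y].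
Proof. by apply: open_measurable_sphere; exact: open_cap. Qed.

Lemma sphere_prob_fin (A : set S) : measurable A -> sigma A \is a fin_num.
Proof. by move=> mA; exact: fin_num_measure. Qed.

Lemma sphere_prob_band_le tau z z' (c : R) : 0 < tau -> tau < 2^-1 ->
  -1 < z < 1 -> -1 < z' < 1 -> 0 < c ->
  (1 - z' ^+ 2) <= c ^+ 2 * (1 - z ^+ 2) ->
  fine (sigma (band tau z')) <= (c / (1 - 2 * tau)) ^+ n.+1 * fine (sigma (band tau z)).
Proof.
move=> t0 t1 hz hz' c0 hc.
rewrite -lee_fin EFinM !fineK ?sphere_prob_fin//; try exact: measurable_band.
apply: sphere_prob_le.
  by rewrite exprn_ge0// divr_ge0// ?ltW//; lra.
exact: hausdorff_band_le.
Qed.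

(** Fubini for [band_weight], over (0, pi) and over (0, rho). The band at angle t has mass g
    sin^(n+1) t up to the factor (1 - 2 tau)^(n+1), g being the mass of the equatorial band. The
    first integral bounds [rapidity tau] above by a multiple of g I_n; the second bounds
    [rapidity tau] times the mass of the cap below by the same multiple of g times a partial
    integral, up to those factors. Both g and the rapidity cancel, and the loss occurs twice, whence
    the square. *)
Lemma cap_lower_bound_approx tau rho : 0 < tau -> tau < 2^-1 -> 0 < rho -> rho <= pi ->
  (1 - 2 * tau) ^+ n.+1 ^+ 2 * (rho * sin rho ^+ n / n.+1%:R) <=
  sin_integral n * fine (sigma [set y : S | cos rho < height y]).
Proof.
move=> t0 t1 r0 rpi; have tau1 : tau < 1 by lra.
set s := fine _; set g := fine (sigma (band tau 0)); set k := 1 - 2 * tau.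
have k0 : 0 < k by rewrite /k; lra.
(* Comparison with the equatorial band in both directions, with the ratios sin t and 1 / sin t. *)
have gE t : 0 < t < pi ->
    (sin t)^-1 * fine (sigma (band tau (cos t))) <= k^-1 ^+ n.+1 * g * sin t ^+ n /\
    k ^+ n.+1 * g * sin t ^+ n <= (sin t)^-1 * fine (sigma (band tau (cos t))).
  move=> tpi; have hc := cos_lt_pi tpi; have st : 0 < sin t by exact: sin_gt0_pi.
  have h0 : -1 < (0 : R) < 1 by apply/andP; split; lra.
  have := @sphere_prob_band_le tau 0 (cos t) (sin t) t0 t1 h0 hc st.
  have := @sphere_prob_band_le tau (cos t) 0 (sin t)^-1 t0 t1 hc h0.
  have e0 : (0 : R) ^+ 2 = 0 by rewrite expr0n.
  rewrite invr_gt0 st e0 subr0 mulr1 -!sin2cos2 -exprMn mulVf ?gt_eqF// expr1n lexx.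
  move=> /(_ isT (lexx _)) + /(_ isT); rewrite -/g !exprMn.
  move: (fine (sigma (band tau (cos t)))) => b h1 h2; split.
    rewrite ler_pdivrMl//; apply: le_trans h2 _; rewrite le_eqVlt; apply/orP; left.
    by rewrite -/k (exprS (sin t)); apply/eqP; ring.
  rewrite ler_pdivlMl//.
  have := ler_wpM2l (ltW (mulr_gt0 (exprn_gt0 n.+1 st) (exprn_gt0 n.+1 k0))) h1.
  have -> : sin t ^+ n.+1 * k ^+ n.+1 * ((sin t)^-1 ^+ n.+1 * (1 - 2 * tau)^-1 ^+ n.+1 * b) = b.
    rewrite -/k !exprVn; move: (exprn_gt0 n.+1 st) (exprn_gt0 n.+1 k0).
    by move: (sin t ^+ n.+1) (k ^+ n.+1) => u v u0 v0; field; rewrite !gt_eqF.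
  by apply: le_trans; rewrite (exprS (sin t)) le_eqVlt; apply/orP; left; apply/eqP; ring.
have g0 : 0 <= g by rewrite fine_ge0.
have s0 : 0 <= s by rewrite fine_ge0.
have eta0 := rapidity_gt0 t0 tau1.
have fub rho' := @fubini_tonelli _ _ _ _ R mu sigma (@band_weight R n tau rho')
  (measurable_band_weight tau rho') (band_weight_ge0 tau rho').
have mbandE rho' t : rho' <= pi -> 0 < t < rho' ->
    (\int[sigma]_x band_weight tau rho' (t, x) =
     ((sin t)^-1 * fine (sigma (band tau (cos t))))%:E)%E.
  move=> r'pi tr'; rewrite integral_band_weightE// EFinM fineK//.
  by rewrite sphere_prob_fin//; exact: measurable_band.
have out rho' (t : R) : ~ (0 < t < rho') ->
    (\int[sigma]_x band_weight tau rho' (t, x) = 0)%E.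
  by move=> tn; apply: integral0_eq => x _; rewrite band_weight_out// => -[].
have mF rho' := @measurable_fun_fubini_tonelli_F _ _ _ _ R sigma (@band_weight R n tau rho')
  (measurable_band_weight tau rho') (band_weight_ge0 tau rho').
have mG rho' := @measurable_fun_fubini_tonelli_G _ _ _ _ R mu (@band_weight R n tau rho')
  (measurable_band_weight tau rho') (band_weight_ge0 tau rho').
have msin (a b : R) : measurable_fun `[a, b] (fun t : R => (sin t ^+ n)%:E).
  apply/measurable_EFinP; apply: measurable_funTS; apply: continuous_measurable_fun.
  exact: continuous_sinX.
have up : rapidity tau <= k^-1 ^+ n.+1 * g * sin_integral n.
  rewrite -lee_fin [leRHS]EFinM -sin_integralE -ge0_integralZl//; last 3 first.
    - exact: msin.
    - by move=> t /=; rewrite in_itv/= => /andP[a b]; rewrite lee_fin exprn_ge0// sin_ge0_pi// a.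
    - by rewrite lee_fin mulr_ge0// exprn_ge0// invr_ge0 ltW.
  apply: (@le_trans _ _ (\int[sigma]_x \int[mu]_t band_weight tau pi (t, x))%E).
    have mH : measurable [set x : S | -1 < height x < 1].
      rewrite (_ : [set x | _] = [set x : S | -1 < height x] `&` ~` [set x : S | 1 <= height x]).
        apply: measurableI; first exact: measurable_cap.
        apply: measurableC; apply: measurable_le_sphere; first exact: cst_continuous.
        exact: height_continuous.
      apply/seteqP; split => x /=; first by move=> /andP[-> ?]; split => //; apply/negP; rewrite -ltNge.
      by move=> [-> /negP]; rewrite -ltNge.
    rewrite -[leLHS]mule1 -(height_poles (ltn0Sn n)) -integral_cst//.
    rewrite integral_mkcond; apply: ge0_le_integral => //.
    - by move=> x _; rewrite patchE; case: ifP => // _; rewrite lee_fin ltW.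
    - exact/(measurable_restrictT _ mH).
    - exact: mG.
    move=> x _; rewrite patchE; case: ifPn => [|_].
      by rewrite inE => hx; rewrite integral_band_weight_in.
    by apply: integral_ge0 => t _; exact: band_weight_ge0.
  rewrite -fub integral_mkcond [leRHS]integral_mkcond !patch_setT.
  apply: ge0_le_integral => //.
  - by move=> t _; apply: integral_ge0 => x _; exact: band_weight_ge0.
  - exact: mF.
  - apply/(measurable_restrictT _ (measurable_itv _)).
    by apply: measurable_funeM; exact: msin.
  move=> t _; have [tpi|tn] := boolP (0 < t < pi).
    rewrite mbandE//= patchE mem_set/=; last by case/andP: tpi => ? ?; rewrite in_itv/= !ltW.
    by rewrite -EFinM lee_fin; have [] := gE _ tpi.
  rewrite out; last exact/negP.
  rewrite patchE; case: ifPn => // ; rewrite inE/= in_itv/= => /andP[a b].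
  by rewrite -EFinM lee_fin mulr_ge0// ?mulr_ge0// exprn_ge0// ?invr_ge0 ?(ltW k0)// sin_ge0_pi// a.
have low : k ^+ n.+1 * g * (rho * sin rho ^+ n / n.+1%:R) <= rapidity tau * s.
  rewrite -lee_fin; apply: (@le_trans _ _ (\int[mu]_t \int[sigma]_x band_weight tau rho (t, x))%E).
    apply: (@le_trans _ _ (\int[mu]_(t in `[0%R, rho]) ((k ^+ n.+1 * g)%:E * (sin t ^+ n)%:E))%E).
      rewrite ge0_integralZl//; last 3 first.
      - exact: msin.
      - move=> t /=; rewrite in_itv/= => /andP[a b]; rewrite lee_fin exprn_ge0// sin_ge0_pi//.
        by rewrite a (le_trans b).
      - by rewrite lee_fin mulr_ge0// exprn_ge0// ltW.
      rewrite EFinM lee_wpmul2l//; first by rewrite lee_fin mulr_ge0// exprn_ge0// ltW.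
      by apply: sin_integral_partial_ge => //; exact: ltW.
    rewrite integral_itv_bndoo; last first.
      apply: measurable_funeM; apply: measurable_funS (msin 0 rho) => //.
      exact: subset_itv_oo_cc.
    rewrite [leLHS]integral_mkcond; apply: ge0_le_integral => //.
    - move=> t _; rewrite patchE; case: ifPn => // ; rewrite inE/= in_itv/= => /andP[a b].
      rewrite -EFinM lee_fin mulr_ge0// ?mulr_ge0// ?exprn_ge0// ?(ltW k0)// sin_ge0_pi//.
      by rewrite (ltW a) (le_trans (ltW b)).
    - apply/(measurable_restrictT _ (measurable_itv _)); apply: measurable_funeM.
      by apply: measurable_funS (msin 0 rho) => //; exact: subset_itv_oo_cc.
    - exact: mF.
    move=> t _; rewrite patchE; case: ifPn => [|_]; last first.
      by apply: integral_ge0 => x _; exact: band_weight_ge0.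
    rewrite inE/= in_itv/= => tr; rewrite mbandE// -EFinM lee_fin.
    by have [] := gE t _; rewrite //; case/andP: tr => -> /lt_le_trans ->.
  rewrite fub EFinM fineK ?sphere_prob_fin//; last exact: measurable_cap.
  rewrite -[X in (_ <= _ * sigma X)%E]setIT -integral_indic//; last exact: measurable_cap.
  rewrite -ge0_integralZl//; last 2 first.
    - apply/measurable_EFinP; apply: measurable_indic; exact: measurable_cap.
    - by rewrite lee_fin ltW.
  apply: ge0_le_integral => //.
  - by move=> x _; apply: integral_ge0 => t _; exact: band_weight_ge0.
  - exact: mG.
  - apply: measurable_funeM; apply/measurable_EFinP; apply: measurable_indic; exact: measurable_cap.
  by move=> x _; apply: integral_band_weight_le.
have I0 := sin_integral_gt0 (R := R) n.
rewrite -(ler_pM2l eta0).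
move: low up; set X := rho * _ / _; rewrite exprVn.
have K0 : 0 < k ^+ n.+1 by rewrite exprn_gt0.
have X0 : 0 <= X by rewrite divr_ge0// mulr_ge0 ?(ltW r0)// exprn_ge0// sin_ge0_pi// (ltW r0).
move: (k ^+ n.+1) K0 => K K0 low up.
apply: (@le_trans _ _ (K * g * sin_integral n * X)); last by nra.
have -> : rapidity tau * (K ^+ 2 * X) = (rapidity tau * K) * (K * X) by ring.
have -> : K * g * sin_integral n * X = (g * sin_integral n) * (K * X) by ring.
apply: ler_wpM2r; first by rewrite mulr_ge0// ltW.
rewrite -ler_pdivlMr//; apply: le_trans up _; rewrite le_eqVlt; apply/orP; left.
by apply/eqP; ring.
Qed.

Lemma one_subX_ge (u : R) k : 0 <= u -> u <= 1 -> 1 - k%:R * u <= (1 - u) ^+ k.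
Proof.
move=> u0 u1; elim: k => [|k IH]; first by rewrite mul0r subr0 expr0.
have u1' : 0 <= 1 - u by lra.
have := ler_wpM2l u1' IH; rewrite exprS; apply: le_trans; rewrite -natr1.
have : 0 <= k%:R * u * u :> R by rewrite !mulr_ge0.
by lra.
Qed.

Definition cap (z : S) (h : R) : set S :=
  [set y | h < dot (sphere_point y) (sphere_point z)].

Lemma measurable_sphere_cap z h : measurable (cap z h).
Proof. by apply: open_measurable_sphere; exact: open_cap. Qed.

(** The reflection exchanging the two centres is an isometry that maps one cap onto the other. *)
Lemma hausdorff_cap_le z z' h :
  (hausdorff (@chord R n.+2) n.+1 (cap z h) <= hausdorff (@chord R n.+2) n.+1 (cap z' h))%E.
Proof.
set r := sphere_reflection z' z.
apply: (@le_trans _ _ (hausdorff (@chord R n.+2) n.+1 (r @` cap z' h))).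
  apply: (@le_hausdorff R S (@chord R n.+2) n.+1 _ _) => y /= hy.
  exists (r y); last by rewrite /r sphere_reflectionK.
  rewrite /cap /=.
  have e : r z = z' by rewrite -[in LHS](sphere_reflectionE z' z) /r sphere_reflectionK.
  suff -> : dot (sphere_point (r y)) (sphere_point z') = dot (sphere_point y) (sphere_point z) by [].
  by rewrite -[RHS](sphere_reflection_dot z' z) -/r e.
have := @hausdorff_image R S S (@chord R n.+2) (@chord R n.+2) n.+1 r (cap z' h) 1.
rewrite expr1n mul1e; apply => //; try exact: chord_ge0.
by move=> x y _ _; rewrite mul1r sphere_reflection_chord.
Qed.

(** The limit of [cap_lower_bound_approx] as tau tends to 0, once the centre has been moved to the
    pole. *)
Lemma cap_lower_bound z rho : 0 < rho -> rho <= pi ->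
  rho * sin rho ^+ n / n.+1%:R <= sin_integral n * fine (sigma (cap z (cos rho))).
Proof.
move=> r0 rpi; pose P : S := to_sphere (@dot_pole R n.+1).
apply: (@le_trans _ _ (sin_integral n * fine (sigma (cap P (cos rho))))); last first.
  rewrite ler_wpM2l// ?(ltW (sin_integral_gt0 _))// fine_le ?sphere_prob_fin//; try exact: measurable_sphere_cap.
  rewrite -[leRHS]mul1e; apply: sphere_prob_le => //.
  by rewrite mul1e; exact: hausdorff_cap_le.
rewrite (_ : cap P _ = [set y | cos rho < height y]); last first.
  by apply/seteqP; split => y; rewrite /cap /= to_sphereE.
have h (t : R) := fun (t0 : 0 < t) (t1 : t < 2^-1) => @cap_lower_bound_approx t rho t0 t1 r0 rpi.
move: h; set X := rho * _ / _; set Y := sin_integral n * _ => h.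
have X0 : 0 <= X.
  by rewrite divr_ge0// mulr_ge0 ?(ltW r0)// exprn_ge0// sin_ge0_pi// (ltW r0).
clearbody X Y; apply/ler_addgt0Pr => e e0.
set M : R := (n.+1 * 2)%:R; have M0 : 0 < M by rewrite ltr0n muln2 double_gt0.
(* By Bernoulli the factor (1 - 2 t)^M is at least 1 - 2 M t, and this t ensures 2 M t X <= e. *)
pose t := Num.min (4^-1) (e / (2 * M * (X + 1))).
have d0 : 0 < 2 * M * (X + 1) by rewrite !mulr_gt0//; lra.
have t0 : 0 < t by rewrite lt_min divr_gt0// andbT.
have t4 : t <= 4^-1 by rewrite ge_min lexx.
have te : t * (2 * M * (X + 1)) <= e by rewrite -ler_pdivlMr// ge_min lexx orbT.
have t2 : t < 2^-1 by lra.
have := h _ t0 t2; rewrite -exprM => hY.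
have := @one_subX_ge (2 * t) (n.+1 * 2)%N; rewrite -/M => /(_ _ _) hM.
have {}hM : 1 - M * (2 * t) <= (1 - 2 * t) ^+ (n.+1 * 2) by apply: hM; lra.
have := ler_wpM2r X0 hM => hX.
have : 0 <= t * M by rewrite mulr_ge0// ltW.
by nra.
Qed.

End cap_measure.

(** * Vitali covering by caps *)

Section vitali.
Context {R : realType} {n : nat}.
Local Notation S := (sphere R n.+2).
Local Notation sigma := (sphere_prob R n.+1).
Local Notation H := (hausdorff (@chord R n.+2) n.+1).
Local Notation Hs := (hausdorff_size (@chord R n.+2) n.+1).
Local Notation D x y := (dot (sphere_point x) (sphere_point y)).
Implicit Types (x y z : S) (u rho c : R).

(** The radius enters through u = 1 - cos of the angle: u = a^2 / 2 means chordal radius a, and 4 u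
    means chordal radius 2 a. *)
Definition closed_cap z u : set S := [set y | 1 - u <= D y z].

Lemma chord_le_sqrt x y (a : R) : 0 <= a -> 2 * (1 - D x y) <= a ^+ 2 -> chord x y <= a.
Proof.
by move=> a0; rewrite -chord_sqr ler_sqr// nnegrE; exact: chord_ge0.
Qed.

Lemma closed_cap_chord z (a : R) x y : 0 <= a ->
  closed_cap z (a ^+ 2 / 2) x -> closed_cap z (a ^+ 2 / 2) y -> chord x y <= 2 * a.
Proof.
rewrite /closed_cap /= => a0 hx hy; apply: le_trans (chord_triangle x z y) _.
have h w : 1 - a ^+ 2 / 2 <= D w z -> chord w z <= a.
  by move=> hw; apply: chord_le_sqrt => //; lra.
by rewrite (chordC z); have := h _ hx; have := h _ hy; lra.
Qed.

Lemma closed_cap_separated x z (a : R) y : 0 <= a ->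
  closed_cap x (a ^+ 2 / 2) y -> closed_cap z (a ^+ 2 / 2) y ->
  1 - 4 * (a ^+ 2 / 2) <= D x z.
Proof.
move=> a0 hx hz.
have : chord x z <= 2 * a.
  apply: le_trans (chord_triangle x y z) _; rewrite (chordC x).
  have h w : closed_cap w (a ^+ 2 / 2) y -> chord y w <= a.
    by rewrite /closed_cap /= => hw; apply: chord_le_sqrt => //; lra.
  by have := h _ hx; have := h _ hz; lra.
rewrite -ler_sqr ?nnegrE ?mulr_ge0 ?chord_ge0// chord_sqr exprMn.
by move: (D x z) (a ^+ 2) => d b; lra.
Qed.

(** The dilation of parameter -4/5 maps the height c to (5 c - 4) / (5 - 4 c), and it expands chords
    at most by sqrt (1 - (4/5)^2) / (1 - 4/5) = 3. *)
Lemma sphere_prob_cap_doubling z c : -1 <= c -> c <= 1 ->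
  (sigma (cap z ((5 * c - 4) / (5 - 4 * c))) <= (3 ^+ n.+1)%:E * sigma (cap z c))%E.
Proof.
move=> c0 c1; apply: sphere_prob_le => //.
pose P : S := to_sphere (@dot_pole R n.+1).
apply: le_trans (hausdorff_cap_le z P _) _.
apply: (@le_trans _ _ ((3 ^+ n.+1)%:E * H (cap P c))%E); last first.
  by rewrite lee_wpmul2l ?lee_fin//; exact: hausdorff_cap_le.
have capP h : cap P h = [set y | h < height y].
  by apply/seteqP; split => y; rewrite /cap /= to_sphereE.
rewrite !capP.
have s1 : -1 < (- (4 / 5) : R) < 1 by apply/andP; split; lra.
have s1' : -1 < (- - (4 / 5) : R) < 1 by apply/andP; split; lra.
apply: (@le_trans _ _ (H (moebius s1 @` [set y | c < height y]))).
  apply: (@le_hausdorff R S (@chord R n.+2) n.+1 _ _) => y /= hy.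
  exists (moebius s1' y); last by rewrite moebiusK.
  rewrite /= moebius_height opprK; have /andP[h0 h1] := height_itv y.
  move: hy; rewrite ltr_pdivrMr ?ltr_pdivlMr; lra.
apply: hausdorff_image; [exact: chord_ge0|exact: chord_ge0|by []|].
move=> x y /= hx hy.
have /andP[hx0 hx1] := height_itv x; have /andP[hy0 hy1] := height_itv y.
have := @moebius_chord R n.+1 _ s1 x y 5^-1; rewrite !invr_gt0.
have -> : Num.sqrt (1 - (- (4 / 5)) ^+ 2) / 5^-1 = 3 :> R.
  have -> : 1 - (- (4 / 5)) ^+ 2 = (3 / 5) ^+ 2 :> R by field.
  by rewrite sqrtr_sqr ger0_norm ?divr_ge0//; field.
by apply; lra.
Qed.

(** For c = 1 - u the enlarged cap begins at height (1 - 5 u) / (1 + 4 u), which is less than 1 - 4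
    u as long as 16 u < 5. *)
Lemma sphere_prob_closed_cap_doubling z u : 0 < u -> u <= 4^-1 ->
  (sigma (closed_cap z (4 * u)) <= (3 ^+ n.+1)%:E * sigma (cap z (1 - u)))%E.
Proof.
move=> u0 u1; apply: le_trans (sphere_prob_cap_doubling z _ _); [|lra|lra].
apply: le_measure; rewrite ?inE; [|exact: measurable_sphere_cap|].
  by apply: measurable_le_sphere; [exact: cst_continuous|exact: sphere_dot_continuous].
move=> y; rewrite /closed_cap /cap /= => hy; apply: lt_le_trans hy.
have d0 : 0 < 5 - 4 * (1 - u) by lra.
by rewrite ltr_pdivrMr//; nra.
Qed.

Lemma open_contains_cap (U : set S) x : open U -> U x ->
  exists2 e, 0 < e & forall y, 1 - e < D y x -> U y.
Proof.
case=> V oV <- Vx; have /nbhs_ballP[e /= e0 eV] := open_nbhs_nbhs (conj oV Vx).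
exists (e ^+ 2 / 2); first by rewrite divr_gt0// exprn_gt0.
move=> y hy; apply: eV; split => // i j; rewrite /ball/= (ord1 i).
have : chord x y < e.
  by rewrite -ltr_sqr ?nnegrE ?(ltW e0) ?chord_ge0// chord_sqr dotC; lra.
apply: le_lt_trans.
by have := normr_coord_le (sphere_point x - sphere_point y) j; rewrite !mxE.
Qed.

Lemma le_cos_half_pow (kappa : R) : kappa < 1 ->
  exists2 rho0, 0 < rho0 & forall rho, 0 < rho -> rho < rho0 -> kappa <= cos (rho / 2) ^+ n.
Proof.
move=> k1; set m : R := n.+1%:R; have m0 : 0 < m by rewrite ltr0n.
exists (Num.min 1 ((1 - kappa) / m)); first by rewrite lt_min ltr01 divr_gt0// subr_gt0.
move=> rho r0; rewrite lt_min => /andP[r1]; rewrite ltr_pdivlMr// => rk.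
have hc : 1 - rho ^+ 2 / 8 <= cos (rho / 2).
  apply: le_trans (cos_ge _); last by rewrite divr_ge0// ltW.
  by rewrite ?divr_ge0 ?(ltW r0)// expr_div_n; lra.
have r2 : rho ^+ 2 <= rho by rewrite expr2; nra.
have r20 : 0 <= rho ^+ 2 by exact: sqr_ge0.
have u0 : 0 <= rho ^+ 2 / 8 by lra.
have u1 : rho ^+ 2 / 8 <= 1 by lra.
apply: le_trans (_ : (1 - rho ^+ 2 / 8) ^+ n <= _); last by apply: lerXn2r; rewrite ?nnegrE//; lra.
apply: le_trans (one_subX_ge n u0 u1).
have nm : n%:R <= m by rewrite ler_nat.
have n0 : 0 <= n%:R :> R by [].
have : n%:R * (rho ^+ 2 / 8) <= m * rho.
  by apply: ler_pM => //; lra.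
by lra.
Qed.

Lemma half_chord_sqr rho : (2 * sin (rho / 2)) ^+ 2 / 2 = 1 - cos rho.
Proof.
rewrite [in RHS](splitr rho) cosD; have := cos2Dsin2 (rho / 2); rewrite !expr2; lra.
Qed.

Lemma sinD_half rho : sin rho = 2 * sin (rho / 2) * cos (rho / 2).
Proof. by rewrite [in LHS](splitr rho) sinD; ring. Qed.

Lemma measurable_closed_cap z u : measurable (closed_cap z u).
Proof. by apply: measurable_le_sphere; [exact: cst_continuous|exact: sphere_dot_continuous]. Qed.

Lemma closed_closed_cap z u : closed (closed_cap z u).
Proof.
rewrite (_ : closed_cap z u = (fun y => D y z) @^-1` [set t | 1 - u <= t])//.
by apply: closed_comp; [move=> y _; exact: sphere_dot_continuous|exact: closed_ge].
Qed.

Lemma closed_cap_lower_bound z rho : 0 < rho -> rho <= pi ->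
  rho * sin rho ^+ n <=
  n.+1%:R * sin_integral n * fine (sigma (closed_cap z ((2 * sin (rho / 2)) ^+ 2 / 2))).
Proof.
move=> r0 rpi; have := cap_lower_bound z r0 rpi; rewrite ler_pdivrMr// => h.
apply: le_trans h _; rewrite [leLHS]mulrC mulrA ler_wpM2l ?mulr_ge0 ?(ltW (sin_integral_gt0 _))//.
apply: fine_le; rewrite ?sphere_prob_fin//; [exact: measurable_sphere_cap|exact: measurable_closed_cap|].
apply: le_measure; rewrite ?inE; [exact: measurable_sphere_cap|exact: measurable_closed_cap|].
by move=> y; rewrite half_chord_sqr /closed_cap /cap /= subKr => /ltW.
Qed.

Lemma closed_cap_prob_gt0 z rho : 0 < rho -> rho < pi ->
  0 < fine (sigma (closed_cap z ((2 * sin (rho / 2)) ^+ 2 / 2))).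
Proof.
move=> r0 rpi; have c0 : 0 < n.+1%:R * sin_integral n :> R by rewrite mulr_gt0// sin_integral_gt0.
rewrite -(pmulr_rgt0 _ c0); apply: lt_le_trans (closed_cap_lower_bound z r0 (ltW rpi)).
by rewrite mulr_gt0// exprn_gt0// sin_gt0_pi// r0.
Qed.

(** A cap of chordal radius a weighs at most omega_(n+1) a^(n+1), while [closed_cap_lower_bound]
    bounds its mass below through rho sin^n rho. As sin rho = a cos (rho / 2) and a <= rho, only
    cos^n (rho / 2) is left for kappa to absorb. *)
Lemma closed_cap_size delta z rho (kappa : R) : 0 < rho -> rho <= pi -> 2 * rho <= delta ->
  0 <= kappa -> kappa <= cos (rho / 2) ^+ n ->
  (kappa%:E * Hs delta (closed_cap z ((2 * sin (rho / 2)) ^+ 2 / 2)) <=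
  (ball_volume n.+1 * (n.+1%:R * sin_integral n))%:E *
  sigma (closed_cap z ((2 * sin (rho / 2)) ^+ 2 / 2)))%E.
Proof.
move=> r0 rpi rd k0 kc; set a := 2 * sin (rho / 2); set K := closed_cap _ _.
have ar : a <= rho by rewrite /a; have := @sin_le R (rho / 2); lra.
have a0 : 0 <= a.
  by rewrite mulr_ge0// sin_ge0_pi//; apply/andP; split; lra.
have dK : (diameter (@chord R n.+2) K <= (2 * a)%:E)%E.
  by apply: diameter_le => x y; exact: closed_cap_chord.
apply: (@le_trans _ _ (kappa%:E * (ball_volume n.+1 * a ^+ n.+1)%:E)%E).
  rewrite lee_wpmul2l ?lee_fin//; apply: le_trans (hausdorff_size_weight n.+1 chord_ge0 _) _.
    by apply: le_trans dK _; rewrite lee_fin; lra.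
  have a2 : 0 <= 2 * a by rewrite mulr_ge0.
  have := hausdorff_weight_le n.+1 chord_ge0 a2 dK.
  by have -> : 2 * a / 2 = a by field.
rewrite -[sigma K]fineK; last by apply: sphere_prob_fin; exact: measurable_closed_cap.
rewrite -!EFinM lee_fin mulrCA -mulrA ler_wpM2l ?ball_volume_ge0//.
apply: le_trans (closed_cap_lower_bound z r0 rpi).
rewrite sinD_half -/a; move: k0 kc ar a0 {K dK}; clear; move: (cos (rho / 2)) a => b a k0 kc ar a0.
rewrite exprMn exprS mulrCA; apply: ler_pM => //.
  by rewrite mulr_ge0// exprn_ge0.
by rewrite mulrC ler_wpM2l ?exprn_ge0.
Qed.

Lemma disjoint_caps_sum (N : nat) (f : 'I_N -> S) (a : R) : 0 <= a ->
  (forall i j, i != j -> D (f i) (f j) < 1 - 4 * (a ^+ 2 / 2)) ->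
  (sigma (\big[setU/set0]_(i < N) closed_cap (f i) (a ^+ 2 / 2)) =
   \sum_(i < N) sigma (closed_cap (f i) (a ^+ 2 / 2)))%E.
Proof.
move=> a0 sf; apply: measure_semi_additive_ord.
- by move=> i; exact: measurable_closed_cap.
- move=> i j _ _ [y [yi yj]]; apply/eqP/negPn/negP => ij.
  by have := closed_cap_separated a0 yi yj; rewrite leNgt sf.
- by apply: bigsetU_measurable => i _; exact: measurable_closed_cap.
Qed.

(** Caps of angle rho around points separated in this sense are disjoint and have mass at least m >
    0, so there are at most 1 / m of them; a family of the largest cardinality is maximal. *)
Lemma maximal_separated (F : set S) rho : 0 < rho -> rho < pi ->
  exists N (f : 'I_N -> S),
    [/\ forall i, F (f i),
        forall i j, i != j -> D (f i) (f j) < 1 - 4 * (1 - cos rho) &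
        forall x, F x -> exists i, 1 - 4 * (1 - cos rho) <= D x (f i)].
Proof.
move=> r0 rpi; rewrite -half_chord_sqr; set a := 2 * sin (rho / 2).
have a0 : 0 <= a.
  by rewrite mulr_ge0// sin_ge0_pi//; apply/andP; split; lra.
pose G N := exists f : 'I_N -> S, (forall i, F (f i)) /\
    forall i j, i != j -> D (f i) (f j) < 1 - 4 * (a ^+ 2 / 2).
pose m := rho * sin rho ^+ n / (n.+1%:R * sin_integral n).
have c0 : 0 < n.+1%:R * sin_integral n :> R by rewrite mulr_gt0// sin_integral_gt0.
have m0 : 0 < m by rewrite divr_gt0// mulr_gt0// exprn_gt0// sin_gt0_pi// r0.
have bound N : G N -> N%:R <= m^-1.
  move=> [f [Ff sf]]; rewrite -[leRHS]mul1r ler_pdivlMr// -lee_fin.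
  have mb : measurable (\big[setU/set0]_(i < N) closed_cap (f i) (a ^+ 2 / 2)).
    by apply: bigsetU_measurable => i _; exact: measurable_closed_cap.
  apply: le_trans (probability_le1 sigma mb); rewrite disjoint_caps_sum//.
  apply: (@le_trans _ _ (\sum_(i < N) m%:E)%E).
    by rewrite sumEFin sumr_const card_ord lee_fin mulr_natl.
  apply: lee_sum => i _.
  rewrite -[sigma _]fineK; last by apply: sphere_prob_fin; exact: measurable_closed_cap.
  by rewrite lee_fin ler_pdivrMr// [leRHS]mulrC closed_cap_lower_bound// ltW.
have [N [GN GN1]] : exists N, G N /\ ~ G N.+1.
  apply: contrapT => h.
  have all N : G N.
    elim: N => [|N GN]; first by exists (fun=> point); split => -[].
    by apply: contrapT => GN1; apply: h; exists N.
  have := bound _ (all (Num.truncn m^-1).+1).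
  by rewrite leNgt truncnS_gt// invr_ge0 ltW.
case: GN => f [Ff sf]; exists N, f; split => // x Fx.
apply: contrapT => nx; apply: GN1.
have nx' i : D x (f i) < 1 - 4 * (a ^+ 2 / 2).
  by rewrite ltNge; apply/negP => h; apply: nx; exists i.
exists (fun i => if unlift ord0 i is Some j then f j else x); split.
  by move=> i; case: unliftP.
move=> i j; case: unliftP => [i' ->|->]; case: unliftP => [j' ->|->] //.
- by move=> ij; apply: sf; apply: contra_neq ij => ->.
- by move=> _; rewrite dotC.
Qed.

End vitali.

Section vitali_covering.
Context {R : realType} {n : nat}.
Local Notation S := (sphere R n.+2).
Local Notation sigma := (sphere_prob R n.+1).
Local Notation H := (hausdorff (@chord R n.+2) n.+1).
Local Notation Hs := (hausdorff_size (@chord R n.+2) n.+1).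
Local Notation D x y := (dot (sphere_point x) (sphere_point y)).
Implicit Types (x y z : S) (u rho c : R).

(** The sets of points at a distance from the complement bounded below exhaust U, so one of them has
    at least half of its mass. The margin e keeps small caps centred in F inside U. *)
Lemma open_inner_approx (U : set S) : open U -> sigma U != 0%E ->
  exists (F : set S) (e : R), [/\ 0 < e, measurable F,
    forall x y, F x -> 1 - e < D y x -> U y &
    (sigma U <= 2%:E * sigma F)%E].
Proof.
move=> oU U0; have mU := open_measurable_sphere oU.
pose F m : set S := \bigcap_(v in ~` U) [set x | D x v <= 1 - m.+1%:R^-1].
have cF m : closed (F m).
  apply: closed_bigI => v _.
  rewrite (_ : [set x | _] = (fun x => D x v) @^-1` [set t | t <= 1 - m.+1%:R^-1])//.
  by apply: closed_comp; [move=> y _; exact: sphere_dot_continuous|exact: closed_le].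
have mF m : measurable (F m).
  rewrite -[F m]setCK; apply: measurableC; apply: open_measurable_sphere.
  exact: closed_openC.
have UF : \bigcup_m F m = U.
  apply/seteqP; split => [x [m _ Fx]|x Ux].
    apply: contrapT => Ux; have := Fx _ Ux; rewrite /= dot_sphere.
    have t0 : 0 < m.+1%:R^-1 :> R by rewrite invr_gt0.
    by move: t0 => /[swap]; move: (m.+1%:R^-1) => t h t0; lra.
  have [e e0 he] := open_contains_cap oU Ux.
  exists (Num.truncn e^-1) => // v /= Uv.
  rewrite leNgt; apply/negP => h; apply: Uv; apply: he; rewrite dotC.
  apply: le_lt_trans h; rewrite lerD2l lerN2 -[leRHS]invrK lef_pV2 ?posrE ?invr_gt0//.
  by rewrite ltW// truncnS_gt// invr_ge0 ltW.
have ndF : nondecreasing_seq F.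
  move=> a b ab; apply/subsetPset => x Fx v Uv; apply: le_trans (Fx v Uv) _.
  by rewrite lerD2l lerN2 lef_pV2 ?posrE// ler_nat.
have := nondecreasing_cvg_mu (mu := sigma) mF _ ndF; rewrite UF => /(_ mU).
have Ufin := sphere_prob_fin mU; have s0 : 0 < fine (sigma U).
  by rewrite fine_gt0// ltey_eq Ufin lt_def U0 measure_ge0.
rewrite -[X in _ --> X](fineK Ufin) => /fine_cvgP [_ /cvgrPdist_lt /(_ (fine (sigma U) / 2))].
rewrite divr_gt0// => /(_ isT) [m _ /(_ m (leqnn m))] /=.
rewrite ltr_norml => /andP[_ hm].
exists (F m), m.+1%:R^-1; split => //.
  move=> x y Fx hy; apply: contrapT => Uy; have := Fx _ Uy; rewrite /= dotC.
  by rewrite leNgt hy.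
rewrite -(fineK Ufin) -[sigma (F m)]fineK ?sphere_prob_fin// -EFinM lee_fin.
by move: hm; rewrite /=; lra.
Qed.

Lemma sphere_prob_big_le (N : nat) (F : 'I_N -> set S) : (forall i, measurable (F i)) ->
  (sigma (\big[setU/set0]_(i < N) F i) <= \sum_(i < N) sigma (F i))%E.
Proof.
move=> mF; suff [] : measurable (\big[setU/set0]_(i < N) F i) /\
  (sigma (\big[setU/set0]_(i < N) F i) <= \sum_(i < N) sigma (F i))%E by [].
elim/big_rec2: _ => [|i s A _ [mA hA]]; first by rewrite measure0.
split; first exact: measurableU.
by apply: le_trans (measureU2 _ _ _) _ => //; exact: leeD2l.
Qed.

(* A fixed fraction of any open set is covered by finitely many disjoint small
   closed caps; iterating on what remains yields the estimate. *)
Lemma vitali_step (delta kappa s : R) :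
  0 < delta -> 0 < kappa -> kappa < 1 -> 0 <= s ->
  let A := ball_volume n.+1 * (n.+1%:R * sin_integral n) in
  (forall U : set S, open U -> (kappa%:E * Hs delta U <= (A + s)%:E * sigma U)%E) ->
  forall U : set S, open U ->
  (kappa%:E * Hs delta U <= (A + s * (1 - (2 * 3 ^+ n.+1)^-1))%:E * sigma U)%E.
Proof.
move=> d0 k0 k1 s0 A IH U oU; have mU := open_measurable_sphere oU.
have A0 : 0 <= A.
  by rewrite mulr_ge0 ?ball_volume_ge0// mulr_ge0// ltW// sin_integral_gt0.
have [U0|U0] := eqVneq (sigma U) 0%E.
  by apply: le_trans (IH _ oU) _; rewrite U0 !mule0.
have [F [e [e0 mF FU UF]]] := open_inner_approx oU U0.
have [rho0 r00 kr] := le_cos_half_pow (n := n) k1.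
(* Small enough for the bound of cos^n by kappa, for diameters at most delta, for the doubling
   estimate, and for the caps around points of F to stay in U. *)
pose rho := Num.min (Num.min (rho0 / 2) (delta / 2)) (Num.min (2^-1) (Num.min 1 e)) .
have r0 : 0 < rho by rewrite !lt_min !divr_gt0// invr_gt0 ltr0n ltr01 e0.
have rr0 : rho < rho0.
  by apply: (@le_lt_trans _ _ (rho0 / 2)); [rewrite !ge_min lexx|lra].
have rd : 2 * rho <= delta.
  have : rho <= delta / 2 by rewrite !ge_min lexx !orbT.
  by lra.
have r2 : rho <= 2^-1 by rewrite !ge_min lexx !orbT.
have re : rho <= e by rewrite !ge_min lexx !orbT.
have rpi : rho < pi by have := @pi_ge2 R; lra.
set a := 2 * sin (rho / 2).
have a0 : 0 < a.
  by rewrite mulr_gt0// sin_gt0_pi//; apply/andP; split; lra.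
have au : a ^+ 2 / 2 = 1 - cos rho by exact: half_chord_sqr.
have ur : 1 - cos rho <= rho ^+ 2 / 2 by have := cos_ge (ltW r0); lra.
have u0 : 0 < 1 - cos rho by rewrite -au divr_gt0// exprn_gt0.
have r22 : rho ^+ 2 / 2 <= rho * 4^-1 by rewrite expr2; nra.
have [N [f [Ff sf cf]]] := maximal_separated F r0 rpi.
rewrite -au in sf cf u0 ur.
set K := \big[setU/set0]_(i < N) closed_cap (f i) (a ^+ 2 / 2).
have mK : measurable K by apply: bigsetU_measurable => i _; exact: measurable_closed_cap.
have cK : closed K by apply: closed_bigsetU => i _; exact: closed_closed_cap.
have KU : K `<=` U.
  rewrite /K -bigcup_seq => y [i _ yi]; apply: (FU (f i) y (Ff i)).
  by move: yi; rewrite /closed_cap /=; lra.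
have sK : sigma K = (\sum_(i < N) sigma (closed_cap (f i) (a ^+ 2 / 2)))%E.
  exact: disjoint_caps_sum (ltW a0) sf.
(* By maximality the caps of twice the chordal radius cover F, and doubling leaves K a fixed
   fraction of the mass of F. *)
have FK : (sigma F <= (3 ^+ n.+1)%:E * sigma K)%E.
  apply: (@le_trans _ _ (sigma (\big[setU/set0]_(i < N) closed_cap (f i) (4 * (a ^+ 2 / 2))))).
    apply: le_measure; rewrite ?inE//.
      by apply: bigsetU_measurable => i _; exact: measurable_closed_cap.
    by move=> x /cf [i hi]; rewrite (bigD1 i)//=; left.
  apply: le_trans (sphere_prob_big_le _) _; first by move=> i; exact: measurable_closed_cap.
  rewrite sK ge0_sume_distrr//; apply: lee_sum => i _.
  apply: le_trans (sphere_prob_closed_cap_doubling _ u0 _) _; first by lra.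
  rewrite lee_wpmul2l ?lee_fin ?exprn_ge0//.
  apply: le_measure; rewrite ?inE; [exact: measurable_sphere_cap|exact: measurable_closed_cap|].
  by move=> y; rewrite /closed_cap /cap /= => /ltW.
have HK : (kappa%:E * Hs delta K <= A%:E * sigma K)%E.
  apply: (@le_trans _ _ (kappa%:E * \sum_(i < N) Hs delta (closed_cap (f i) (a ^+ 2 / 2)))%E).
    by rewrite lee_wpmul2l ?lee_fin ?(ltW k0)//; apply: hausdorff_size_seq; exact: chord_ge0.
  rewrite sK !ge0_sume_distrr//; last by move=> i _; exact: hausdorff_size_ge0 chord_ge0 _ _.
  apply: lee_sum => i _; apply: closed_cap_size => //; try exact: ltW.
  exact: kr.
have oUK : open (U `&` ~` K) by apply: openI => //; exact: closed_openC.
have mUK := open_measurable_sphere oUK.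
have HUK := IH _ oUK.
have sU : sigma U = (sigma K + sigma (U `&` ~` K))%E.
  rewrite -measureU//; last by rewrite setICA setICr setI0.
  by rewrite setUIr setUCr setIT (setUidr KU).
(* Per unit of mass K costs at most A and the rest at most A + s. Since K has at least the fraction
   1 / (2 * 3^(n+1)) of the mass of U, the excess s shrinks by the stated factor. *)
apply: (@le_trans _ _ (kappa%:E * (Hs delta K + Hs delta (U `&` ~` K)))%E).
  rewrite lee_wpmul2l ?lee_fin ?(ltW k0)//.
  apply: le_trans (hausdorff_size_setU _ chord_ge0 _ _ _).
  by apply: le_hausdorff_size => y Uy; have [Ky|Ky] := pselect (K y); [left|right].
rewrite ge0_muleDr; try exact: hausdorff_size_ge0 chord_ge0 _ _.
apply: le_trans (leeD HK HUK) _.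
move: UF FK; rewrite sU -(fineK (sphere_prob_fin mK)) -(fineK (sphere_prob_fin mF)).
rewrite -(fineK (sphere_prob_fin mUK)) !(=^~ EFinM, =^~ EFinD) !lee_fin.
move: (fine _) (fine _) (fine _) => y z x xy yz.
have e3 : 0 < (3 : R) ^+ n.+1 by rewrite exprn_gt0.
move: ((3 : R) ^+ n.+1) e3 xy yz => t t0 xy yz.
have : x + z <= 2 * t * x by lra.
rewrite -ler_pdivrMl ?mulr_gt0// => h.
have : 0 <= s * (x - (2 * t)^-1 * (x + z)) by rewrite mulr_ge0// subr_ge0.
by move: ((2 * t)^-1) => v; lra.
Qed.

Lemma hausdorff_sphereE (U : set S) : H U = ((sphere_area R n.+2)%:E * sigma U)%E.
Proof.
rewrite sphere_probE muleCA -EFinM.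
suff -> : sphere_area R n.+2 * (fine (H setT))^-1 = 1 by rewrite mule1.
by apply: mulfV; rewrite gt_eqF// sphere_area_gt0.
Qed.

Lemma exists_powM_le (b h eta : R) : 0 <= b -> b < 1 -> 0 <= h -> 0 < eta ->
  exists m, h * b ^+ m <= eta.
Proof.
move=> b0 b1 h0 eta0.
have hb : 0 < eta / (h + 1) by rewrite divr_gt0//; lra.
have /cvgrPdist_lt /(_ _ hb) [m _ /(_ m (leqnn m))] /= : (fun m => b ^+ m) @ \oo --> (0 : R).
  by apply: cvg_expr; rewrite ger0_norm.
rewrite sub0r normrN ger0_norm ?exprn_ge0// ltr_pdivlMr; last by lra.
move=> hm; exists m; have : 0 <= b ^+ m by rewrite exprn_ge0.
by move: (b ^+ m) hm => t; nra.
Qed.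

(** Starting from the trivial excess s = h, the iteration of [vitali_step] makes the excess tend to
    0 geometrically, for each delta and kappa. Then the supremum over delta is taken and kappa tends
    to 1. *)
Lemma sphere_area_le_mul_sin_integral :
  sphere_area R n.+2 <= ball_volume n.+1 * (n.+1%:R * sin_integral n).
Proof.
set h := sphere_area R n.+2; set A := _ * _.
have h0 : 0 < h := sphere_area_gt0.
have A0 : 0 <= A.
  by rewrite mulr_ge0 ?ball_volume_ge0// mulr_ge0// ltW// sin_integral_gt0.
have sT : sigma setT = 1%E := probability_setT _.
have size_le (delta kappa : R) : 0 < delta -> 0 < kappa -> kappa < 1 ->
    (kappa%:E * Hs delta setT <= A%:E)%E.
  move=> d0 k0 k1; pose b : R := 1 - (2 * 3 ^+ n.+1)^-1.
  have e1 : (1 : R) <= 3 ^+ n.+1 by rewrite exprn_ege1//; lra.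
  have b01 : 0 <= b /\ b < 1.
    have t0 : 0 < (2 * 3 ^+ n.+1)^-1 :> R by rewrite invr_gt0 mulr_gt0// exprn_gt0.
    have : (2 * 3 ^+ n.+1)^-1 <= 1 :> R by rewrite invf_le1; lra.
    by rewrite /b; lra.
  have [b0 b1] := b01.
  have step m U : open U -> (kappa%:E * Hs delta U <= (A + h * b ^+ m)%:E * sigma U)%E.
    elim: m U => [|m IH] U oU; last first.
      rewrite exprSr mulrA; apply: vitali_step => //.
      by rewrite mulr_ge0 ?exprn_ge0// ltW.
    apply: (@le_trans _ _ (H U)).
      apply: (@le_trans _ _ (Hs delta U)); last exact: hausdorff_size_le.
      rewrite -[leRHS]mul1e lee_wpmul2r ?lee_fin ?(ltW k1)//.
      exact: hausdorff_size_ge0 chord_ge0 _ _.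
    by rewrite hausdorff_sphereE expr0 mulr1 lee_wpmul2r// lee_fin lerDr.
  apply/lee_addgt0Pr => eta eta0.
  have [m hm] := exists_powM_le b0 b1 (ltW h0) eta0.
  apply: le_trans (step m _ openT) _.
  by rewrite sT mule1 -EFinD lee_fin lerD2l.
have kH kappa : 0 < kappa -> kappa < 1 -> kappa * h <= A.
  move=> k0 k1; rewrite -lee_fin EFinM -lee_pdivlMl//.
  rewrite -[h%:E]mule1 -sT -hausdorff_sphereE; apply: ge_ereal_sup => _ [delta /= d0 <-].
  by rewrite lee_pdivlMl//; exact: size_le.
rewrite leNgt; apply/negP => Ah.
(* If A < h, the kappa halfway between A / h and 1 would give kappa h > A. *)
have := kH ((1 + A / h) / 2).
have Ah1 : A / h < 1 by rewrite ltr_pdivrMr// mul1r.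
have Ah0 : 0 <= A / h by rewrite divr_ge0// ltW.
have Ahh : A / h * h = A by rewrite divfK// gt_eqF.
move: (A / h) Ah0 Ah1 Ahh => t t0 t1 th; clearbody h A.
have k0 : 0 < (1 + t) / 2 by lra.
have k1 : (1 + t) / 2 < 1 by lra.
by move=> /(_ k0 k1); lra.
Qed.

Lemma sphere_area_mul_sin_integral_le :
  sphere_area R n.+2 * sin_integral n.+1 <= 2 * pi * ball_volume n.+1.
Proof.
have I1 := sin_integral_gt0 (R := R) n.+1.
apply: le_trans (ler_wpM2r (ltW I1) sphere_area_le_mul_sin_integral) _.
have n1 : n.+1%:R != 0 :> R by rewrite pnatr_eq0.
have := sin_integral_mulS (R := R) n.
move: (sin_integral n) (sin_integral n.+1) (ball_volume n.+1) => I I' b II.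
rewrite le_eqVlt; apply/orP; left; apply/eqP.
transitivity (b * n.+1%:R * (I * I')); first by ring.
by rewrite II; field.
Qed.

End vitali_covering.

(** The sphere S^0 consists of two points of measure at most 1 each. It is treated apart because the
    covering argument concerns spheres of positive dimension. *)
Lemma sphere_area1_le (R : realType) : sphere_area R 1 <= 2.
Proof.
have H1 (x : sphere R 1) : (hausdorff (@chord R 1) 0 [set x] <= 1)%E.
  apply: ge_ereal_sup => _ [e /= e0 <-].
  have dx : (diameter (@chord R 1) [set x] <= 0%:E)%E.
    apply: diameter_le => _ _ -> ->; rewrite /chord subrr /enorm dot0l sqrtr0//.
  apply: le_trans (hausdorff_size_weight 0 chord_ge0 _) _.
    by apply: le_trans dx _; rewrite lee_fin ltW.
  apply: le_trans (hausdorff_weight_le 0 chord_ge0 (lexx 0) dx) _.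
  by rewrite expr0 mulr1.
pose P : sphere R 1 := to_sphere (@dot_pole R 0).
have N1 : dot (- @pole R 0) (- pole) = 1 by rewrite dotNl dotNr opprK dot_pole.
pose N : sphere R 1 := to_sphere N1.
rewrite -lee_fin /sphere_area fineK; last exact: (hausdorff_sphere_fin (n := 0)).
apply: (@le_trans _ _ (hausdorff (@chord R 1) 0 ([set P] `|` [set N]))).
  apply: (@le_hausdorff R _ (@chord R 1) 0 _ _) => x _.
  have : sphere_point x 0 0 ^+ 2 = 1.
    by have := dot_sphere x; rewrite /dot big_ord1 expr2.
  move=> /eqP; rewrite sqrf_eq1 => /orP[] /eqP x1; [left|right]; apply: sphere_point_inj;
    apply/rowP => i; rewrite (ord1 i) x1 to_sphereE !mxE eqxx//.
have := outer_measureU2 (@sphere_hausdorff R 1) [set P] [set N].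
move=> /le_trans; apply; apply: le_trans (leeD (H1 P) (H1 N)) _.
by rewrite -EFinD.
Qed.

Lemma sphere_area_sin_integral_le (R : realType) m :
  sphere_area R m.+1 * sin_integral m <= 2 * pi * ball_volume m.
Proof.
case: m => [|m]; last exact: sphere_area_mul_sin_integral_le.
by rewrite sin_integral0 mulr1 ler_wpM2r ?pi_ge0// sphere_area1_le.
Qed.

(** * The radius of the cells *)

Lemma powR_tangent (R : realType) (p s t : R) : 1 <= p -> 0 <= s -> 0 <= t ->
  s `^ p - t `^ p <= p * s `^ (p - 1) * (s - t).
Proof.
move=> p1 s0 t0; move: s0; rewrite le_eqVlt => /predU1P[<-|s0].
  have p0 : p != 0 by lra.
  rewrite powR0// sub0r sub0r mulrN lerN2.
  have [->|p1'] := eqVneq p 1; first by rewrite subrr powRr0 !mul1r powRr1.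
  by rewrite powR0 ?subr_eq0// mulr0 mul0r powR_ge0.
have := @powR_bernoulli R p (t / s) p1; rewrite divr_ge0 ?(ltW s0)// => /(_ isT).
have tE : t `^ p = (t / s) `^ p * s `^ p by rewrite -powRM ?divfK ?gt_eqF ?divr_ge0 ?(ltW s0).
have sE : s `^ p = s * s `^ (p - 1).
  rewrite -[X in _ = X * _](powRr1 (ltW s0)) -powRD; first by rewrite addrC subrK.
  by rewrite (gt_eqF s0) implybT.
rewrite tE sE => h; have : 0 <= s * s `^ (p - 1) by rewrite mulr_ge0 ?powR_ge0// ltW.
have e : t = t / s * s by rewrite divfK// gt_eqF.
move: (t / s) (s `^ (p - 1)) ((t / s) `^ p) h e => u v w h -> sv.
by have := ler_wpM2r sv h; lra.
Qed.

Lemma dist_powR_le (R : realType) (p M s t : R) : 1 <= p ->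
  0 <= s <= M -> 0 <= t <= M -> `|s `^ p - t `^ p| <= p * M `^ (p - 1) * `|s - t|.
Proof.
move=> p1 /andP[s0 sM] /andP[t0 tM].
have M0 := le_trans s0 sM.
wlog st : s t s0 sM t0 tM / t <= s.
  move=> h; have [ts|/ltW st] := leP t s; first exact: h.
  by rewrite distrC (distrC s); exact: h.
have tps : t `^ p <= s `^ p by rewrite ge0_ler_powR// ?nnegrE//; lra.
rewrite !ger0_norm ?subr_ge0//; apply: le_trans (powR_tangent p1 s0 t0) _.
rewrite ler_wpM2r ?subr_ge0// ler_wpM2l//; first by lra.
by rewrite ge0_ler_powR// ?nnegrE//; lra.
Qed.

Section transport.
Context {R : realType} {n : nat}.
Local Notation S := (sphere R n.+2).
Local Notation sigma := (sphere_prob R n.+1).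
Implicit Types (x y z : S).

(** Split z into its component along y and a rest w of norm sin d(y, z). By [sphere_bessel] the
    product of x and w is at least - sin d(x, y) sin d(y, z), so cos d(x, z) >= cos (d(x, y) + d(y,
    z)). *)
Lemma sphere_dist_triangle x y z : sphere_dist x z <= sphere_dist x y + sphere_dist y z.
Proof.
have /andP[a0 api] := sphere_dist_itv x y; have /andP[b0 bpi] := sphere_dist_itv y z.
have /andP[c0 cpi] := sphere_dist_itv x z.
have [hpi|hpi] := leP pi (sphere_dist x y + sphere_dist y z); first exact: le_trans cpi hpi.
rewrite leNgt -ltr_cos ?in_itv/= ?addr_ge0 ?c0 ?(ltW hpi)// -leNgt.
set c := dot (sphere_point z) (sphere_point y).
pose w := sphere_point z - c *: sphere_point y.
have yw : dot (sphere_point y) w = 0.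
  by rewrite /w dotC dotBl dotZl dot_sphere mulr1 subrr.
have sw : enorm w = sin (sphere_dist y z).
  apply: (@pexpIrn _ 2); rewrite ?nnegrE ?enorm_ge0 ?sin_ge0_pi ?b0//.
  rewrite enorm_sq sin2cos2 cos_sphere_dist (dotC (sphere_point y)) -/c.
  by rewrite {1}/w dotBl dotZl yw mulr0 subr0 /w dotC dotBl dotZl !dot_sphere (dotC (sphere_point y)) -/c expr2.
have := sphere_bessel x yw; rewrite sw ler_norml => /andP[h _].
rewrite cosD !cos_sphere_dist; move: h; rewrite /w dotC dotBl dotZl.
rewrite (dotC (sphere_point y) (sphere_point z)) -/c (dotC (sphere_point z)) (dotC (sphere_point y)).
by lra.
Qed.

Lemma dist_sphere_dist_le x y z : `|sphere_dist x z - sphere_dist y z| <= sphere_dist x y.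
Proof.
rewrite ler_norml; apply/andP; split.
  by have := sphere_dist_triangle y x z; rewrite (sphere_distC y x); lra.
by have := sphere_dist_triangle x y z; lra.
Qed.

Lemma near_sphere_dist x (e : R) : 0 < e -> \forall y \near x, sphere_dist y x < e.
Proof.
move=> e0; pose e' := Num.min e (pi / 2).
have p0 := @pi_gt0 R.
have e'0 : 0 < e' by rewrite lt_min e0 divr_gt0.
have e'pi : e' < pi by apply: (@le_lt_trans _ _ (pi / 2)); [rewrite ge_min lexx orbT|lra].
have ce : cos e' < 1 by rewrite -cos0 ltr_cos// in_itv/= ?lexx ?pi_ge0// !ltW.
have : open (cap x (cos e')) := @open_cap R n (sphere_point x) (cos e').
rewrite openE => /(_ x); rewrite /cap /= dot_sphere => /(_ ce).
apply: filterS => y; rewrite /= -cos_sphere_dist.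
have yi : sphere_dist y x \in `[0, pi] by rewrite in_itv/= sphere_dist_itv.
have ei : e' \in `[0, pi] by rewrite in_itv/= !ltW.
by rewrite ltr_cos// => /lt_le_trans; apply; rewrite ge_min lexx.
Qed.

Lemma sphere_lipschitz_continuous (f : S -> R) (M : R) : 0 <= M ->
  (forall x y, `|f x - f y| <= M * sphere_dist x y) -> continuous f.
Proof.
move=> M0 hf x; apply/(@cvgrPdist_lt R R S (nbhs x) (@nbhs_filter S x)) => e e0.
have d0 : 0 < e / (M + 1) by rewrite divr_gt0//; lra.
move: (near_sphere_dist x d0); apply: (@filterS _ _ (@nbhs_filter S x)) => y.
rewrite /= ltr_pdivlMr; last by lra.
move=> h; apply: le_lt_trans (hf _ _) _; rewrite sphere_distC.
by have := sphere_dist_ge0 y x; move: (sphere_dist y x) h => d h d'; lra.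
Qed.

Lemma continuous_sphere_dist_powR z (p : R) : 1 <= p ->
  continuous (fun x => sphere_dist x z `^ p).
Proof.
move=> p1; have C0 : 0 <= p * pi `^ (p - 1) by rewrite mulr_ge0 ?powR_ge0//; lra.
apply: (sphere_lipschitz_continuous C0) => x y.
apply: le_trans (dist_powR_le p1 (sphere_dist_itv x z) (sphere_dist_itv y z)) _.
by apply: ler_wpM2l C0 _ _ _; exact: dist_sphere_dist_le.
Qed.

Section cells.
Context {L : nat} (p : R) (w : 'I_L -> S) (lam : 'I_L -> R).
Hypothesis p1 : 1 < p.

Lemma closed_le_sphere (f g : S -> R) : continuous f -> continuous g ->
  closed [set x | f x <= g x].
Proof.
move=> cf cg; rewrite (_ : [set x | _] = (fun x => g x - f x) @^-1` [set t | 0 <= t]); last first.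
  by apply/seteqP; split => x /=; rewrite subr_ge0.
apply: closed_comp; last exact: closed_ge.
by move=> x _; exact: (@cvgB _ _ _ (nbhs x) (@nbhs_filter S x) g f _ _ (cg x) (cf x)).
Qed.

Lemma continuous_cell_cost i : continuous (fun x => sphere_dist x (w i) `^ p + lam i).
Proof.
have cc : continuous (cst (lam i) : S -> R) by exact: cst_continuous.
move=> y; apply: (@cvgD _ _ _ (nbhs y) (@nbhs_filter S y)
  (fun x => sphere_dist x (w i) `^ p) (cst (lam i)) _ _ _ (cc y)).
by apply: continuous_sphere_dist_powR; exact: ltW.
Qed.

Lemma closure_strict_cell l k x : closure (strict_cell p w lam l) x ->
  sphere_dist x (w l) `^ p + lam l <= sphere_dist x (w k) `^ p + lam k.
Proof.
have c := continuous_cell_cost.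
move: x; rewrite closureE; apply: smallest_sub => [|x hx]; first exact: closed_le_sphere.
by have [->|kl] := eqVneq k l; [rewrite /= lexx|exact: ltW (hx _ kl)].
Qed.

Lemma open_strict_cell l : open (strict_cell p w lam l).
Proof.
have c := continuous_cell_cost.
rewrite (_ : strict_cell p w lam l = ~` \bigcup_(k in [set k | k != l])
   [set x | sphere_dist x (w k) `^ p + lam k <= sphere_dist x (w l) `^ p + lam l]).
  apply: closed_openC; apply: closed_bigcup; first exact: finite_finset.
  by move=> k _; exact: closed_le_sphere.
apply/seteqP; split => [x hx [k kl /=]|x hx k kl]; first by apply/negP; rewrite -ltNge; exact: hx.
by rewrite ltNge; apply/negP => h; apply: hx; exists k.
Qed.

End cells.
End transport.

Section radius.
Context {R : realType} {n L : nat}.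
Local Notation S := (sphere R n.+2).
Local Notation sigma := (sphere_prob R n.+1).
Variables (p : R) (w : 'I_L -> S) (T : S -> option S).
Hypotheses (p1 : 1 < p) (L0 : (0 < L)%N).
Implicit Types (x y z : S).

Definition transport_cost x : R := if T x is Some y then sphere_dist x y `^ p else 0.

Lemma transport_cost_ge0 x : 0 <= transport_cost x.
Proof. by rewrite /transport_cost; case: (T x) => // y; exact: powR_ge0. Qed.

Variable lam : 'I_L -> R.
Hypothesis TE : forall x y, T x = Some y <-> exists2 l, w l = y & strict_cell p w lam l x.

Lemma strict_cell_inj l k x : strict_cell p w lam l x -> strict_cell p w lam k x -> l = k.
Proof.
move=> hl hk; apply/eqP/negPn/negP => lk.
have kl : k != l by rewrite eq_sym.
by have := lt_trans (hl _ kl) (hk _ lk); rewrite ltxx.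
Qed.

(** Measurability of the cost is read off from this finite sum of continuous functions cut off to
    open cells. *)
Lemma transport_costE x :
  transport_cost x = \sum_(l < L) sphere_dist x (w l) `^ p * \1_(strict_cell p w lam l) x.
Proof.
rewrite /transport_cost; case Tx : (T x) => [y|].
  have [l wl hl] := (TE x y).1 Tx.
  rewrite (bigD1 l)//= big1 ?addr0 => [|k kl]; first by rewrite indicE mem_set// mulr1 wl.
  rewrite indicE memNset ?mulr0// => hk; move: kl; rewrite (strict_cell_inj hl hk).
  by rewrite eqxx.
rewrite big1// => l _; rewrite indicE memNset ?mulr0// => hl.
have : T x = Some (w l) by apply/TE; exists l.
by rewrite Tx.
Qed.

Lemma measurable_transport_cost : measurable_fun setT transport_cost.
Proof.
rewrite (_ : transport_cost = fun x => \sum_(l < L) sphere_dist x (w l) `^ p *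
    \1_(strict_cell p w lam l) x); last by apply/funext => x; exact: transport_costE.
apply: measurable_sum => l; apply: measurable_funM.
  by apply: sphere_continuous_measurable; apply: continuous_sphere_dist_powR; exact: ltW.
by apply: measurable_indic; apply: open_measurable_sphere; exact: open_strict_cell.
Qed.

(** Let x' lie in cell k. Adding the optimality of l at x to that of k at x' eliminates lam: d(x,
    w_l)^p + d(x', w_k)^p <= d(x, w_k)^p + d(x', w_l)^p. By the triangle inequality through x' this
    is the hypothesis of [displacement_lower_bound], with t = d(x', w_k) and A, B the distances from
    x' to x and w_l. *)
Lemma transport_displacement l x : closure (strict_cell p w lam l) x ->
  0 < sphere_dist x (w l) ->
  exists z, forall x' y', T x' = Some y' ->
    cos (ball_ratio p * sphere_dist x (w l)) <= dot (sphere_point x') (sphere_point z) ->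
    displacement_ratio p * sphere_dist x (w l) <= sphere_dist x' y'.
Proof.
move=> hx r0; have [z hz] := sphere_midpoint x (w l); exists z => x' y' /TE [k <- hk] hs.
have [h1 h2] := hz x'; have /andP[_ rpi] := sphere_dist_itv x (w l).
have b0 := ball_ratio_gt0 p1; have b4 := ball_ratio_le p.
apply: (@displacement_lower_bound R p (sphere_dist x (w l)) (sphere_dist x' z) (sphere_dist x' (w k))
  (sphere_dist x' x) (sphere_dist x' (w l)) p1 r0 rpi) => //; try exact: sphere_dist_ge0;
  try exact: sphere_dist_itv.
  rewrite leNgt -ltr_cos ?in_itv/= ?sphere_dist_itv// -?leNgt ?cos_sphere_dist//.
  by apply/andP; split; [rewrite mulr_ge0// ltW|nra].
have c1 := closure_strict_cell p1 k hx.
have c2 : sphere_dist x' (w k) `^ p + lam k <= sphere_dist x' (w l) `^ p + lam l.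
  have [->|lk] := eqVneq l k; first by [].
  exact: ltW (hk _ lk).
have c3 : sphere_dist x (w k) `^ p <= (sphere_dist x' x + sphere_dist x' (w k)) `^ p.
  have p0 : 0 <= p := ltW (lt_trans ltr01 p1).
  rewrite ge0_ler_powR// ?nnegrE ?addr_ge0 ?sphere_dist_ge0//.
  by rewrite (sphere_distC x'); exact: sphere_dist_triangle.
lra.
Qed.

Hypothesis domT : sigma (\bigcup_l strict_cell p w lam l) = 1%E.

Lemma transport_cost_lower_bound l x : closure (strict_cell p w lam l) x ->
  let r := sphere_dist x (w l) in 0 < r ->
  (((displacement_ratio p * r) `^ p * (ball_ratio p * r * sin (ball_ratio p * r) ^+ n /
    (n.+1%:R * sin_integral n)))%:E <= \int[sigma]_x (transport_cost x)%:E)%E.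
Proof.
move=> hx r r0; have [z hz] := transport_displacement hx r0.
have b0 := ball_ratio_gt0 p1; have b4 := ball_ratio_le p.
have t0 := displacement_ratio_gt0 p1.
have /andP[_ rpi] := sphere_dist_itv x (w l).
have br0 : 0 < ball_ratio p * r by rewrite mulr_gt0.
have brpi : ball_ratio p * r <= pi.
  apply: le_trans rpi; rewrite -/r -[leRHS]mul1r ler_wpM2r// ?(ltW r0)//.
  by apply: le_trans b4 _; rewrite invf_le1// ler1n.
set B := cap z (cos (ball_ratio p * r)).
set U := \bigcup_l strict_cell p w lam l.
have mB : measurable B by exact: measurable_sphere_cap.
have mU : measurable U.
  by apply: open_measurable_sphere; apply: bigcup_open => l' _; exact: open_strict_cell.
(* T is defined almost everywhere, so the part of the cap outside the open cells is null. *)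
have BU : sigma (B `&` U) = sigma B.
  apply/eqP; rewrite eq_le; apply/andP; split.
    by apply: le_measure; rewrite ?inE//; exact: measurableI.
  have U0 : sigma (~` U) = 0%E by rewrite probability_setC// domT subee.
  apply: (@le_trans _ _ (sigma ((B `&` U) `|` ~` U))).
    apply: le_measure; rewrite ?inE//.
      by apply: measurableU; [exact: measurableI|exact: measurableC].
    by move=> y By; have [Uy|Uy] := pselect (U y); [left|right].
  apply: le_trans (measureU2 _ (measurableI _ _ mB mU) (measurableC mU)) _.
  by rewrite -[leRHS]adde0; apply: leeD => //; rewrite le_eqVlt; apply/orP; left; apply/eqP.
apply: (@le_trans _ _ (((displacement_ratio p * r) `^ p)%:E * sigma (B `&` U))%E).
  rewrite BU EFinM lee_wpmul2l ?lee_fin ?powR_ge0//.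
  rewrite -(fineK (sphere_prob_fin mB)) lee_fin ler_pdivrMr; last first.
    by rewrite mulr_gt0// sin_integral_gt0.
  have := cap_lower_bound z br0 brpi; rewrite ler_pdivrMr// -/B.
  move: (fine _) => s /le_trans; apply; rewrite le_eqVlt; apply/orP; left; apply/eqP.
  by ring.
rewrite -integral_cst; last exact: measurableI.
rewrite integral_mkcond; apply: ge0_le_integral => //.
- by move=> y _; rewrite patchE; case: ifP => // _; rewrite lee_fin powR_ge0.
- by apply/(measurable_restrictT _ (measurableI _ _ mB mU)); exact: measurable_cst.
- by apply/measurable_EFinP; exact: measurable_transport_cost.
move=> y _; rewrite patchE; case: ifPn => [|_]; last by rewrite lee_fin transport_cost_ge0.
rewrite inE => -[By [k _ hk]].
have Ty : T y = Some (w k) by apply/TE; exists k.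
rewrite /= lee_fin /transport_cost Ty; have p0 : 0 <= p := ltW (lt_trans ltr01 p1).
rewrite ge0_ler_powR// ?nnegrE ?sphere_dist_ge0//.
  by rewrite mulr_ge0// ltW.
by apply: hz Ty _; exact: ltW By.
Qed.

Lemma transport_cost_lty : (\int[sigma]_x (transport_cost x)%:E < +oo)%E.
Proof.
apply: (@le_lt_trans _ _ (\int[sigma]_x (cst (pi `^ p)%:E) x)%E); last first.
  rewrite integral_cst//; apply: (@le_lt_trans _ _ ((pi `^ p)%:E * 1)%E); last by rewrite mule1 ltry.
  by apply: lee_wpmul2l; [rewrite lee_fin powR_ge0|exact: (probability_le1 sigma measurableT)].
apply: ge0_le_integral => //.
- by move=> x _; rewrite lee_fin transport_cost_ge0.
- by apply/measurable_EFinP; exact: measurable_transport_cost.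
move=> x _; rewrite lee_fin /transport_cost; case: (T x) => [y|]; last exact: powR_ge0.
have /andP[d0 dpi] := sphere_dist_itv x y; have p0 : 0 <= p := ltW (lt_trans ltr01 p1).
by rewrite ge0_ler_powR// ?nnegrE// pi_ge0.
Qed.

Lemma cell_radius_bound l x : closure (strict_cell p w lam l) x ->
  sphere_dist x (w l) <= alpha_const n.+2 p / 2 *
    fine (\int[sigma]_x (transport_cost x)%:E) `^ (n.+2%:R - 1 + p)^-1.
Proof.
move=> hx; set W := fine _; set r := sphere_dist x (w l).
have pi0 := @pi_gt0 R.
have a0 := a_const_gt0 p1; have a4 := a_const_lt4 p1.
have h0 : 0 < sphere_area R n.+1 := sphere_area_gt0.
have NE : n.+2%:R - 1 + p = n.+1%:R + p :> R by rewrite -natr1; ring.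
have n1 : n.+2%:R - 1 = n.+1%:R :> R by rewrite -natr1; ring.
rewrite /alpha_const n1 /=; set a := a_const p in a0 a4 *.
have s0 : 0 < sin (a * pi).
  by rewrite sin_gt0_pi// mulr_gt0//=; nra.
set c := _ / _ * _ ^+ n; set N := n.+1%:R + p.
have c0 : 0 < c by rewrite mulr_gt0// ?divr_gt0// exprn_gt0// divr_gt0// mulr_gt0.
have p0 : 0 < p := lt_trans ltr01 p1.
have N0 : 0 < N by rewrite addr_gt0.
have r_ge0 : 0 <= r := sphere_dist_ge0 x (w l).
have /andP[_ rpi] := sphere_dist_itv x (w l).
have W0 : 0 <= W.
  by rewrite fine_ge0// integral_ge0// => y _; rewrite lee_fin transport_cost_ge0.
have Wfin : (\int[sigma]_x (transport_cost x)%:E)%E \is a fin_num.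
  rewrite ge0_fin_numE ?transport_cost_lty// integral_ge0// => y _.
  by rewrite lee_fin transport_cost_ge0.
(* As c is the expression in braces in alpha, the claim is this inequality solved for r. The
   exponent N adds p from the cost, 1 from the radius of the ball and n from the power of its
   sine. *)
have key : (a * r) `^ N * c <= W.
  move: r_ge0; rewrite le_eqVlt => /predU1P[<-|r0].
    by rewrite mulr0 powR0 ?gt_eqF// mul0r.
  have := transport_cost_lower_bound hx r0; rewrite -(fineK Wfin) lee_fin -/W -/r => hW.
  apply: le_trans hW.
  have I0 := sin_integral_gt0 (R := R) n.
  have b0 := ball_ratio_gt0 p1; have t0 := displacement_ratio_gt0 p1.
  have K0 : 0 <= sphere_area R n.+1 * sin_integral n by rewrite mulr_ge0// ltW.
  have := constant_ineq p1 (ltW r0) rpi K0 (sphere_area_sin_integral_le R n).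
  have a_ge0 := ltW a0; have rr := ltW r0.
  rewrite -/a -/r (powRM p (ltW t0) rr) => hc.
  have -> : (a * r) `^ N = a `^ (p + 1) * (r `^ p * r) * (a * r) ^+ n.
    have -> : N = n%:R + (p + 1) by rewrite /N -natr1; ring.
    rewrite [in LHS]powRD; last by rewrite (gt_eqF (mulr_gt0 a0 r0)) implybT.
    have a0' := ltW a0; have r0' := ltW r0.
    rewrite powR_mulrn; last exact: mulr_ge0.
    rewrite mulrC powRM//; congr (_ * _ * _).
    rewrite powRD; first by rewrite powRr1.
    by rewrite (gt_eqF r0) implybT.
  have rp0 : 0 < r `^ p by exact: powR_gt0.
  have -> : (displacement_ratio p `^ p * r `^ p) * (ball_ratio p * r *
     sin (ball_ratio p * r) ^+ n / (n.+1%:R * sin_integral n)) =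
     (r `^ p * r / (n.+1%:R * sin_integral n)) *
     (displacement_ratio p `^ p * ball_ratio p * sin (ball_ratio p * r) ^+ n) by ring.
  have f0 : 0 <= r `^ p * r / (n.+1%:R * sin_integral n).
    by apply: divr_ge0; apply: mulr_ge0 => //; exact: ltW.
  apply: le_trans (ler_wpM2l f0 hc).
  have -> : r * sin (a * pi) / pi = (a * r) * (sin (a * pi) / (a * pi)).
    have gen (u s q b : R) : q != 0 -> b != 0 -> u * s / q = b * u * (s / (b * q)).
      by move=> q0 b0'; field; apply/andP.
    by apply: gen; rewrite gt_eqF.
  rewrite le_eqVlt; apply/orP; left; apply/eqP; rewrite [in RHS]exprMn /c.
  move: ((a * r) ^+ n) ((sin (a * pi) / (a * pi)) ^+ n) => u v.
  have n10 : n.+1%:R != 0 :> R by rewrite pnatr_eq0.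
  have I1 : sin_integral n != 0 :> R by rewrite gt_eqF.
  move: (a `^ (p + 1)) (r `^ p) (sphere_area R n.+1) (sin_integral n) (n.+1%:R : R) n10 I1.
  by move=> A B C I N' n10 I1; field; apply/andP.
have h : a * r <= c `^ (- N^-1) * W `^ N^-1.
  have -> : a * r = ((a * r) `^ N) `^ N^-1.
    by rewrite -powRrM divff ?gt_eqF// powRr1// mulr_ge0// ltW.
  have -> : c `^ (- N^-1) = (c^-1) `^ N^-1.
    by rewrite -[in RHS](powR_inv1 (ltW c0)) -powRrM mulN1r.
  rewrite -powRM ?invr_ge0 ?(ltW c0)// ge0_ler_powR ?invr_ge0 ?(ltW N0)// ?nnegrE ?powR_ge0//.
    by rewrite mulr_ge0// invr_ge0 ltW.
  by rewrite ler_pdivlMl// mulrC.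
have -> : 2 / a * c `^ (- N^-1) / 2 * W `^ N^-1 = a^-1 * (c `^ (- N^-1) * W `^ N^-1).
  by field; rewrite gt_eqF.
by rewrite ler_pdivlMl.
Qed.

End radius.

(** * Couplings and slices *)

Section same_cell_coupling.
Local Open Scope ereal_scope.
Context {R : realType} {d1 d2 d3 : measure_display} {X : measurableType d1}
  {Y : measurableType d2} {Z : measurableType d3}.
Variables (mu : probability X R) (gamma : probability (Y * Z)%type R) (f : {mfun X >-> Y}).
Hypothesis gamma1 : forall A, measurable A -> gamma (A `*` setT) = mu (f @^-1` A).
Variable I : (set Y)^nat.
Hypotheses (mI : forall j, measurable (I j)) (tI : trivIset setT I)
  (cI : \bigcup_j I j = setT).

Let A j := f @^-1` I j.
Let B j : set (Y * Z)%type := I j `*` setT.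
Let C j : set (X * (Y * Z))%type := A j `*` B j.

Let mA j : measurable (A j).
Proof. by rewrite -[A j]setTI; exact: measurable_funPT. Qed.

Let mB j : measurable (B j). Proof. exact: measurableX. Qed.

Let mC j : measurable (C j). Proof. exact: measurableX. Qed.

Let tA : trivIset setT A. Proof. by move=> i j _ _ [x [xi xj]]; apply: tI => //; exists (f x). Qed.

Let tB : trivIset setT B.
Proof.
move=> i j _ _ [[y z] [[/= yi _] [yj _]]]; apply: tI => //.
by exists y.
Qed.

Let cA : \bigcup_j A j = setT.
Proof. by rewrite -preimage_bigcup cI. Qed.

Let cB : \bigcup_j B j = setT.
Proof.
apply/seteqP; split => // -[y z] _; have : setT y by [].
by rewrite -cI => -[j _ Ij]; exists j.
Qed.

Let weight_ge0 j : (0 <= (fine (mu (A j)))^-1)%R.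
Proof. by rewrite invr_ge0 fine_ge0. Qed.

(** The product measure restricted to C j and divided by the common mass of A j and B j, which gives
    the right marginals on the cell. If that mass is 0, so is its inverse, and the piece vanishes as
    it should. *)
Let piece j := mscale (NngNum (weight_ge0 j)) (mrestr (mu \x gamma) (mC j)).
Let total := mseries piece 0.

Let gammaB j : gamma (B j) = mu (A j). Proof. exact: gamma1. Qed.

Let pieceE j E F : measurable E -> measurable F ->
  piece j (E `*` F) = ((fine (mu (A j)))^-1)%R%:E * (mu (E `&` A j) * gamma (F `&` B j)).
Proof.
move=> mE mF; rewrite /piece /mscale/= /mrestr; congr (_ * _).
rewrite -product_measure1E; [|exact: measurableI|exact: measurableI].
by congr (_ _); apply/seteqP; split => -[x yz] /= [[? ?] [? ?]].
Qed.

Let muA_fin j : mu (A j) \is a fin_num. Proof. exact: fin_num_measure. Qed.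

Let cancel_weight j (m : \bar R) : 0 <= m -> m <= mu (A j) ->
  ((fine (mu (A j)))^-1)%R%:E * (m * mu (A j)) = m.
Proof.
move=> m0 mA'; have [A0|A0] := eqVneq (mu (A j)) 0.
  by rewrite A0 mule0 mule0; apply/eqP; rewrite eq_le m0 -A0.
rewrite muleCA -[X in _ * (_ * X)](fineK (muA_fin j)) -EFinM mulVf ?mule1//.
by rewrite fine_eq0.
Qed.

Let total1 E : measurable E -> total (E `*` setT) = mu E.
Proof.
move=> mE; rewrite /total /mseries.
transitivity (\sum_(0 <= j <oo) mu (E `&` A j)).
  apply: eq_eseriesr => j _; rewrite [LHS](pieceE j mE measurableT) setTI gammaB cancel_weight//.
  by apply: le_measure; rewrite ?inE//; exact: measurableI.
rewrite -measure_semi_bigcup.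
- by rewrite -setI_bigcupr cA setIT.
- by move=> j; exact: measurableI.
- exact: trivIset_setIl.
- by rewrite -setI_bigcupr cA setIT.
Qed.

Let total2 F : measurable F -> total (setT `*` F) = gamma F.
Proof.
move=> mF; rewrite /total /mseries.
transitivity (\sum_(0 <= j <oo) gamma (F `&` B j)).
  apply: eq_eseriesr => j _; rewrite [LHS](pieceE j measurableT mF) setTI muleA muleAC -muleA cancel_weight//.
  by rewrite -gammaB; apply: le_measure; rewrite ?inE//; exact: measurableI.
rewrite -measure_semi_bigcup.
- by rewrite -setI_bigcupr cB setIT.
- by move=> j; exact: measurableI.
- exact: trivIset_setIl.
- by rewrite -setI_bigcupr cB setIT.
Qed.

(* Given the cell, the two coordinates of Q are independent, so that no
   disintegration of gamma is needed. *)
Lemma exists_same_cell_coupling : exists Q : probability (X * (Y * Z))%type R,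
  [/\ forall E, measurable E -> Q (E `*` setT) = mu E,
      forall F, measurable F -> Q (setT `*` F) = gamma F &
      Q (~` \bigcup_j ((f @^-1` I j) `*` (I j `*` setT))) = 0].
Proof.
have totalT : total setT = 1 by rewrite -setXTT total1// probability_setT.
(* The mass is already 1; the normalization only packages [total] as a probability. *)
exists (mnormalize total \d_(point, (point, point))).
have QE E : mnormalize total \d_(point, (point, point)) E = total E.
  rewrite /mnormalize; case: ifPn => [/orP[]/eqP|_].
  - by rewrite [LHS]totalT => /eqP; rewrite onee_eq0.
  - by rewrite [LHS]totalT.
  - by rewrite [X in fine X]totalT invr1 mule1.
split=> [E mE|F mF|].
- exact: etrans (QE _) (total1 mE).
- exact: etrans (QE _) (total2 mF).
apply: etrans (QE _) _; apply: eseries0 => j _ _; set N := ~` _.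
have NC : N `&` C j = set0 by apply/seteqP; split => // z [/= nz Cz]; apply: nz; exists j.
change (((fine (mu (A j)))^-1)%R%:E * (mu \x gamma) (N `&` C j) = 0).
by rewrite NC measure0 mule0.
Qed.

End same_cell_coupling.

Section laws.
Local Open Scope ereal_scope.
Context {R : realType} {d1 d2 : measure_display} {W : measurableType d1} {E : measurableType d2}.

Lemma integral_law (P : {measure set W -> \bar R}) (nu : {measure set E -> \bar R})
    (X : {mfun W >-> E}) (g : E -> \bar R) :
  measurable_fun setT g -> (forall y, 0 <= g y) ->
  (forall A, measurable A -> P (X @^-1` A) = nu A) ->
  \int[P]_z g (X z) = \int[nu]_y g y.
Proof.
move=> mg g0 PX; transitivity (\int[pushforward P X]_y g y).
  by rewrite ge0_integral_pushforward.
by apply: eq_measure_integral => A mA _; exact: PX.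
Qed.

End laws.

Section partition.
Context {R : realType}.

Lemma real_partition (h : R) : 0 < h -> exists I : (set R)^nat,
  [/\ forall j, measurable (I j), trivIset setT I, \bigcup_j I j = setT &
      forall j s t, I j s -> I j t -> `|s - t| <= h].
Proof.
move=> h0; pose q j : R := ratr (odflt 0%Q (unpickle j)).
pose F j : set R := [set s | `|s - q j| < h / 2].
have mF j : measurable (F j).
  apply: open_measurable.
  rewrite (_ : F j = ball (q j) (h / 2)); first exact: ball_open.
  by apply/seteqP; split => s; rewrite /F /ball /= distrC.
exists (seqDU F); split.
- exact: seqDU_measurable.
- exact: trivIset_seqDU.
- rewrite -seqDU_bigcup_eq; apply/seteqP; split => // s _.
  have /rat_in_itvoo [x] : s - h / 2 < s + h / 2 by lra.
  rewrite in_itv/= => /andP[x1 x2]; exists (pickle x) => //.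
  rewrite /F /q /= pickleK /= ltr_norml; apply/andP; split; lra.
move=> j s t /(@subset_seqDU _ F j) sj /(@subset_seqDU _ F j) tj; move: sj tj.
rewrite /F /= => sj tj.
by apply: le_trans (ler_distD (q j) _ _) _; rewrite (distrC (q j)); lra.
Qed.

End partition.

Section slices.
Context {R : realType} {n : nat}.
Local Notation X := 'rV[R]_n.
Local Notation RR := (Real.sort R).
Variable p : R.
Hypothesis p1 : 1 <= p.

Definition Lp_norm {d} {W : measurableType d} (P : {measure set W -> \bar R}) (F : W -> R) : \bar R :=
  ((\int[P]_z (`|F z| `^ p)%:E) `^ p^-1)%E.

Lemma Lp_normE {d} {W : measurableType d} (P : {measure set W -> \bar R}) (F : W -> R) :
  Lp_norm P F = ('N[P]_p%:E [EFin \o F])%E.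
Proof. by rewrite unlock. Qed.

Lemma Lp_normD {d} {W : measurableType d} (P : {measure set W -> \bar R}) (F G : W -> R) :
  measurable_fun setT F -> measurable_fun setT G ->
  (Lp_norm P (fun z => F z + G z)%R <= Lp_norm P F + Lp_norm P G)%E.
Proof.
move=> mF mG; rewrite !Lp_normE; apply: eminkowski => //.
Qed.

Lemma measurable_norm_powR {d} {W : measurableType d} (F : W -> R) : measurable_fun setT F ->
  measurable_fun setT (fun z => (`|F z| `^ p)%:E).
Proof.
move=> mF; apply/measurable_EFinP.
apply: (measurableT_comp (measurable_powR _)) => //; exact: measurableT_comp.
Qed.

(** The law of (U, V) is a coupling, so that couplings can be handled as random variables on any
    probability space. *)
Lemma MK_le_Lp_norm {d} {W : measurableType d} (P : probability W R) (U V : {mfun W >-> RR})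
    (nu1 nu2 : probability RR R) :
  (forall A, measurable A -> P (U @^-1` A) = nu1 A) ->
  (forall A, measurable A -> P (V @^-1` A) = nu2 A) ->
  (MK rdist p nu1 nu2 <= Lp_norm P (fun z => U z - V z)%R)%E.
Proof.
move=> PU PV.
have mUV : measurable_fun setT (fun z => (U z, V z)).
  by apply/measurable_fun_pairP; split; exact: measurable_funPT.
pose UV : {mfun W >-> (RR * RR)%type} := HB.pack (fun z => (U z, V z)) (isMeasurableFun.Build _ _ _ _ _ mUV).
apply: ereal_inf_lbound; exists (distribution P UV).
  move=> A mA; split; [apply: etrans (PU _ mA)|apply: etrans (PV _ mA)];
    by rewrite /distribution /pushforward; congr (P _); apply/seteqP; split => z //= [].
congr (_ `^ _)%E; rewrite ge0_integral_distribution//.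
- apply/measurable_EFinP; apply: (measurableT_comp (measurable_powR _)) => //.
  apply: measurableT_comp => //; apply: measurable_funB; [exact: measurable_fst|exact: measurable_snd].
- by move=> y; rewrite lee_fin powR_ge0.
Qed.

Lemma Lp_norm_law {d1 d2} {W : measurableType d1} {E : measurableType d2}
    (P : {measure set W -> \bar R}) (nu : {measure set E -> \bar R})
    (U : {mfun W >-> E}) (F : E -> R) : measurable_fun setT F ->
  (forall A, measurable A -> P (U @^-1` A) = nu A) ->
  Lp_norm P (fun z => F (U z)) = Lp_norm nu F.
Proof.
move=> mF PU; congr (_ `^ _)%E; by rewrite -(integral_law (measurable_norm_powR mF) _ PU).
Qed.

Lemma Lp_norm_ae_le {d} {W : measurableType d} (P : {measure set W -> \bar R}) (F G : W -> R)
    (N : set W) :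
  measurable_fun setT F -> measurable_fun setT G -> measurable N -> P N = 0%E ->
  (forall z, ~ N z -> `|F z| <= `|G z|) -> (Lp_norm P F <= Lp_norm P G)%E.
Proof.
move=> mF mG mN PN FG.
have p0 : 0 < p := lt_le_trans ltr01 p1.
have I0 (H : W -> R) : (\int[P]_z (`|H z| `^ p)%:E)%E \in `[0%E, +oo%E].
  by rewrite in_itv/= leey andbT; apply: integral_ge0 => z _; rewrite lee_fin powR_ge0.
have p0' : 0 <= p^-1 by rewrite invr_ge0 ltW.
apply: (@gt0_ler_poweR R p^-1 p0' _ _ (I0 F) (I0 G)).
apply: ae_ge0_le_integral => //; try exact: measurable_norm_powR.
exists N; split => // z /= nz; apply: contrapT => Nz; apply: nz => _.
by rewrite lee_fin ge0_ler_powR ?(ltW p0)// ?nnegrE// FG.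
Qed.

Lemma Lp_normZ {d} {W : measurableType d} (P : {measure set W -> \bar R}) (F : W -> R) (c : R) :
  0 <= c -> measurable_fun setT F ->
  Lp_norm P (fun z => c * F z) = (c%:E * Lp_norm P F)%E.
Proof.
move=> c0 mF; have p0 : 0 < p := lt_le_trans ltr01 p1.
have I0 : (0 <= \int[P]_z (`|F z| `^ p)%:E)%E.
  by apply: integral_ge0 => z _; rewrite lee_fin powR_ge0.
rewrite /Lp_norm.
have -> : (\int[P]_z (`|c * F z| `^ p)%:E = (c `^ p)%:E * \int[P]_z (`|F z| `^ p)%:E)%E.
  rewrite -ge0_integralZl//; last 2 first.
  - exact: measurable_norm_powR.
  - by rewrite lee_fin powR_ge0.
  by apply: eq_integral => z _; rewrite normrM (ger0_norm c0) powRM.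
rewrite poweRM// ?lee_fin ?powR_ge0// poweR_EFin -powRrM divff ?gt_eqF//.
by rewrite powRr1.
Qed.

Lemma Lp_norm_cst {d} {W : measurableType d} (P : probability W R) (c : R) :
  0 <= c -> Lp_norm P (cst c) = c%:E.
Proof.
move=> c0; have p0 : 0 < p := lt_le_trans ltr01 p1; rewrite /Lp_norm.
have -> : (\int[P]_z (`|cst c z| `^ p)%:E = (c `^ p)%:E)%E.
  transitivity (\int[P]_z (cst (c `^ p)%:E z))%E.
    by apply: eq_integral => z _; rewrite /= ger0_norm.
  apply: etrans (integral_cst P measurableT _) _.
  by rewrite [X in (_ * X)%E]probability_setT mule1.
by rewrite poweR_EFin -powRrM divff ?gt_eqF// powRr1.
Qed.

Lemma measurable_enorm : measurable_fun setT (@enorm R n).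
Proof.
have cE : continuous (fun x : X => dot x x).
  apply: continuous_big => [|i _]; first exact: add_continuous.
  move=> x; have cx := @coord_continuous R 1 n 0 i x.
  exact: (@cvgM _ _ (nbhs x) (@nbhs_filter X x) _ _ _ _ cx cx).
apply: (measurableT_comp (f := @Num.sqrt R)).
  by apply: continuous_measurable_fun; exact: sqrt_continuous.
move/continuousP: cE => cE.
apply: (measurability _ (measurable_realfun.RGenOpens.measurableE R)) => _ [_ [a [b ->] <-]].
rewrite setTI; apply: sub_sigma_algebra; apply: cE.
exact: interval_open.
Qed.

Lemma Lp_norm_enorm (mu : probability X R) : Lp_norm mu (@enorm R n) = (moment p mu `^ p^-1)%E.
Proof.
congr (_ `^ _)%E; apply: eq_integral => x _.
by rewrite ger0_norm// enorm_ge0.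
Qed.

End slices.

Definition to_mfun {d1 d2} {W : measurableType d1} {E : measurableType d2} (f : W -> E)
  (mf : measurable_fun setT f) : {mfun W >-> E} :=
  HB.pack f (isMeasurableFun.Build _ _ _ _ f mf).

Section slices.
Context {R : realType} {n : nat}.
Local Notation X := 'rV[R]_n.
Variables (p : R) (mu1 mu2 : probability X R).
Hypothesis p1 : 1 <= p.
Implicit Types w : sphere R n.

Lemma Lp_norm_slice_le (mu : probability X R) w :
  (Lp_norm p mu (slice_map w) <= moment p mu `^ p^-1)%E.
Proof.
rewrite -Lp_norm_enorm; apply: (Lp_norm_ae_le p1 (N := set0)) => //.
- exact: measurable_enorm.
move=> x _; rewrite [leRHS]ger0_norm ?enorm_ge0//.
by apply: le_trans (norm_dot_le _ _) _; rewrite enorm_sphere mulr1.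
Qed.

Lemma Lp_norm_sliceB_le (mu : probability X R) w w' :
  (Lp_norm p mu (fun x => slice_map w x - slice_map w' x)%R <=
   (chord w w')%:E * moment p mu `^ p^-1)%E.
Proof.
have c0 : 0 <= chord w w' := enorm_ge0 _.
rewrite -Lp_norm_enorm -Lp_normZ//; last exact: measurable_enorm.
apply: (Lp_norm_ae_le p1 (N := set0)) => //.
- exact: measurable_funB.
- by apply: measurable_funM => //; exact: measurable_enorm.
move=> x _; rewrite /slice_map -dotBr [leRHS]ger0_norm ?mulr_ge0 ?enorm_ge0//.
by apply: le_trans (norm_dot_le _ _) _; rewrite mulrC.
Qed.

(** Obtained from the independent coupling of mu1 and mu2. It makes the slice distances finite and
    bounded in w when the moments are finite. *)
Lemma sliceMK_le w : (sliceMK p mu1 mu2 w <=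
  moment p mu1 `^ p^-1 + moment p mu2 `^ p^-1)%E.
Proof.
have mU : measurable_fun setT (fun z : X * X => slice_map w z.1).
  by apply: (measurableT_comp (f := slice_map w)); [exact: measurable_slice_map|exact: measurable_fst].
have mV : measurable_fun setT (fun z : X * X => slice_map w z.2).
  by apply: (measurableT_comp (f := slice_map w)); [exact: measurable_slice_map|exact: measurable_snd].
have fstE (A : set X) : measurable A -> (mu1 \x mu2)%E (fst @^-1` A) = mu1 A.
  move=> mA; rewrite -setXT product_measure1E//.
  by rewrite -[RHS]mule1; congr (_ * _)%E; exact: probability_setT.
have sndE (A : set X) : measurable A -> (mu1 \x mu2)%E (snd @^-1` A) = mu2 A.
  move=> mA; rewrite -setTX product_measure1E//.
  by rewrite -[RHS]mul1e; congr (_ * _)%E; exact: probability_setT.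
have mS (A : set R) : measurable A -> measurable (slice_map w @^-1` A).
  by move=> mA; rewrite -[X in measurable X]setTI; exact: measurable_slice_map.
apply: le_trans (@MK_le_Lp_norm R p _ _ (mu1 \x mu2)%E (to_mfun mU) (to_mfun mV) _ _ _ _) _.
- by move=> A mA; exact: fstE (mS _ mA).
- by move=> A mA; exact: sndE (mS _ mA).
have mV' : measurable_fun setT (fun z : X * X => - slice_map w z.2).
  exact: measurableT_comp.
apply: le_trans (Lp_normD p1 _ mU mV') _.
apply: leeD.
  apply: le_trans (Lp_norm_slice_le mu1 w).
  by rewrite (@Lp_norm_law R p _ _ _ _ (mu1 \x mu2)%E mu1 (to_mfun measurable_fst) (slice_map w)).
apply: le_trans (Lp_norm_slice_le mu2 w).
rewrite -(@Lp_norm_law R p _ _ _ _ (mu1 \x mu2)%E mu2 (to_mfun measurable_snd) (slice_map w))//.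
by apply: (Lp_norm_ae_le p1 (N := set0)) => // z _; rewrite normrN.
Qed.

(** An approximate gluing: f and the first coordinate of gamma have the same law, so both can be
    placed in the same member of a partition of the line into sets of diameter at most h. *)
Lemma exists_close_coupling {d1 d3} {W : measurableType d1} {Z : measurableType d3}
    (mu : probability W R) (gamma : probability (R * Z)%type R) (f : {mfun W >-> R}) (h : R) :
  (forall A, measurable A -> gamma (A `*` setT) = mu (f @^-1` A)) -> 0 < h ->
  exists Q : probability (W * (R * Z))%type R,
  [/\ forall E, measurable E -> Q (E `*` setT) = mu E,
      forall F, measurable F -> Q (setT `*` F) = gamma F &
      exists N, [/\ measurable N, Q N = 0%E &
        forall z, ~ N z -> `|f z.1 - z.2.1| <= h]].
Proof.
move=> gf h0; have [I [mI tI cI dI]] := real_partition h0.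
have [Q [Q1 Q2 Q0]] := exists_same_cell_coupling gf mI tI cI.
exists Q; split => //; exists (~` \bigcup_j ((f @^-1` I j) `*` (I j `*` setT))); split => //.
  apply: measurableC; apply: bigcup_measurable => j _; apply: measurableX.
    by rewrite -[X in measurable X]setTI; exact: measurable_funPT.
  exact: measurableX.
by move=> z /contrapT [j _ [/= fz [sz _]]]; exact: dI fz sz.
Qed.

(** Two gluings put on one space x and y of laws mu1 and mu2 and (s, t) of law gamma, with s and t
    almost surely h-close to the slices of x and y in direction w. The difference of the slices in
    direction w' then splits into s - t, two terms of size at most h, and two terms for the change
    of direction. *)
Lemma sliceMK_coupling_le w w' (gamma : probability (R * R)%type R) (h : R) : 0 < h ->
  couplings (distribution mu1 (slice_map w)) (distribution mu2 (slice_map w)) gamma ->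
  (sliceMK p mu1 mu2 w' <= ((\int[gamma]_z (rdist z.1 z.2 `^ p)%:E) `^ p^-1 +
    (chord w' w)%:E * (moment p mu1 `^ p^-1 + moment p mu2 `^ p^-1)) + (2 * h)%:E)%E.
Proof.
move=> h0 cg; set f := slice_map w; set f' := slice_map w'.
have mf : measurable_fun setT f := measurable_slice_map w.
have mf' : measurable_fun setT f' := measurable_slice_map w'.
have g1 A : measurable A -> gamma (A `*` setT) = mu1 (f @^-1` A) by move=> mA; have [] := cg _ mA.
have g2 A : measurable A -> gamma (setT `*` A) = mu2 (f @^-1` A) by move=> mA; have [] := cg _ mA.
have [Q1 [Q1X Q1g [N1 [mN1 QN1 hN1]]]] := exists_close_coupling (f := slice_map w) g1 h0.
have mS : measurable_fun setT (fun u : X * (R * R) => (u.2.2, (u.1, u.2.1))).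
  apply/measurable_fun_pairP; split.
    exact: (measurableT_comp measurable_snd measurable_snd).
  apply/measurable_fun_pairP; split; first exact: measurable_fst.
  exact: (measurableT_comp measurable_fst measurable_snd).
(* The coordinate t is put first, since it is the one to be glued to the slice of y. *)
pose gamma2 : probability (R * (X * R))%type R := distribution Q1 (to_mfun mS).
have g3 A : measurable A -> gamma2 (A `*` setT) = mu2 (f @^-1` A).
  move=> mA; rewrite -g2// -Q1g; last exact: measurableX.
  by rewrite /gamma2 /distribution /pushforward; congr (Q1 _); apply/seteqP; split => u /=;
    [move=> [? ?]|move=> [_ [_ ?]]].
have [Q2 [Q2X Q2g [N2 [mN2 QN2 hN2]]]] := exists_close_coupling (f := slice_map w) g3 h0.
pose W := (X * (R * (X * R)))%type.
have Q2Q1 (B : set (R * (X * R))) : measurable B ->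
    Q2 (snd @^-1` B) = Q1 ((fun u : X * (R * R) => (u.2.2, (u.1, u.2.1))) @^-1` B).
  by move=> mB; rewrite -setTX Q2g.
have mR : measurable_fun setT (fun v : R * (X * R) => (v.2.1, (v.2.2, v.1))).
  apply/measurable_fun_pairP; split.
    exact: (measurableT_comp measurable_fst measurable_snd).
  apply/measurable_fun_pairP; split; last exact: measurable_fst.
  exact: (measurableT_comp measurable_snd measurable_snd).
have mZ : measurable_fun setT (fun z : W => (z.2.2.1, (z.2.2.2, z.2.1))).
  by apply: (measurableT_comp mR); exact: measurable_snd.
pose Zm := to_mfun mZ.
have Q2Z (B : set (X * (R * R))) : measurable B -> Q2 (Zm @^-1` B) = Q1 B.
  move=> mB; have mRB : measurable ((fun v : R * (X * R) => (v.2.1, (v.2.2, v.1))) @^-1` B).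
    by rewrite -[X in measurable X]setTI; exact: mR.
  apply: etrans (Q2Q1 _ mRB) _; congr (Q1 _).
  by apply/seteqP; split => -[x [s t]].
have mx : measurable_fun setT (fun z : W => z.2.2.1).
  by apply: (measurableT_comp (f := fst) measurable_fst mZ).
have mst : measurable_fun setT (fun z : W => (z.2.2.2, z.2.1)).
  by apply: (measurableT_comp (f := snd) measurable_snd mZ).
have xlaw A : measurable A -> Q2 ((fun z : W => z.2.2.1) @^-1` A) = mu1 A.
  move=> mA; have mAT : measurable (A `*` [set: R * R]) by exact: measurableX.
  apply: etrans (etrans (Q2Z _ mAT) (Q1X _ mA)).
  by congr (Q2 _); apply/seteqP; split => z //= [].
have ylaw A : measurable A -> Q2 ((fun z : W => z.1) @^-1` A) = mu2 A.
  by move=> mA; rewrite -setXT Q2X.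
have stlaw A : measurable A -> Q2 ((fun z : W => (z.2.2.2, z.2.1)) @^-1` A) = gamma A.
  move=> mA; have mAT : measurable ([set: X] `*` A) by exact: measurableX.
  apply: etrans (etrans (Q2Z _ mAT) (Q1g _ mA)).
  by congr (Q2 _); apply/seteqP; split => z //= [].
have mpre (g : X -> R) (A : set R) : measurable_fun setT g -> measurable A -> measurable (g @^-1` A).
  by move=> mg mA; rewrite -[X in measurable X]setTI; exact: mg.
have mU : measurable_fun setT (fun z : W => f' z.2.2.1) by exact: measurableT_comp mf' mx.
have mV : measurable_fun setT (fun z : W => f' z.1).
  by apply: (measurableT_comp mf'); exact: measurable_fst.
apply: le_trans (@MK_le_Lp_norm R p _ _ Q2 (to_mfun mU) (to_mfun mV) _ _ _ _) _.
- by move=> A mA; exact: xlaw (mpre _ _ mf' mA).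
- by move=> A mA; exact: ylaw (mpre _ _ mf' mA).
pose F1 (z : W) := f' z.2.2.1 - f z.2.2.1.
pose F2 (z : W) := f z.2.2.1 - z.2.2.2.
pose F3 (z : W) := z.2.2.2 - z.2.1.
pose F4 (z : W) := z.2.1 - f z.1.
pose F5 (z : W) := f z.1 - f' z.1.
have mfx : measurable_fun setT (fun z : W => f z.2.2.1) by exact: measurableT_comp mf mx.
have mfy : measurable_fun setT (fun z : W => f z.1).
  by apply: (measurableT_comp mf); exact: measurable_fst.
have ms : measurable_fun setT (fun z : W => z.2.2.2).
  by apply: (measurableT_comp (f := fst) measurable_fst mst).
have mt : measurable_fun setT (fun z : W => z.2.1).
  by apply: (measurableT_comp (f := snd) measurable_snd mst).
have m1 : measurable_fun setT F1 by exact: measurable_funB.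
have m2 : measurable_fun setT F2 by exact: measurable_funB.
have m3 : measurable_fun setT F3 by exact: measurable_funB.
have m4 : measurable_fun setT F4 by exact: measurable_funB.
have m5 : measurable_fun setT F5 by exact: measurable_funB.
have n1 : (Lp_norm p Q2 F1 <= (chord w' w)%:E * moment p mu1 `^ p^-1)%E.
  apply: le_trans (Lp_norm_sliceB_le mu1 w' w).
  have mG : measurable_fun setT (fun x : X => f' x - f x) by exact: measurable_funB.
  by rewrite -(@Lp_norm_law R p _ _ _ _ Q2 mu1 (to_mfun mx) _ mG xlaw).
have n5 : (Lp_norm p Q2 F5 <= (chord w' w)%:E * moment p mu2 `^ p^-1)%E.
  rewrite chordC; apply: le_trans (Lp_norm_sliceB_le mu2 w w').
  have mG : measurable_fun setT (fun x : X => f x - f' x) by exact: measurable_funB.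
  by rewrite -(@Lp_norm_law R p _ _ _ _ Q2 mu2 (to_mfun measurable_fst) _ mG ylaw).
have n2 : (Lp_norm p Q2 F2 <= h%:E)%E.
  rewrite -(Lp_norm_cst p1 Q2 (ltW h0)).
  apply: (Lp_norm_ae_le p1 (N := Zm @^-1` N1)) => //.
  - rewrite -[X in measurable X]setTI; exact (mZ measurableT _ mN1).
  - exact: etrans (Q2Z _ mN1) QN1.
  by move=> z Nz; rewrite [leRHS]ger0_norm ?(ltW h0)//; exact: hN1 Nz.
have n4 : (Lp_norm p Q2 F4 <= h%:E)%E.
  rewrite -(Lp_norm_cst p1 Q2 (ltW h0)).
  apply: (Lp_norm_ae_le p1 (N := N2)) => //.
  by move=> z Nz; rewrite [leRHS]ger0_norm ?(ltW h0)// distrC; exact: hN2 Nz.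
have n3 : Lp_norm p Q2 F3 = ((\int[gamma]_z (rdist z.1 z.2 `^ p)%:E) `^ p^-1)%E.
  have mG : measurable_fun setT (fun v : R * R => v.1 - v.2).
    by apply: measurable_funB; [exact: measurable_fst|exact: measurable_snd].
  rewrite [LHS](@Lp_norm_law R p _ _ _ _ Q2 gamma (to_mfun mst) _ mG stlaw).
  by [].
have -> : (fun z => to_mfun mU z - to_mfun mV z) = (fun z => F1 z + (F2 z + (F3 z + (F4 z + F5 z)))).
  by apply/funext => z; rewrite /F1 /F2 /F3 /F4 /F5 /=; ring.
have m45 : measurable_fun setT (fun z => F4 z + F5 z) by exact: measurable_funD.
have m345 : measurable_fun setT (fun z => F3 z + (F4 z + F5 z)) by exact: measurable_funD.
have m2345 : measurable_fun setT (fun z => F2 z + (F3 z + (F4 z + F5 z))) by exact: measurable_funD.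
apply: le_trans (Lp_normD p1 _ m1 m2345) _.
apply: le_trans (leeD n1 (le_trans (Lp_normD p1 _ m2 m345) (leeD n2 (le_trans (Lp_normD p1 _ m3 m45)
  (leeD (lexx _) (le_trans (Lp_normD p1 _ m4 m5) (leeD n4 n5))))))) _.
rewrite n3 ge0_muleDr ?poweR_ge0//.
have -> : (2 * h)%:E = (h%:E + h%:E)%E by rewrite -EFinD; congr EFin; ring.
have alg (a b c d : \bar R) : (a + (d + (c + (d + b))) = (c + (a + b)) + (d + d))%E.
  by rewrite (addeCA d c) (addeCA a c) -addeA (addeA d d) (addeC (d + d)) (addeA a b).
by rewrite alg.
Qed.

Lemma sliceMK_lip w w' : (moment p mu1 < +oo)%E -> (moment p mu2 < +oo)%E ->
  (sliceMK p mu1 mu2 w' <= sliceMK p mu1 mu2 w +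
    (chord w' w)%:E * (moment p mu1 `^ p^-1 + moment p mu2 `^ p^-1))%E.
Proof.
move=> M1 M2; set c := (_ * _)%E.
have cfin : c \is a fin_num.
  by rewrite fin_numM// fin_numD !ge0_fin_numE ?poweR_ge0// !poweR_lty.
rewrite -leeBlDr//; apply: le_ereal_inf_tmp => _ [gamma cg <-]; rewrite leeBlDr//.
apply/lee_addgt0Pr => e e0; have h0 : 0 < e / 2 by rewrite divr_gt0.
apply: le_trans (sliceMK_coupling_le w' h0 cg) _.
by have -> : 2 * (e / 2) = e by field.
Qed.

End slices.

(** * Comparison of the norms *)

Section Lq.
Context {d : measure_display} {W : measurableType d} {R : realType}.
Variable (P : probability W R).

Lemma Lnorm_bounded (q : \bar R) (F : W -> R) (c : R) : (1 <= q)%E -> 0 <= c ->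
  measurable_fun setT F -> (forall z, `|F z| <= c) -> ('N[P]_q [EFin \o F] <= c%:E)%E.
Proof.
case: q => [q||//]; rewrite ?lee_fin => q1 c0 mF Fc.
  rewrite -Lp_normE -(Lp_norm_cst q1 P c0).
  apply: (Lp_norm_ae_le q1 (N := set0)) => // z _.
  by rewrite [leRHS]ger0_norm.
rewrite unlock; case: ifP => // _; apply/ess_supP; apply: nearW => z.
by rewrite /= lee_fin.
Qed.

Lemma dist_Lnorm_le (q : \bar R) (F G : W -> R) (c : R) (M : R) : (1 <= q)%E -> 0 <= c -> 0 <= M ->
  measurable_fun setT F -> measurable_fun setT G -> (forall z, `|F z| <= M) ->
  (forall z, `|G z - F z| <= c) ->
  (`| 'N[P]_q [EFin \o G] - 'N[P]_q [EFin \o F] | <= c%:E)%E.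
Proof.
move=> q1 c0 M0 mF mG FM GF.
have FL := Lnorm_bounded q1 M0 mF FM.
have GM z : `|G z| <= M + c.
  rewrite -[G z](subrK (F z)) addrC; apply: le_trans (ler_normD _ _) _.
  exact: lerD.
have GL := Lnorm_bounded q1 (addr_ge0 M0 c0) mG GM.
have mGF : measurable_fun setT (fun z => G z - F z) by exact: measurable_funB.
have mFG : measurable_fun setT (fun z => F z - G z) by exact: measurable_funB.
have FG z : `|F z - G z| <= c by rewrite distrC.
have GFL := Lnorm_bounded q1 c0 mGF GF.
have FGL := Lnorm_bounded q1 c0 mFG FG.
have h1 : ('N[P]_q [EFin \o G] <= 'N[P]_q [EFin \o F] + c%:E)%E.
  apply: le_trans (leeD (lexx _) GFL); apply: le_trans (eminkowski P mF mGF q1).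
  by rewrite (_ : EFin \o G = EFin \o (F \+ (fun z => G z - F z))%R)//; apply/funext => z /=; rewrite addrC subrK.
have h2 : ('N[P]_q [EFin \o F] <= 'N[P]_q [EFin \o G] + c%:E)%E.
  apply: le_trans (leeD (lexx _) FGL); apply: le_trans (eminkowski P mG mFG q1).
  by rewrite (_ : EFin \o F = EFin \o (G \+ (fun z => F z - G z))%R)//; apply/funext => z /=; rewrite addrC subrK.
move: h1 h2 FL GL (Lnorm_ge0 P q (EFin \o F)) (Lnorm_ge0 P q (EFin \o G)).
case: ('N[P]_q [EFin \o F])%E => [a||]//; case: ('N[P]_q [EFin \o G])%E => [b||]//.
rewrite -!EFinD !lee_fin => h1 h2 _ _ _ _.
by rewrite /= ?lee_fin ler_norml; apply/andP; split; lra.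
Qed.

End Lq.

(** * Covering by the cells and the final estimate *)

Section main.
Context {R : realType} {n L : nat}.
Local Notation S := (sphere R n.+2).
Local Notation sigma := (sphere_prob R n.+1).
Implicit Types (x y z : S).

(** A nonempty open set contains a cap, which has positive mass. This serves to show that the
    closures of the cells cover the whole sphere and not only almost all of it. *)
Lemma open_null_set0 (U : set S) : open U -> sigma U = 0%E -> U = set0.
Proof.
move=> oU U0; apply/seteqP; split => // x Ux; exfalso.
have [e e0 he] := open_contains_cap oU Ux.
pose rho := Num.min 1 e.
have r0 : 0 < rho by rewrite lt_min ltr01.
have r1 : rho <= 1 by rewrite ge_min lexx.
have re : rho <= e by rewrite ge_min lexx orbT.
have rpi : rho < pi by have := @pi_ge2 R; lra.
have := closed_cap_prob_gt0 x r0 rpi; rewrite half_chord_sqr => hpos.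
suff : (sigma (closed_cap x (1 - cos rho)) <= 0)%E.
  have := measurable_closed_cap x (1 - cos rho) => /sphere_prob_fin /fineK <-.
  by rewrite lee_fin leNgt hpos.
rewrite -U0; apply: le_measure; rewrite ?inE.
- exact: measurable_closed_cap.
- exact: open_measurable_sphere.
move=> y; rewrite /closed_cap /= => hy; apply: he.
have := cos_ge (ltW r0); have r2 : rho ^+ 2 <= rho by rewrite expr2; nra.
by move: hy; lra.
Qed.

Section cells.
Variables (D C : 'I_L -> set S).
Hypothesis DE : forall l, D l = C l `\` \bigcup_(k in [set k : 'I_L | (k < l)%N]) D k.
Hypothesis mC : forall l, measurable (C l).
Hypothesis cC : forall x, exists l, C l x.

Lemma disjointified_sub l : D l `<=` C l.
Proof. by rewrite DE; exact: subDsetl. Qed.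

Lemma measurable_disjointified l : measurable (D l).
Proof.
have [m] := ubnP (l : nat); elim: m l => // m IH l lm; rewrite DE.
apply: measurableD => //; apply: fin_bigcup_measurable; first exact: finite_finset.
by move=> k /= kl; apply: IH; exact: leq_trans kl _.
Qed.

Lemma disjointified_inj l k x : D l x -> D k x -> l = k.
Proof.
have lt_absurd (i j : 'I_L) : (i < j)%N -> D i x -> D j x -> False.
  by move=> ij Di; rewrite DE => -[_]; apply; exists i.
move=> Dl Dk; apply/val_inj; case: (ltngtP l k) => // lk; exfalso.
  exact: lt_absurd lk Dl Dk.
exact: lt_absurd lk Dk Dl.
Qed.

Lemma disjointified_cover x : exists l, D l x.
Proof.
have [l Cl] := cC x; have [m] := ubnP (l : nat); elim: m l Cl => // m IH l Cl lm.
have [[k /= kl Dk]|h] := pselect ((\bigcup_(k in [set k : 'I_L | (k < l)%N]) D k) x).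
  by exists k.
by exists l; rewrite DE.
Qed.

Lemma sum_disjointified (F : 'I_L -> R) l x : D l x -> \sum_(k < L) F k * \1_(D k) x = F l.
Proof.
move=> Dl; rewrite (bigD1 l)//= indicE mem_set// mulr1 big1 ?addr0// => k kl.
rewrite indicE memNset ?mulr0// => Dk; move: kl; rewrite (disjointified_inj Dl Dk).
by rewrite eqxx.
Qed.

End cells.

End main.

Theorem corollary3p2 (R : realType) (n : nat) (p : R) (q : \bar R)
    (L : nat) (w : 'I_L -> sphere R n.+2) (D : 'I_L -> set (sphere R n.+2))
    (mu1 mu2 : probability 'rV[R]_n.+2 R) :
  1 < p -> (1 <= q)%E ->
  (0 < L)%N -> injective w ->
  is_transport_partition p w D ->
  (moment p mu1 < +oo)%E -> (moment p mu2 < +oo)%E ->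
  (`| 'N[sphere_prob R n.+1]_q
        [(fun x => \sum_(l < L) sliceMK p mu1 mu2 (w l) * (\1_(D l) x)%:E)]
      - slicedMK p q mu1 mu2 |
   <= (alpha_const n.+2 p / 2)%:E *
      sphereMK p w `^ (p / (n.+2%:R - 1 + p)) *
      (moment p mu1 `^ p^-1 + moment p mu2 `^ p^-1))%E.
Proof.
move=> p1 q1 L0 winj [T [[lam TE] Tlaw Tcost] DE] M1 M2.
have p0 : 0 < p := lt_trans ltr01 p1; have p1' := ltW p1.
set M := (moment p mu1 `^ p^-1 + moment p mu2 `^ p^-1)%E.
have Mge : (0 <= M)%E by rewrite adde_ge0// poweR_ge0.
have Mfin : M \is a fin_num.
  by rewrite fin_numD !ge0_fin_numE ?poweR_ge0// !poweR_lty.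
have M0 : 0 <= fine M by rewrite fine_ge0.
have sge x : (0 <= sliceMK p mu1 mu2 x)%E.
  by apply: le_ereal_inf_tmp => _ [g _ <-]; exact: poweR_ge0.
have sle x : (sliceMK p mu1 mu2 x <= M)%E by exact: sliceMK_le.
pose f x := fine (sliceMK p mu1 mu2 x).
have fE x : sliceMK p mu1 mu2 x = (f x)%:E.
  by rewrite /f fineK// ge0_fin_numE// (le_lt_trans (sle x))// ltey_eq Mfin.
have f0 x : 0 <= f x by rewrite fine_ge0.
have fM x : `|f x| <= fine M.
  by rewrite ger0_norm// -lee_fin -fE fineK.
have flip x y : `|f x - f y| <= fine M * sphere_dist x y.
  have h u v : f u <= f v + fine M * sphere_dist u v.
    have := sliceMK_lip p1' v u M1 M2; rewrite -/M !fE -(fineK Mfin) -EFinM -EFinD lee_fin.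
    move=> /le_trans; apply; rewrite lerD2l mulrC ler_wpM2l//.
    exact: chord_le_sphere_dist.
  rewrite ler_norml; have := h x y; have := h y x; rewrite (sphere_distC y).
  by move=> h1 h2; apply/andP; split; lra.
have mf : measurable_fun setT f.
  by apply: sphere_continuous_measurable; exact: sphere_lipschitz_continuous M0 flip.
pose U := \bigcup_l strict_cell p w lam l.
have mU : measurable U.
  by apply: open_measurable_sphere; apply: bigcup_open => l _; exact: open_strict_cell.
(* The push-forward condition for the whole sphere: T is defined almost everywhere, since the
   empirical measure has mass 1 for L > 0. *)
have domT : sphere_prob R n.+1 U = 1%E.
  have := Tlaw _ measurableT; rewrite /empirical.
  have -> : T @^-1` (Some @` setT) = U.
    apply/seteqP; split => x /=.
      by move=> [y _ /esym Ty]; have [l _ hl] := (TE x y).1 Ty; exists l.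
    by move=> [l _ hl]; exists (w l) => //; apply/esym/TE; exists l.
  move=> ->; under eq_bigr do rewrite diracT.
  rewrite sumEFin sumr_const card_ord -EFinM mulVf// pnatr_eq0.
  by rewrite -lt0n.
(* Here the points have to be distinct, as otherwise the value w l could also be taken on another
   cell. *)
have TwE l : T @^-1` [set Some (w l)] = strict_cell p w lam l.
  apply/seteqP; split => x /=.
    by move=> /TE [k /winj <-].
  by move=> hl; apply/TE; exists l.
pose C l := closure (strict_cell p w lam l).
have DCE l : D l = C l `\` \bigcup_(k in [set k : 'I_L | (k < l)%N]) D k.
  by rewrite {1}DE TwE.
have mC l : measurable (C l).
  rewrite -[C l]setCK; apply: measurableC; apply: open_measurable_sphere.
  by apply: closed_openC; exact: closed_closure.
(* The complement of the closures is open because they are finitely many, and null because it misses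
   the domain of T. *)
have cC x : exists l, C l x.
  pose V := ~` \bigcup_l C l.
  have oV : open V.
    apply: closed_openC; apply: closed_bigcup; first exact: finite_finset.
    by move=> l _; exact: closed_closure.
  have mV := open_measurable_sphere oV.
  have V0 : V = set0.
    apply: open_null_set0 oV _; apply/eqP; rewrite eq_le measure_ge0 andbT.
    have UC : sphere_prob R n.+1 (~` U) = 0%E by rewrite probability_setC// domT subee.
    rewrite -UC; apply: le_measure; rewrite ?inE.
    - exact: mV.
    - exact: measurableC.
    move=> y Vy [l _ hl]; apply: Vy; exists l => //; exact: subset_closure.
  have : ~ V x by rewrite V0.
  by move=> /contrapT [l _ Cl]; exists l.
pose g x := \sum_(l < L) f (w l) * \1_(D l) x.
have mg : measurable_fun setT g.
  apply: measurable_sum => l; apply: measurable_funM => //; apply: measurable_indic.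
  exact: measurable_disjointified DCE mC l.
pose K := (\int[sphere_prob R n.+1]_x (transport_cost p T x)%:E)%E.
have Klt : (K < +oo)%E := transport_cost_lty p1 TE.
have K0 : (0 <= K)%E by apply: integral_ge0 => x _; rewrite lee_fin transport_cost_ge0.
have KE : (sphereMK p w `^ p)%E = K by rewrite -Tcost.
set N := n.+2%:R - 1 + p.
pose r := alpha_const n.+2 p / 2 * fine K `^ N^-1.
have rad l x : C l x -> sphere_dist x (w l) <= r.
  by move=> Cl; exact: (cell_radius_bound p1 TE domT Cl).
have r0 : 0 <= r.
  by have [l Cl] := cC point; apply: le_trans (rad _ _ Cl); exact: sphere_dist_ge0.
have gf x : `|g x - f x| <= fine M * r.
  have [l Dl] := disjointified_cover DCE cC x.
  rewrite /g (sum_disjointified DCE _ Dl); apply: le_trans (flip _ _) _.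
  rewrite ler_wpM2l// sphere_distC.
  by apply: rad; exact: (disjointified_sub DCE) Dl.
have -> : (fun x => \sum_(l < L) sliceMK p mu1 mu2 (w l) * (\1_(D l) x)%:E)%E = EFin \o g.
  by apply/funext => x; rewrite /g /= -sumEFin; apply: eq_bigr => l _; rewrite fE EFinM.
rewrite /slicedMK (_ : sliceMK p mu1 mu2 = EFin \o f); last by apply/funext => x; rewrite fE.
apply: le_trans (dist_Lnorm_le (sphere_prob R n.+1) q1 (mulr_ge0 M0 r0) M0 mf mg fM gf) _.
have MKge : (0 <= sphereMK p w)%E.
  by apply: le_ereal_inf_tmp => _ [h _ <-]; exact: poweR_ge0.
(* The p-th power of [sphereMK p w] is the finite cost K, which excludes an infinite distance and
   turns the exponent p / N into 1 / N on K. *)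
have MKE : (sphereMK p w `^ (p / N) = (fine K `^ N^-1)%:E)%E.
  move: KE MKge Klt; case: (sphereMK p w) => [s||]//=; last by rewrite (gt_eqF p0) => <-.
  by rewrite lee_fin => <- s0 _ /=; rewrite powRrM.
rewrite MKE -(fineK Mfin) -!EFinM lee_fin le_eqVlt; apply/orP; left; apply/eqP.
by rewrite /r; ring.
Qed.
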